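(* Let $G=[g_1,\ldots,g_n]$ be a finitely generated transcendental semigroup. Suppose that $\Gamma_i$, $1\le i\le n$, are curves going to $\infty$ and that $g_i|_{\Gamma_i}$ is bounded for each $1\le i\le n$. Then all the components of $F(G)$ are simply connected.
   Context: $G=[g_1,\ldots,g_n]$ is the set of all finite compositions (of length at least one) of the transcendental entire functions $g_1,\ldots,g_n$. The Fatou set $F(G)$ is the largest open subset of $\mathbb{C}$ on which the family $G$ is normal (every sequence in $G$ has a subsequence converging locally uniformly to a holomorphic function or to $\infty$). *)

(* Defs.v *)
From HB Require Import structures.
From mathcomp Require Import all_boot all_order all_algebra.
From mathcomp Require Import complex.
From mathcomp Require Import all_classical all_reals all_analysis.

Set Implicit Arguments.
Unset Strict Implicit.
Unset Printing Implicit Defensive.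

Import Order.TTheory GRing.Theory Num.Theory.
Import numFieldNormedType.Exports.
Local Open Scope classical_set_scope.
Local Open Scope ring_scope.
Local Open Scope complex_scope.

Section Definitions.
Variable R : realType.
(* R[i] as a normed module over itself, so that [derivable _ _ 1] is complex
   differentiability. *)
Local Notation C := (R[i]^o).

Definition holomorphic_on (W : set C) (f : C -> C) : Prop :=
  forall z, W z -> derivable f z (1 : R[i]).

Definition entire (f : C -> C) : Prop := holomorphic_on setT f.

Definition transcendental_entire (f : C -> C) : Prop :=
  entire f /\ ~ exists p : {poly R[i]}, forall z, f z = p.[z].

Inductive generated_semigroup (n : nat) (g : 'I_n -> C -> C) : set (C -> C) :=
| generated_semigroup_gen i : generated_semigroup g (g i)
| generated_semigroup_comp f h :
    generated_semigroup g f -> generated_semigroup g h ->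
    generated_semigroup g (f \o h).

Definition cvg_locally_uniformly_on (W : set C) (u : nat -> C -> C)
    (h : C -> C) : Prop :=
  forall z, W z -> exists2 V, nbhs z V & {uniform V, u @ \oo --> h}.

Definition cvg_locally_uniformly_infty_on (W : set C) (u : nat -> C -> C)
    : Prop :=
  forall z, W z -> exists2 V, nbhs z V &
    forall M : R, \forall k \near \oo, forall w, V w -> M%:C < `|u k w|.

Definition normal_on (W : set C) (G : set (C -> C)) : Prop :=
  forall u : nat -> C -> C, (forall k, G (u k)) ->
  exists phi : nat -> nat, {homo phi : i j / (i < j)%N} /\
    ((exists2 h, holomorphic_on W h &
        cvg_locally_uniformly_on W (u \o phi) h) \/
     cvg_locally_uniformly_infty_on W (u \o phi)).

(* The union of the open sets of normality, i.e. the set of points having a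
   neighbourhood on which G is normal.  It is the largest open set on which G
   is normal when, as usual, the alternative in [normal_on] (holomorphic limit
   or infinity) is allowed to vary between the components of a disconnected
   set. *)
Definition fatou_set (G : set (C -> C)) : set C :=
  \bigcup_(W in [set W | open W /\ normal_on W G]) W.

Definition curve_to_infty (Gamma : set C) : Prop :=
  exists gamma : R -> C,
    [/\ {within `[0, +oo[, continuous gamma},
        forall M : R, \forall t \near +oo, M%:C < `|gamma t|
      & Gamma = gamma @` `[0, +oo[].

Definition closed_curve_in (U : set C) (gamma : R -> C) : Prop :=
  [/\ {within `[0, 1], continuous gamma}, gamma @` `[0, 1] `<=` U
    & gamma 0 = gamma 1].

(* Homotopic in U, through closed curves, to a constant curve. *)
Definition null_homotopic_in (U : set C) (gamma : R -> C) : Prop :=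
  exists (H : R * R -> C) (c : C),
    [/\ {within `[0, 1] `*` `[0, 1], continuous H},
        H @` (`[0, 1] `*` `[0, 1]) `<=` U,
        forall t : R, 0 <= t <= 1 -> H (0, t) = gamma t,
        forall t : R, 0 <= t <= 1 -> H (1, t) = c
      & forall s : R, 0 <= s <= 1 -> H (s, 0) = H (s, 1)].

(* Applied to open sets of the plane, where connected and path connected
   agree. *)
Definition simply_connected (U : set C) : Prop :=
  connected U /\
  forall gamma, closed_curve_in U gamma -> null_homotopic_in U gamma.

End Definitions.

(* Main.v *)
(** Let [gamma] be a closed curve in the Fatou set [F], and suppose that a
   bounded open set [W] has its boundary in a compact connected set
   [K `<=` F]; the point is that then [W `<=` F].  A sequence of elements [u_k]
   of the semigroup has a subsequence that, on [K], either converges uniformly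
   or tends to infinity.  In the first case the maximum principle gives
   convergence on [W].  In the second case either infinitely many [u_k] have no
   zero in [W], and the minimum principle shows that they tend to infinity on
   [W], or [u_k @` W] contains discs about [0] of radii tending to infinity.
   Then [u_k @` K] meets the curve on which the generator [g_1] is bounded, so
   that [g_1 \o u_k], again in the semigroup, cannot tend to infinity on [K]; a
   subsequence is bounded on [K], hence on [W], so [g_1] is bounded on the whole
   plane and is constant by Liouville's theorem.

   The theory of holomorphic functions is obtained without Cauchy's formula.
   Goursat's bisection argument gives local primitives.  Difference quotients
   of primitives are twice differentiable, which yields the maximum principle
   by comparing the value at a point with those at the four vertices of a small
   square.  Applied to [(z - a) * ((f z - f a) / (z - a)) ^ n] as [n] tends to
   infinity, it gives a bound of Schwarz type, whence Liouville's theorem and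
   the differentiability of uniform limits.

   To contract [gamma], approximate it by a path in a fine square lattice and
   add the bounded components of the complement of that path; by the above, the
   resulting finite lattice set stays inside [F].  A finite connected lattice
   set without holes is contractible: remove the rightmost point of its top row,
   or, when that point disconnects the set, contract the two sides one after
   the other.  The homotopy is interpolated from the lattice with hat functions. *)

Require Import Defs.
From mathcomp Require Import all_boot all_order all_algebra.
From mathcomp Require Import complex ring lra zify.
From mathcomp Require Import all_classical all_reals all_analysis.
Import Order.TTheory GRing.Theory Num.Theory.
Import numFieldNormedType.Exports.
Local Open Scope ring_scope.

(** * Lattice sets without holes *)

(** A null-homotopy has to be exhibited, so the topology is made combinatorial. Paths inside a
    lattice set use 4-adjacency and paths in its complement 8-adjacency: with this pairing no
    complementary path crosses a closed path of the set, and absence of holes is strong enough to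
    yield a contraction. A hole of the lattice path can be large compared with the mesh and is a
    priori unrelated to the Fatou set; hence the filling statement concerns any bounded open set
    whose boundary lies in [K], and [K] is taken to be a tube around the curve. On the analytic
    side, the comparison at four points needs an expansion of order two, whereas a holomorphic
    function is at first known to have only one of order one. A primitive gains one order, and its
    difference quotients bring this gain to functions uniformly close to the original one. No
    argument principle is at hand to count values: that a value [w] is attained by [u] comes from
    the minimum principle for [u - w]. *)

Ltac bool_cases :=
  repeat (case: (boolP (_ < _)) => ? /=; try by exfalso; lia);
  repeat (case: eqP => ? //=; try by exfalso; lia).

Section Lattice.

Definition pt := (int * int)%type.
Implicit Types (p q x y z v b : pt) (V S : pt -> Prop) (s : seq pt).

(* 4- and 8-adjacency in the square lattice, both reflexive. *)
Definition a4 p q := (p.1 = q.1 /\ -1 <= p.2 - q.2 <= 1) \/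
                     (p.2 = q.2 /\ -1 <= p.1 - q.1 <= 1).
Definition a8 p q := -1 <= p.1 - q.1 <= 1 /\ -1 <= p.2 - q.2 <= 1.

Lemma pt_eq p q : p.1 = q.1 -> p.2 = q.2 -> p = q.
Proof. by case: p q => [? ?] [? ?] /= -> ->. Qed.

Lemma pt_neq p q : p <> q -> p.1 <> q.1 \/ p.2 <> q.2.
Proof.
move=> pq; have [h|h] := eqVneq p.1 q.1; last by left; apply/eqP.
by right=> h2; apply: pq; exact: pt_eq.
Qed.

Inductive conn (e : pt -> pt -> Prop) (S : pt -> Prop) : pt -> pt -> Prop :=
| conn_refl x : S x -> conn e S x x
| conn_step x y z : S x -> e x y -> conn e S y z -> conn e S x z.

Lemma conn_trans e S x y z : conn e S x y -> conn e S y z -> conn e S x z.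
Proof. by elim=> // {}x w {}y Sx xw _ IH /IH; exact: conn_step. Qed.

Lemma conn_ends e S x y : conn e S x y -> S x /\ S y.
Proof. by elim=> // {}x w {}y Sx xw _ []. Qed.

Lemma conn_sym e S x y : (forall p q, e p q -> e q p) -> conn e S x y ->
  conn e S y x.
Proof.
move=> se; elim=> [{}x Sx|{}x w {}y Sx xw cwy IH]; first exact: conn_refl.
apply: conn_trans IH _; apply: (conn_step _ _ _ x); last exact: conn_refl.
  by have [] := conn_ends _ _ _ _ cwy.
exact: se.
Qed.

Lemma conn_sub e (S S' : pt -> Prop) x y : (forall p, S p -> S' p) ->
  conn e S x y -> conn e S' x y.
Proof.
move=> SS; elim=> [{}x Sx|{}x w {}y Sx xw cwy IH]; first by apply: conn_refl;
  exact: SS.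
by apply: conn_step IH => //; exact: SS.
Qed.

Lemma a4_sym p q : a4 p q -> a4 q p.
Proof. rewrite /a4; lia. Qed.

Lemma a8_sym p q : a8 p q -> a8 q p.
Proof. rewrite /a8; lia. Qed.

Lemma a4_a8 p q : a4 p q -> a8 p q.
Proof. rewrite /a4 /a8; lia. Qed.

Lemma conn_map e S S' (f : pt -> pt) x y :
  (forall p, S p -> S' (f p)) -> (forall p q, S p -> S q -> e p q ->
    e (f p) (f q)) ->
  conn e S x y -> conn e S' (f x) (f y).
Proof.
move=> Sf ef; elim=> [{}x Sx|{}x w {}y Sx xw cwy IH]; first by apply: conn_refl;
  exact: Sf.
have [Sw _] := conn_ends _ _ _ _ cwy.
by apply: conn_step IH; [exact: Sf|exact: ef].
Qed.

(* Horizontal edges crossed by the vertical ray going up from a point slightly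
   to the right of [q]; the parity of the number of crossings is a mod-2
   winding number. *)
Definition cross q x y : bool :=
  [&& x.2 == y.2, q.2 < x.2 &
     ((x.1 == q.1) && (y.1 == q.1 + 1)) || ((y.1 == q.1) && (x.1 == q.1 + 1))].

Fixpoint parity q x s : bool :=
  if s is y :: s' then cross q x y (+) parity q y s' else false.

Fixpoint chain S x s : Prop :=
  if s is y :: s' then [/\ S x, a4 x y & chain S y s'] else S x.

Lemma conn_chain S x y : conn a4 S x y -> exists2 s, chain S x s & last x s = y.
Proof.
elim=> [{}x Sx|{}x w {}y Sx xw _ [s cs ls]]; first by exists [::].
by exists (w :: s).
Qed.

Lemma chain_head S x s : chain S x s -> S x.
Proof. by case: s => // y s []. Qed.

Lemma chain_sub S S' x s : (forall p, S p -> S' p) -> chain S x s ->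
  chain S' x s.
Proof.
move=> SS; elim: s x => [|y s IH] x /=; first exact: SS.
by move=> [Sx xy cs]; split => //; [exact: SS|exact: IH].
Qed.

Lemma chain_rcons S x s y : chain S x s -> a4 (last x s) y -> S y ->
  chain S x (rcons s y).
Proof.
elim: s x => [|w s IH] x /=; first by move=> Sx xy Sy.
by move=> [Sx xw cs] l Sy; split => //; exact: IH.
Qed.

Lemma parity_rcons q x s y : parity q x (rcons s y) = parity q x s (+) cross q
  (last x s) y.
Proof. by elim: s x => [|w s IH] x /=; rewrite ?addbF ?addFb // IH addbA. Qed.

Definition on_ray q x : bool := (x.1 == q.1) && (q.2 < x.2).

(** The edges crossed by the two rays enter or leave the column of [q'] from its left and from its
    right, so away from [q] and [q'] the sum of the two counts is the coboundary of [on_ray q']: a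
    vertical edge could leave that ray only through [q'], and horizontal edges at a height reached
    by only one of the rays touch [q] or [q']. *)
Lemma cross_shift q q' x y : q'.1 = q.1 + 1 -> -1 <= q'.2 - q.2 <= 1 ->
  a4 x y ->
  x <> q -> x <> q' -> y <> q -> y <> q' ->
  cross q x y (+) cross q' x y = on_ray q' x (+) on_ray q' y.
Proof.
move=> h1 h2 h3 /pt_neq h4 /pt_neq h5 /pt_neq h6 /pt_neq h7.
rewrite /cross /on_ray; case: h3 => -[e h3]; rewrite ?e.
  bool_cases.
bool_cases.
Qed.

Lemma parity_shift q q' x s : q'.1 = q.1 + 1 -> -1 <= q'.2 - q.2 <= 1 ->
  chain (fun p => p <> q /\ p <> q') x s ->
  parity q x s (+) parity q' x s = on_ray q' x (+) on_ray q' (last x s).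
Proof.
move=> h1 h2; elim: s x => [|y s IH] x /=; first by rewrite addbb.
move=> [[xq xq'] xy cs]; have [yq yq'] := chain_head _ _ _ cs.
rewrite addbACA (cross_shift q q')// IH//.
by case: (on_ray q' x); case: (on_ray q' y); case: (on_ray q' _).
Qed.

(** The only edges counted for [q] and not for [q'] are at the height of [q'], where they have [q']
    as an endpoint. *)
Lemma parity_up q q' x s : q'.1 = q.1 -> q'.2 = q.2 + 1 ->
  chain (fun p => p <> q /\ p <> q') x s -> parity q x s = parity q' x s.
Proof.
move=> h1 h2; elim: s x => [|y s IH] x //=.
move=> [[_ /pt_neq xq'] xy cs]; have [_ /pt_neq yq'] := chain_head _ _ _ cs.
rewrite IH//; congr (_ (+) _); rewrite /cross; lia.
Qed.

Lemma parity_a8 q q' x s : a8 q q' -> last x s = x ->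
  chain (fun p => p <> q /\ p <> q') x s -> parity q x s = parity q' x s.
Proof.
move=> [h1 h2] lx cs.
have cs' : chain (fun p => p <> q' /\ p <> q) x s
  by apply: chain_sub cs => p [].
have cases : q = q' \/ q'.1 = q.1 + 1 \/ q.1 = q'.1 + 1 \/ (q'.1 = q.1 /\ q'.2 =
  q.2 + 1) \/ (q.1 = q'.1 /\ q.2 = q'.2 + 1).
  have [h|/pt_neq h] := pselect (q = q'); first by left.
  by right; lia.
case: cases => [->//|[h|[h|[[? ?]|[? ?]]]]].
- have h2' : -1 <= q'.2 - q.2 <= 1 by lia.
  by have := parity_shift q q' x s h h2' cs; rewrite lx addbb;
    case: (parity q x s); case: (parity q' x s).
- have := parity_shift q' q x s h h2 cs'; rewrite lx addbb.
  by case: (parity q x s); case: (parity q' x s).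
- exact: parity_up.
- by apply/esym; exact: parity_up.
Qed.

(** The digital Jordan property behind the choice of adjacencies: an 8-path outside [V] cannot cross
    a closed 4-path inside it, so the winding parity is constant along the 8-path. *)
Lemma parity_conn V q q' x s : conn a8 (fun p => ~ V p) q q' -> last x s = x ->
  chain V x s -> parity q x s = parity q' x s.
Proof.
move=> cq lx cs; elim: cq => // {q q'} q w q' nVq qw cwq' <-.
have [nVw _] := conn_ends _ _ _ _ cwq'.
apply: parity_a8 => //; apply: chain_sub cs => p Vp; split=> pE; subst p; by [].
Qed.

Lemma parity_below q x s : chain (fun p => p.2 <= q.2) x s ->
  parity q x s = false.
Proof.
elim: s x => //= y s IH x [xq _ /IH ->]; rewrite addbF /cross; lia.
Qed.

(* [q] lies in the unbounded 8-component of the complement of [V]. *)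
Definition escapes V q :=
  exists2 q', conn a8 (fun p => ~ V p) q q' & forall p, V p -> p.2 < q'.2.

Lemma escapes_sub V V' q : (forall p, V' p -> V p) -> escapes V q ->
  escapes V' q.
Proof.
move=> VV [q' c h]; exists q'; last by move=> p /VV; exact: h.
by apply: conn_sub c => p nVp /VV.
Qed.

(* Closing such a path through [v] would separate the diagonal neighbour [d]
   from infinity. *)
Lemma corner_separates V v (l D d : pt) :
  (forall p, V p -> p.2 <= v.2) -> V v -> V l ->
  l.1 = v.1 - 1 -> l.2 = v.2 -> D.1 = v.1 -> D.2 = v.2 - 1 ->
  d.1 = v.1 - 1 -> d.2 = v.2 - 1 -> escapes V d ->
  ~ conn a4 (fun p => V p /\ p <> v) l D.
Proof.
move=> top Vv Vl l1 l2 D1 D2 d1 d2 [q' cq' hq'] /conn_chain[s cs ls].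
have cV : chain V l s by apply: chain_sub cs => p [].
have clo : chain V v (l :: rcons s v).
  split => //; first by rewrite /a4; lia.
  by apply: chain_rcons => //; rewrite ls /a4; lia.
have lst : last v (l :: rcons s v) = v by rewrite /= last_rcons.
have E := parity_conn V d q' v _ cq' lst clo.
have P0 : parity q' v (l :: rcons s v) = false.
  by apply: parity_below; apply: chain_sub clo => p /hq' /ltW.
(* An edge of this path crossing the ray of [d] would lie in the top row, between the columns of [l]
   and [v], and so have [v] as an endpoint. *)
have P1 : parity d l s = false.
  have : chain (fun p => p.2 <= v.2 /\ p <> v) l s
    by apply: chain_sub cs => p [/top].
  elim: s {cs ls cV clo lst E P0} (l) => //= y s IH x [[xv /pt_neq nv] xy c].
  rewrite IH// addbF; have [yv /pt_neq nyv] := chain_head _ _ _ c.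
  rewrite /cross; lia.
(* The closing edge from [D] to [v] is vertical, so the edge from [v] to [l] is the only crossing
   and the parity is odd. *)
move: E; rewrite P0 /= parity_rcons P1 ls /cross; lia.
Qed.

(* [f] is joined to the constant map [b] by adjacency-preserving maps fixing
   [b]; no such condition is put on [f] itself, only on the maps after it. *)
Inductive deform V b : (pt -> pt) -> Prop :=
| deform_const f : (forall x, V x -> f x = b) -> deform V b f
| deform_step f g : (forall x, V x -> V (g x)) ->
    (forall x y, V x -> V y -> a4 x y -> a4 (g x) (g y)) ->
    (forall x, V x -> a8 (f x) (g x)) -> g b = b -> deform V b g ->
      deform V b f.

Lemma deform_ext V b f f' : (forall x, V x -> f x = f' x) -> deform V b f ->
  deform V b f'.
Proof.
move=> ff' H; elim: H f' ff' => {f} [f h|f g Vg ag fg gb dg _] f' ff'.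
  by apply: deform_const => x Vx; rewrite -ff'// h.
by apply: (deform_step _ _ _ g) => // x Vx; rewrite -ff'//; exact: fg.
Qed.

Lemma deform_retract V V' b f r : (forall x, V' x -> V x) ->
  (forall x, V x -> V' (r x)) -> (forall x y, V x -> V y -> a4 x y ->
    a4 (r x) (r y)) ->
  r b = b -> deform V' b f -> deform V b (f \o r).
Proof.
move=> VV Vr ar rb; elim=> {f} [f h|f g Vg ag fg gb dg IH].
  by apply: deform_const => x Vx; apply: h; exact: Vr.
apply: (deform_step _ _ _ (g \o r)) => //=.
- by move=> x Vx; apply/VV/Vg/Vr.
- by move=> x y Vx Vy xy; apply: ag; [exact: Vr|exact: Vr|exact: ar].
- by move=> x Vx; apply/fg/Vr.
- by rewrite rb.
Qed.

Lemma a4_refl p : a4 p p.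
Proof. rewrite /a4; lia. Qed.

Lemma a8_refl p : a8 p p.
Proof. rewrite /a8; lia. Qed.

(** The stages contracting [V2] fix [v], and the two pieces touch only at [v], so extending these
    stages by the identity of [V1] keeps adjacency. *)
Lemma deform_wedge V V1 V2 v b :
  (forall x, V x <-> V1 x \/ V2 x) -> (forall x, V1 x -> V2 x -> x = v) ->
  V1 v -> V2 v -> (forall x y, V1 x -> V2 y -> a4 x y -> x = v \/ y = v) ->
  V1 b -> deform V2 v id -> deform V1 b id -> deform V b id.
Proof.
move=> VE V12 V1v V2v sep V1b d2 d1.
pose ext (f : pt -> pt) x := if `[< V2 x >] then f x else x.
have ext2 f x : V2 x -> ext f x = f x by rewrite /ext; case: asboolP.
have ext1 f x : ~ V2 x -> ext f x = x by rewrite /ext; case: asboolP.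
have ext_adj f : (forall x y, V2 x -> V2 y -> a4 x y -> a4 (f x) (f y)) ->
  f v = v ->
    forall x y, V x -> V y -> a4 x y -> a4 (ext f x) (ext f y).
  move=> hf fv x y /VE Vx /VE Vy xy.
  have [x2|x2] := pselect (V2 x); have [y2|y2] := pselect (V2 y).
  - by rewrite !ext2//; exact: hf.
  - have y1 : V1 y by case: Vy.
    rewrite (ext2 _ x)// (ext1 _ y)//; have [yv|->] :=
      sep y x y1 x2 (a4_sym _ _ xy).
      by exfalso; apply: y2; rewrite yv.
    rewrite fv; suff <- : x = v by [].
    by have [yv|//] := sep y x y1 x2 (a4_sym _ _ xy); exfalso; apply: y2;
      rewrite yv.
  - have x1 : V1 x by case: Vx.
    rewrite (ext1 _ x)// (ext2 _ y)//; have [xv|yv] := sep x y x1 y2 xy.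
      by exfalso; apply: x2; rewrite xv.
    by rewrite yv fv -yv.
  - by rewrite !ext1.
have extb f : f v = v -> ext f b = b.
  move=> fv; have [b2|b2] := pselect (V2 b); last exact: ext1.
  by rewrite ext2// (V12 b).
suff H f : deform V2 v f -> deform V b (ext f).
  by apply: deform_ext (H id d2) => x _; rewrite /ext; case: asboolP.
elim=> {f} [f h|f g Vg ag fg gv dg IH].
  have fv : f v = v by exact: h.
  (* The last stage maps [V2] to [v], so its extension retracts [V] onto [V1], and the contraction
     of [V1] takes over. *)
  have rho : deform V b (id \o ext f).
    apply: (deform_retract _ V1) => //.
    - by move=> x V1x; apply/VE; left.
    - move=> x /VE Vx; have [x2|x2] := pselect (V2 x); first
      by rewrite ext2// h.
      by rewrite ext1//; case: Vx.
    - by apply: ext_adj => // x y x2 y2 _; rewrite !h//; exact: a4_refl.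
    - exact: extb.
  exact: rho.
apply: (deform_step _ _ _ (ext g)) => //.
- move=> x /VE Vx; apply/VE; have [x2|x2] := pselect (V2 x).
    by right; rewrite ext2//; exact: Vg.
  by left; rewrite ext1//; case: Vx.
- exact: ext_adj.
- move=> x /VE Vx; have [x2|x2] := pselect (V2 x); first by rewrite !ext2//;
  exact: fg.
  by rewrite !ext1//; exact: a8_refl.
- exact: extb.
Qed.

(** Meant for the reflection in the origin, which exchanges top right and bottom left corners. *)
Lemma deform_conj V V' b f (n : pt -> pt) : involutive n ->
  (forall x, V' (n x) <-> V x) -> (forall x y, a4 x y -> a4 (n x) (n y)) ->
  (forall x y, a8 x y -> a8 (n x) (n y)) ->
  deform V' (n b) f -> deform V b (n \o f \o n).
Proof.
move=> nn VV n4 n8; elim=> {f} [f h|f g Vg ag fg gb dg IH].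
  by apply: deform_const => x Vx /=; rewrite h ?nn//; apply/VV.
apply: (deform_step _ _ _ (n \o g \o n)) => //=.
- by move=> x Vx; apply/VV; rewrite nn; apply/Vg/VV.
- by move=> x y Vx Vy xy; apply/n4/ag; [apply/VV|apply/VV|exact: n4].
- by move=> x Vx; apply/n8/fg/VV.
- by rewrite gb nn.
Qed.

End Lattice.

(** * Contraction of finite lattice sets, by induction on their size *)

Section LatticeSets.
Implicit Types (p q x y z v b l : pt) (V : seq pt).

Definition mems V : pt -> Prop := fun x => x \in V.
Definition connected_pts V := forall x y, mems V x -> mems V y ->
  conn a4 (mems V) x y.
Definition hole_free V := forall q, ~ mems V q -> escapes (mems V) q.
(** Such a [v] has no right or upper neighbour in [V]; only the left and the lower one remain to be
    discussed. *)
Definition top_right V v := mems V v /\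
  forall p, mems V p -> p.2 < v.2 \/ (p.2 = v.2 /\ p.1 <= v.1).

Lemma top_right_exists V x : mems V x -> exists v, top_right V v.
Proof.
elim: V x => // y s IH x _.
have [[z zs]|ne] := pselect (exists z, mems s z); last first.
  exists y; split; first by rewrite /mems in_cons eqxx.
  move=> p; rewrite /mems in_cons => /orP[/eqP ->|ps]; first by right; split.
  by exfalso; apply: ne; exists p.
have [v [vs hv]] := IH z zs.
have [h|h] := pselect (v.2 < y.2 \/ (v.2 = y.2 /\ v.1 <= y.1)).
  exists y; split; first by rewrite /mems in_cons eqxx.
  move=> p; rewrite /mems in_cons => /orP[/eqP ->|/hv ps]; first by right;
    split.
  by lia.
exists v; split; first by rewrite /mems in_cons vs orbT.
move=> p; rewrite /mems in_cons => /orP[/eqP ->|/hv //]; lia.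
Qed.

Lemma mems_filter V (a : pred pt) x : mems (seq.filter a V) x <->
  a x /\ mems V x.
Proof. by rewrite /mems mem_filter; split=> [/andP|] // [-> ->]. Qed.

Lemma size_filter_lt V (a : pred pt) x : mems V x -> ~~ a x ->
  (size (seq.filter a V) < size V)%N.
Proof.
move=> Vx nax; rewrite size_filter -(count_predC a V) -[X in (X < _)%N]addn0
  ltn_add2l.
by rewrite -has_count; apply/hasP; exists x.
Qed.

Lemma escapes_step V q q' : ~ mems V q -> a8 q q' -> escapes (mems V) q' ->
  escapes (mems V) q.
Proof. by move=> nq qq' [r c hr]; exists r => //; exact: conn_step c. Qed.

Lemma escapes_conn V q q' : conn a8 (fun p => ~ mems V p) q q' ->
  escapes (mems V) q' -> escapes (mems V) q.
Proof. by move=> c [r c' hr]; exists r => //; exact: conn_trans c c'. Qed.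

Lemma escapes_above V q : ~ mems V q -> (forall p, mems V p -> p.2 < q.2) ->
  escapes (mems V) q.
Proof. by move=> nq h; exists q => //; exact: conn_refl. Qed.

Lemma conn_inside (S : pt -> Prop) x y : conn a4 S x y ->
  conn a4 (conn a4 S x) x y.
Proof.
have H z w : conn a4 S z w -> conn a4 S x z -> conn a4 (conn a4 S x) z w.
  elim=> [{}z Sz|{}z u {}w Sz zu cuw IH] xz; first exact: conn_refl.
  apply: (conn_step _ _ _ u) => //; apply: IH; apply: (conn_trans _ _ _ _ _ xz).
  by apply: (conn_step _ _ _ u) => //; apply: conn_refl; have [] :=
    conn_ends _ _ _ _ cuw.
by move=> c; apply: H => //; apply: conn_refl; have [] := conn_ends _ _ _ _ c.
Qed.

Lemma mems_bounded V : exists N : int, forall p, mems V p ->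
  -N <= p.1 <= N /\ -N <= p.2 <= N.
Proof.
elim: V => [|y s [N hN]]; first by exists 0.
exists (N + `|N| + `|y.1| + `|y.2|) => p;
  rewrite /mems in_cons => /orP[/eqP ->|/hN]; lia.
Qed.

Lemma conn_horizontal (S : pt -> Prop) (p : pt) (X : int) : p.1 <= X ->
  (forall k, S (k, p.2)) -> conn a8 S p (X, p.2).
Proof.
move=> pX HS; have [n ->] : exists n : nat, X = p.1 + n%:Z
  by exists `|X - p.1|%N; lia.
elim: n {X pX} => [|n IH].
  by rewrite addr0 -surjective_pairing; apply: conn_refl;
    rewrite [p]surjective_pairing.
apply: conn_trans IH _; apply: (conn_step _ _ _ (p.1 + n.+1%:Z, p.2)) => //.
  by rewrite /a8 /=; lia.
exact: conn_refl.
Qed.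

Lemma conn_vertical (S : pt -> Prop) (x y y' : int) : y <= y' ->
  (forall k, S (x, k)) -> conn a8 S (x, y) (x, y').
Proof.
move=> pX HS; have [n ->] : exists n : nat, y' = y + n%:Z by exists `|y' - y|%N;
  lia.
elim: n {y' pX} => [|n IH]; first by rewrite addr0; exact: conn_refl.
apply: conn_trans IH _; apply: (conn_step _ _ _ (x, y + n.+1%:Z)) => //.
  by rewrite /a8 /=; lia.
exact: conn_refl.
Qed.

Definition contractible_below V := forall V' b, (size V' < size V)%N ->
  connected_pts V' -> hole_free V' -> mems V' b -> deform (mems V') b id.

(** Folding [v] onto [w] and fixing the rest preserves adjacency because every neighbour of [v] is
    equal or adjacent to [w]. The fold may be diagonal, which is why successive stages of [deform]
    are only required to be 8-adjacent. *)
Lemma deform_simple_corner V v w b : contractible_below V -> connected_pts V ->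
  hole_free V -> mems V b -> v <> b -> top_right V v -> mems V w -> w <> v ->
  (forall x, mems V x -> x <> v -> a4 x v -> a4 x w) -> a8 v w ->
    deform (mems V) b id.
Proof.
move=> IH cV hV Vb vb [Vv top] Vw wv hw vw.
pose V' := [seq x <- V | x != v].
pose r x := if x == v then w else x.
have V'E x : mems V' x <-> x <> v /\ mems V x.
  by rewrite mems_filter; split=> -[h1 h2]; split=> //; apply/eqP.
have rV x : mems V x -> mems V' (r x).
  by move=> Vx; apply/V'E; rewrite /r; case: eqP => // _; split.
have rv x : x <> v -> r x = x by rewrite /r; case: eqP.
have ra x y : mems V x -> mems V y -> a4 x y -> a4 (r x) (r y).
  move=> Vx Vy xy; rewrite /r; case: eqP => [xv|xv]; case: eqP => [yv|yv] //.
  - exact: a4_refl.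
  - by apply/a4_sym/hw => //; apply: a4_sym; rewrite -xv.
  - by apply: hw => //; rewrite -yv.
have rb : r b = b by apply: rv => bv; apply: vb.
apply: (deform_step _ _ _ r) => //.
- by move=> x /rV /V'E[].
- by move=> x Vx; rewrite /r; case: eqP => [->|_] //; exact: a8_refl.
apply: (deform_retract _ (mems V') _ id r) => //.
- by move=> x /V'E[].
apply: IH.
- by apply: (size_filter_lt _ _ v) => //; rewrite negbK.
- move=> x y /V'E[xv Vx] /V'E[yv Vy]; rewrite -(rv x)// -(rv y)//.
  by apply: (conn_map _ (mems V)) => //; exact: cV.
- move=> q nq.
  have up x : mems V' x -> x.2 < v.2 + 1 by move=> /V'E[_ /top]; lia.
  have nup : ~ mems V' (v.1, v.2 + 1) by move=> /up /=; lia.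
  (* The removed point [v] escapes through the point just above it, which lies above all of [V]. *)
  have [qv|qv] := pselect (q = v).
    apply: (escapes_step _ _ (v.1, v.2 + 1)) => //; first by rewrite qv /a8 /=;
      lia.
    exact: escapes_above.
  apply: (escapes_sub (mems V)); first by move=> p /V'E[].
  by apply: hV => Vq; apply: nq; apply/V'E.
- by apply/V'E; split=> // bv; apply: vb.
Qed.

(** Here [v] is a cut point: by [corner_separates] its neighbours [l] and [D] lie in different
    components of the rest. One piece is [v] with the component [A] of [l], the other is everything
    outside [A]; both are smaller than [V] and they meet in [v] alone. *)
Lemma deform_cut_corner V v l (D d : pt) b : contractible_below V ->
  connected_pts V ->
  hole_free V -> mems V b -> top_right V v -> mems V l -> mems V D ->
    ~ mems V d ->
  l.1 = v.1 - 1 -> l.2 = v.2 -> D.1 = v.1 -> D.2 = v.2 - 1 ->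
  d.1 = v.1 - 1 -> d.2 = v.2 - 1 -> deform (mems V) b id.
Proof.
move=> IH cV hV Vb [Vv top] Vl VD nVd l1 l2 D1 D2 d1 d2.
have nbr x : mems V x -> a4 x v -> x <> v -> x = l \/ x = D.
  move=> /top h; rewrite /a4 => xv /pt_neq nv.
  have [?|?] : (x.1 = l.1 /\ x.2 = l.2) \/ (x.1 = D.1 /\ x.2 = D.2) by lia.
    by left; apply: pt_eq; tauto.
  by right; apply: pt_eq; tauto.
have lv : l <> v by move=> lv; move: l1; rewrite lv; lia.
have Dv : D <> v by move=> Dv; move: D2; rewrite Dv; lia.
pose S x := mems V x /\ x <> v.
pose A := conn a4 S l.
have Sl : S l by [].
have SD : S D by [].
have Al : A l by exact: conn_refl.
have AS x : A x -> S x by move=> c; have [] := conn_ends _ _ _ _ c.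
have nAD : ~ A D.
  apply: (corner_separates (mems V) v l D d) => //; last exact: hV.
  by move=> p /top; lia.
have Astep x y : A x -> S y -> a4 x y -> A y.
  move=> Ax Sy xy; apply: (conn_trans _ _ _ _ _ Ax);
    apply: (conn_step _ _ _ y) => //.
    exact: AS.
  exact: conn_refl.
have nAv : ~ A v by move=> /AS[].
pose V1 := [seq x <- V | (x == v) || `[< A x >]].
pose V2 := [seq x <- V | ~~ `[< A x >]].
have V1E x : mems V1 x <-> x = v \/ A x.
  rewrite mems_filter; split=> [[/orP[/eqP|/asboolP] h _]|[->|h]].
  - by left.
  - by right.
  - by rewrite eqxx.
  - by split; [apply/orP; right; apply/asboolP|have [] := AS x h].
have V2E x : mems V2 x <-> mems V x /\ ~ A x.
  by rewrite mems_filter; split=> -[h1 h2]; split=> //; apply/asboolPn.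
have hd : escapes (mems V) d by exact: hV.
have V1V x : mems V1 x -> mems V x by move=> /V1E[->|/AS[]].
have V2V x : mems V2 x -> mems V x by move=> /V2E[].
have s1 : (size V1 < size V)%N.
  apply: (size_filter_lt _ _ D) => //=; apply/norP; split; first by apply/eqP.
  by apply/asboolPn.
have s2 : (size V2 < size V)%N.
  by apply: (size_filter_lt _ _ l) => //; rewrite /= negbK; apply/asboolP.
have c1 x : mems V1 x -> conn a4 (mems V1) v x.
  move=> /V1E[->|Ax]; first by apply/conn_refl/V1E; left.
  apply: (conn_step _ _ _ l); [by apply/V1E; left|by rewrite /a4; lia|].
  apply: (conn_sub _ A); first by move=> p Ap; apply/V1E; right.
  exact: conn_inside.
have V2v : mems V2 v by apply/V2E.
have c2 x y : conn a4 (mems V) x y -> y = v -> mems V2 x ->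
  conn a4 (mems V2) x v.
  elim=> [{}x Vx|{}x w {}y Vx xw cwy IHc] yv V2x; first by rewrite yv;
    exact: conn_refl.
  have [->|xv] := pselect (x = v); first exact: conn_refl.
  apply: (conn_step _ _ _ w) => //; apply: IHc => //; apply/V2E; split.
    by have [] := conn_ends _ _ _ _ cwy.
  move=> Aw; move/V2E: V2x => [_]; apply; apply: (Astep w) => //; exact: a4_sym.
have conn1 : connected_pts V1.
  move=> x y /c1 cx /c1 cy; apply: conn_trans cy; apply: conn_sym cx;
    exact: a4_sym.
have conn2 : connected_pts V2.
  move=> x y V2x V2y; have cx := c2 x v (cV x v (V2V _ V2x) Vv) erefl V2x.
  have cy := c2 y v (cV y v (V2V _ V2y) Vv) erefl V2y.
  by apply: conn_trans cx _; apply: conn_sym cy; exact: a4_sym.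
have nV1d : ~ mems V1 d by move=> /V1V.
have nV2d : ~ mems V2 d by move=> /V2V.
(* Removing [A] creates no hole: its points reach [l] inside [A], and [l] touches [d], which
   escapes. *)
have h2 : hole_free V2.
  move=> q nq; have [Aq|nAq] := pselect (A q); last first.
    apply: (escapes_sub (mems V)) => //; apply: hV => Vq; apply: nq; exact/V2E.
  apply: (escapes_conn _ _ l).
    apply: (conn_sym _ _ _ _ a8_sym).
    have : conn a4 A l q by exact: conn_inside.
    elim=> [x Ax|x w y Ax xw cwy IHc]; first by apply: conn_refl => /V2E[].
    by apply: (conn_step _ _ _ w) => //; [move=> /V2E[]|exact: a4_a8].
  apply: (escapes_step _ _ d); first by move=> /V2E[].
    by rewrite /a8; lia.
  exact: escapes_sub hd.
have h1 : hole_free V1.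
  move=> q nq; have [Vq|nVq] := pselect (mems V q); last first.
    apply: (escapes_sub (mems V)) => //; exact: hV.
  have V2q : mems V2 q by apply/V2E; split=> // Aq; apply: nq; apply/V1E; right.
  have qv : q <> v by move=> qv; apply: nq; apply/V1E; left.
  (* A path in [V2] first arrives at [v] from a neighbour of [v] outside [A], hence from [D], and
     [D] touches [d]. *)
  have toD x y : conn a4 (mems V2) x y -> y = v -> x <> v ->
      conn a8 (fun p => ~ mems V1 p) x D.
    elim=> [//|{}x w {}y V2x xw cwy IHc] yv xv.
    have nV1x : ~ mems V1 x by move=> /V1E[//|Ax]; move/V2E: V2x => [].
    have [wv|wv] := pselect (w = v); last first.
      by apply: (conn_step _ _ _ w) => //; [exact: a4_a8|exact: IHc].
    rewrite wv in xw; have [xl|<-] := nbr x (V2V _ V2x) xw xv;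
      last exact: conn_refl.
    by exfalso; move/V2E: V2x => [_]; rewrite xl.
  apply: (escapes_conn _ _ D); first by apply: (toD q v) => //; exact: conn2.
  apply: (escapes_step _ _ d); first by move=> /V1E[].
    by rewrite /a8; lia.
  exact: escapes_sub hd.
have V1v : mems V1 v by apply/V1E; left.
have disj x : mems V1 x -> mems V2 x -> x = v.
  by move=> /V1E[//|Ax] /V2E[_ nA].
have cover x : mems V x <-> mems V1 x \/ mems V2 x.
  split=> [Vx|[/V1V|/V2V] //].
  have [Ax|nAx] := pselect (A x); first by left; apply/V1E; right.
  by right; apply/V2E.
have sep x y : mems V1 x -> mems V2 y -> a4 x y -> x = v \/ y = v.
  move=> /V1E[->|Ax] /V2E[Vy nAy] xy; first by left.
  have [->|yv] := pselect (y = v); first by right.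
  by exfalso; apply: nAy; exact: (Astep x).
case/cover: (Vb) => [b1|b2].
  apply: (deform_wedge _ (mems V1) (mems V2) v) => //; exact: IH.
apply: (deform_wedge _ (mems V2) (mems V1) v) => //.
- by move=> x; rewrite cover; tauto.
- by move=> x x2 x1; exact: disj.
- by move=> x y x2 y1 xy; have [|h|h] := sep y x y1 x2;
  [exact: a4_sym|right|left].
- exact: IH.
- exact: IH.
Qed.

(** When both neighbours are present the diagonal point [d] decides: with it [v] folds onto [d],
    without it [v] cuts the set. With a single neighbour [v] folds onto that one, and with none [v]
    would be isolated from [b]. *)
Lemma deform_corner V v b : contractible_below V -> connected_pts V ->
  hole_free V -> mems V b -> top_right V v -> v <> b -> deform (mems V) b id.
Proof.
move=> IH cV hV Vb trv vb; have [Vv top] := trv.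
pose l : pt := (v.1 - 1, v.2); pose D : pt := (v.1, v.2 - 1).
pose d : pt := (v.1 - 1, v.2 - 1).
have nbr x : mems V x -> a4 x v -> x <> v -> x = l \/ x = D.
  move=> /top h; rewrite /a4 => xv /pt_neq nv.
  have [?|?] : (x.1 = l.1 /\ x.2 = l.2) \/ (x.1 = D.1 /\ x.2 = D.2)
    by rewrite /l /D /=; lia.
    by left; apply: pt_eq; tauto.
  by right; apply: pt_eq; tauto.
have lv : l <> v by move=> /(congr1 fst) /=; lia.
have Dv : D <> v by move=> /(congr1 snd) /=; lia.
have dv : d <> v by move=> /(congr1 snd) /=; lia.
have [Vl|nVl] := pselect (mems V l); have [VD|nVD] := pselect (mems V D).
- have [Vd|nVd] := pselect (mems V d); last exact: (deform_cut_corner V v l D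
  d).
  apply: (deform_simple_corner V v d) => //; last by rewrite /a8 /d /=; lia.
  by move=> x Vx xv /nbr[] // ->; rewrite /a4 /l /D /d /=; lia.
- apply: (deform_simple_corner V v l) => //; last by rewrite /a8 /l /=; lia.
  by move=> x Vx xv /nbr[] // xE; [rewrite xE; exact: a4_refl|exfalso;
    apply: nVD; rewrite -xE].
- apply: (deform_simple_corner V v D) => //; last by rewrite /a8 /D /=; lia.
  by move=> x Vx xv /nbr[] // xE; [exfalso; apply: nVl; rewrite -xE|rewrite xE;
    exact: a4_refl].
- exfalso; have := cV b v Vb Vv.
  have H x y : conn a4 (mems V) x y -> y = v -> x = v.
    elim=> [//|{}x w {}y Vx xw cwy IHc] yv; apply: contrapT => xv.
    rewrite (IHc yv) in xw.
    by have [xl|xD] := nbr x Vx xw xv; [apply: nVl; rewrite -xl|apply: nVD;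
      rewrite -xD].
  by move=> /H /(_ erefl) bv; apply: vb.
Qed.

Lemma hole_free_deform V b : connected_pts V -> hole_free V -> mems V b ->
  deform (mems V) b id.
Proof.
have [n] := ubnP (size V); elim: n V b => // n IHn V b sV cV hV Vb.
have IH : contractible_below V.
  by move=> V' b' sV'; apply: IHn; exact: leq_trans sV' _.
have [v trv] := top_right_exists V b Vb.
have [vb|vb] := pselect (v = b); last exact: (deform_corner V v).
have [triv|] := pselect (forall x, mems V x -> x = b).
  exact: deform_const.
move=> /existsNP[x /not_implyP[Vx xb]].
(* A corner equal to [b] must not be moved; the opposite corner is used instead, after a reflection.
   The two cannot both be [b], since [V] has a further point [x]. *)
pose neg (p : pt) : pt := (- p.1, - p.2).
have negK : involutive neg by move=> [p1 p2]; rewrite /neg /= !opprK.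
pose V' := map neg V.
have V'E y : mems V' (neg y) <-> mems V y.
  by rewrite /mems mem_map//; exact: inv_inj.
have V'E' y : mems V' y <-> mems V (neg y) by rewrite -V'E negK.
have n4 y z : a4 y z -> a4 (neg y) (neg z) by rewrite /a4 /neg /=; lia.
have n8 y z : a8 y z -> a8 (neg y) (neg z) by rewrite /a8 /neg /=; lia.
have sz : size V' = size V by rewrite size_map.
suff H : deform (mems V') (neg b) id.
  apply: deform_ext (deform_conj (mems V) (mems V') b id neg negK V'E n4 n8 H).
  by move=> y _ /=; rewrite negK.
have V'b : mems V' (neg b) by apply/V'E.
have [v' trv'] := top_right_exists V' _ V'b.
apply: (deform_corner V' v') => //.
- by move=> W c; rewrite sz; exact: IH.
- move=> y z /V'E' Vy /V'E' Vz; rewrite -(negK y) -(negK z).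
  by apply: (conn_map _ (mems V)) (cV _ _ Vy Vz) ; [by move=> p;
    rewrite V'E|by move=> ? ? _ _; exact: n4].
- move=> q nq; have [|q' c hq'] := hV (neg q); first by rewrite -V'E'.
  have [N hN] := mems_bounded V.
  (* Escaping upwards from the reflected set means escaping downwards from [V]: the path goes out to
     the right of all points and then down. *)
  pose X := Num.max (N + 1) q'.1; pose t : pt := (X, - N - 1).
  have c1 : conn a8 (fun p => ~ mems V p) q' (X, q'.2).
    by apply: conn_horizontal => [|k]; [rewrite /X; lia|move=> /hq' /=; lia].
  have c2 : conn a8 (fun p => ~ mems V p) (X, q'.2) t.
    have [y0|y0] := leP (- N - 1) q'.2.
      apply: (conn_sym _ _ _ _ a8_sym); apply: conn_vertical => // k /hN /=.
      by rewrite /X; lia.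
    by apply: conn_vertical; [lia|move=> k /hN /=; rewrite /X; lia].
  exists (neg t); last by move=> p /V'E' /hN; rewrite /neg /=; lia.
  rewrite -(negK q); apply: (conn_map _ (fun p => ~ mems V p)).
  - by move=> p; rewrite V'E.
  - by move=> ? ? _ _; exact: n8.
  apply: (conn_trans _ _ _ _ _ c); exact: conn_trans c2.
- move=> v'b; case: trv' trv => _ top' [_ top].
  have := top _ Vx; have := top' (neg x) ((V'E x).2 Vx).
  rewrite v'b vb /neg /=; move: (pt_neq _ _ xb); lia.
Qed.

Lemma escapes_outside V (N : int) q : (forall p, mems V p ->
  -N <= p.1 <= N /\ -N <= p.2 <= N) ->
  0 <= N -> ~ (-N <= q.1 <= N /\ -N <= q.2 <= N) -> escapes (mems V) q.
Proof.
move=> hN N0 nq; pose S p := ~ mems V p.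
have out (p : pt) : ~ (-N <= p.1 <= N /\ -N <= p.2 <= N) -> S p
  by move=> np /hN.
pose X := if -N <= q.1 <= N then N + 1 else q.1.
have c1 : conn a8 S q (X, q.2).
  rewrite /X; case: ifP => hq; last first.
    by rewrite -surjective_pairing; apply: conn_refl; exact: out.
  by apply: conn_horizontal => [|k]; [lia|apply: out => /=; lia].
have nX : ~ (-N <= X <= N) by rewrite /X; case: ifP; lia.
pose Y := Num.max q.2 (N + 1).
have c2 : conn a8 S (X, q.2) (X, Y).
  by apply: conn_vertical => [|k]; [rewrite /Y; lia|apply: out => /=; lia].
exists (X, Y); first exact: conn_trans c2.
by move=> p /hN /=; rewrite /Y; lia.
Qed.

Lemma fill_holes V0 : connected_pts V0 -> (exists p, mems V0 p) -> exists V,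
  [/\ connected_pts V, hole_free V &
   forall q, mems V q <-> mems V0 q \/ (~ mems V0 q /\ ~ escapes (mems V0) q)].
Proof.
move=> c0 [p0 V0p0]; have [N hN] := mems_bounded V0.
have N0 : 0 <= N by have := hN p0 V0p0; lia.
pose n := `|N|%N.
(* Points outside the bounding box escape, so the holes fit in a finite list. *)
pose box := [seq (i%:Z - N, j%:Z - N) : pt | i <- iota 0 (n + n).+1, j <- iota 0
  (n + n).+1].
pose V := V0 ++ [seq q <- box | `[< ~ mems V0 q /\ ~ escapes (mems V0) q >]].
have VE q : mems V q <-> mems V0 q \/ (~ mems V0 q /\ ~ escapes (mems V0) q).
  rewrite /mems mem_cat mem_filter; split.
    by move=> /orP[->|/andP[/asboolP h _]]; [left|right].
  move=> [->//|h]; apply/orP; right; apply/andP; split; first exact/asboolP.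
  have [[q1 q2]|nq] := pselect (-N <= q.1 <= N /\ -N <= q.2 <= N); last first.
    by exfalso; apply: h.2; apply: escapes_outside hN N0 nq.
  apply/allpairsP; exists (absz (q.1 + N)%R, absz (q.2 + N)%R).
  split; [rewrite mem_iota /n /=; lia|rewrite mem_iota /n /=; lia|].
  by apply: pt_eq => /=; lia.
have VnE q : ~ mems V q -> ~ mems V0 q /\ escapes (mems V0) q.
  move=> nq; have n0 : ~ mems V0 q by move=> h; apply: nq; apply/VE; left.
  by split=> //; apply: contrapT => ne; apply: nq; apply/VE; right.
have nVE q : ~ mems V0 q -> escapes (mems V0) q -> ~ mems V q.
  by move=> n0 e0 /VE[|[_]].
exists V; split => //.
  (* Moving left from a hole, one stays among the holes until [V0] is hit, for a neighbour outside
     [V] would let the hole escape; [k] bounds the steps left inside the box, beyond which every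
     point escapes. *)
  have toV0 (k : nat) q : mems V q -> q.1 + N <= k%:Z ->
    exists2 p, mems V0 p & conn a4 (mems V) q p.
    elim: k q => [|k IH] q Vq hq; have [V0q|n0] := pselect (mems V0 q).
    - by exists q => //; exact: conn_refl.
    - move/VE: (Vq) => [//|[_ ne]]; exfalso.
      have [hb|hb] := pselect (-N <= q.1 <= N /\ -N <= q.2 <= N); last first.
        by apply: ne; exact: escapes_outside hN N0 hb.
      have q1 : q.1 = - N by lia.
      apply: ne; apply: (escapes_step _ _ (q.1 - 1, q.2)) => //; first
        by rewrite /a8 /=; lia.
      by apply: (escapes_outside _ _ _ hN N0) => /=; lia.
    - by exists q => //; exact: conn_refl.
    - move/VE: (Vq) => [//|[_ ne]]; pose q' : pt := (q.1 - 1, q.2).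
      have Vq' : mems V q'.
        apply: contrapT => /VnE[n0' e']; apply: ne.
        by apply: (escapes_step _ _ q') => //; rewrite /a8 /q' /=; lia.
      have [|p V0p c] := IH q' Vq'; first by rewrite /q' /=; lia.
      by exists p => //; apply: (conn_step _ _ _ q') => //; rewrite /a4 /q' /=;
        lia.
  have toV0' q : mems V q -> exists2 p, mems V0 p & conn a4 (mems V) q p.
    by move=> Vq; apply: (toV0 (absz (q.1 + N)%R)) => //; lia.
  move=> x y /toV0'[p V0p cp] /toV0'[r V0r cr].
  apply: conn_trans cp _; apply: (conn_trans _ _ _ r); last
    by apply: conn_sym cr; exact: a4_sym.
  by apply: conn_sub (c0 _ _ V0p V0r) => u V0u; apply/VE; left.
(* Along an escaping path every point escapes, hence avoids the filled holes; and these rise no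
   higher than [V0], since a point above all of [V0] escapes. *)
move=> q /VnE[_ [q' c above]]; exists q'; last first.
  move=> p /VE[/above//|[np ne]].
  have [h|/existsNP[r /not_implyP[V0r /negP]]] :=
    pselect (forall r, mems V0 r -> r.2 < p.2).
    by exfalso; apply: ne; exact: escapes_above.
  by rewrite -leNgt => h; apply: le_lt_trans h (above _ V0r).
elim: c above => [{}q nq|{}q w {}q' nq qw c IH] above.
  by apply: conn_refl; apply: nVE => //; exact: escapes_above.
apply: (conn_step _ _ _ w) => //; last by apply: IH => //; have [] :=
  conn_ends _ _ _ _ c.
by apply: nVE => //; exists q' => //; exact: conn_step c.
Qed.

Lemma deform_seq (V : pt -> Prop) b f : deform V b f ->
  (forall x, V x -> V (f x)) -> (forall x y, V x -> V y -> a4 x y ->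
    a4 (f x) (f y)) ->
  exists (M : nat) (h : nat -> pt -> pt),
  [/\ forall x, h 0%N x = f x, forall x, V x -> h M x = b,
      forall i x, V x -> V (h i x),
      forall i x y, V x -> V y -> a4 x y -> a4 (h i x) (h i y) &
      forall i x, V x -> a8 (h i x) (h i.+1 x)].
Proof.
elim=> {f} [f fb|f g Vg ag fg gb dg IH] Vf af.
  by exists 0%N, (fun=> f); split => // i x Vx; exact: a8_refl.
have [M [h [h0 hM Vh ah hh]]] := IH Vg ag.
exists M.+1, (fun i => if i is i'.+1 then h i' else f); split => //.
- by case.
- by case.
- by case=> [|i] x Vx; [rewrite h0; exact: fg|exact: hh].
Qed.

End LatticeSets.

Local Open Scope classical_set_scope.
Local Open Scope ring_scope.
Local Open Scope complex_scope.

(** * Potentials of pointwise closed forms *)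

Section RealPotential.
Variable R : realType.
Implicit Types (x y a b c d e : R).

Lemma continuous_has_primitive (phi : R -> R) a : continuous phi ->
  exists P : R -> R, forall x, a < x -> is_derive x 1 P (phi x).
Proof.
move=> cphi; exists (fun x => \int[lebesgue_measure]_(t in `[a, x]) phi t).
move=> x ax.
have itg : lebesgue_measure.-integrable `[a, x + 1] (EFin \o phi).
  apply: continuous_compact_integrable; first exact: segment_compact.
  exact: continuous_subspaceT.
have x1 : x < x + 1 by lra.
have [dF F'] := @continuous_FTC1_closed R phi a x (x + 1) x1 itg ax (cphi x).
by split; [exact: dF | rewrite -derive1E; exact: F'].
Qed.

(** The mean value theorem for [P] minus the quadratic whose derivative is [A + B * t]; an affine
    comparison is what first-order expansions of the integrand supply. *)
Lemma mean_value_bound (P phi : R -> R) (A B x y e : R) :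
  (forall t, Num.min x y <= t <= Num.max x y -> is_derive t 1 P (phi t)) ->
  (forall t, Num.min x y <= t <= Num.max x y -> `|phi t - (A + B * t)| <= e) ->
  `|P y - P x - (A * (y - x) + B * (y ^+ 2 - x ^+ 2) / 2)| <= e * `|y - x|.
Proof.
wlog xy : x y / x <= y.
  move=> wl dP hphi; have [xy|/ltW yx] := leP x y; first exact: wl.
  have := wl y x yx; rewrite minC maxC => /(_ dP hphi).
  rewrite (distrC x y); congr (_ <= _); rewrite -[LHS]normrN; congr (`|_|).
  by ring.
rewrite (min_idPl xy) (max_idPr xy) => dP hphi.
pose Q : R -> R := A \*: id + (B / 2) \*: (id ^+ 2).
have QE t : Q t = A * t + B / 2 * t ^+ 2 by [].
pose D := P - Q.
have DE t : D t = P t - Q t by [].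
have dD t : x <= t <= y -> is_derive t 1 D (phi t - (A + B * t)).
  move=> /dP dPt; apply: is_derive_eq.
  rewrite /GRing.scale /=; by field.
have [||t tI Dxy] := @MVT_segment R D (fun t => phi t - (A + B * t)) x y xy.
- by move=> t; rewrite in_itv/= => /andP[xt ty]; apply: dD; rewrite !ltW.
- by apply: derivable_within_continuous => t; rewrite in_itv/= => /dD [].
- have -> : P y - P x - (A * (y - x) + B * (y ^+ 2 - x ^+ 2) / 2) = D y - D x.
    by rewrite !DE !QE; field.
  by rewrite Dxy normrM ler_wpM2r// hphi//.
Qed.

Lemma nested_intervals (u v : nat -> R) :
  {homo u : n m / (n <= m)%N >-> n <= m} ->
  {homo v : n m / (n <= m)%N >-> m <= n} ->
  (forall n, u n <= v n) -> exists x, forall n, u n <= x <= v n.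
Proof.
move=> hu hv uv.
have ub m : ubound (range u) (v m).
  move=> _ [n _ <-]; apply: le_trans (hu _ _ (leq_maxl n m)) _.
  by apply: le_trans (uv _) _; apply: hv; exact: leq_maxr.
exists (sup (range u)) => n; apply/andP; split; last first.
  by apply: ge_sup; [exists (u 0%N), 0%N|exact: ub].
by apply: ub_le_sup; [exists (v 0%N); exact: ub|exists n].
Qed.

Lemma ex_div_expn2_lt w e : 0 < e -> exists n, w / 2 ^+ n < e.
Proof.
move=> e0; have [n /andP[_ wn]] : exists n : nat, (true && (w / e < n%:R))%R.
  by exists (Num.truncn (Num.max 0 (w / e))).+1 => /=;
    rewrite (le_lt_trans _ (truncnS_gt _))// le_max lexx orbT.
exists n; rewrite ltr_pdivrMr ?exprn_gt0// mulrC -ltr_pdivrMr//.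
apply: (lt_le_trans wn); rewrite -natrX ler_nat; exact/ltnW/ltn_expl.
Qed.

(** Bisection for an abstract additive functional of rectangles. If the bound with constant [e]
    fails on a rectangle, it fails on one of its quarters: halving the sides divides the bound by
    four, and there are four quarters. *)
Lemma rect_functional_eq0 (Phi : R -> R -> R -> R -> R) a b c d :
  (forall x1 x2 x3 y1 y2,
    Phi x1 x3 y1 y2 = Phi x1 x2 y1 y2 + Phi x2 x3 y1 y2) ->
  (forall x1 x2 y1 y2 y3,
    Phi x1 x2 y1 y3 = Phi x1 x2 y1 y2 + Phi x1 x2 y2 y3) ->
  a <= b -> c <= d ->
  (forall x y, a <= x <= b -> c <= y <= d -> forall e, 0 < e ->
    exists2 del, 0 < del & forall x1 x2 y1 y2,
      a <= x1 -> x1 <= x -> x <= x2 -> x2 <= b ->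
      c <= y1 -> y1 <= y -> y <= y2 -> y2 <= d ->
      x2 - x1 < del -> y2 - y1 < del ->
      `|Phi x1 x2 y1 y2| <= e * ((x2 - x1) + (y2 - y1)) ^+ 2) ->
  Phi a b c d = 0.
Proof.
move=> addx addy ab cd small; apply/eqP; apply/negPn/negP => Phi0.
pose S := (b - a) + (d - c).
(* With this constant the bound fails on the whole rectangle; adding 1 keeps the denominator
   positive when both sides have length zero. *)
pose e := `|Phi a b c d| / (S ^+ 2 + 1).
have S0 : 0 < S ^+ 2 + 1 by have := sqr_ge0 S; lra.
have e0 : 0 < e by rewrite divr_gt0// normr_gt0.
pose bad (q : (R * R) * (R * R)) :=
  `|Phi q.1.1 q.1.2 q.2.1 q.2.2| > e * ((q.1.2 - q.1.1) + (q.2.2 - q.2.1)) ^+ 2.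
pose next (q q' : (R * R) * (R * R)) :=
  [/\ bad q', q.1.1 <= q'.1.1, q'.1.2 <= q.1.2, q.2.1 <= q'.2.1 & q'.2.2 <=
    q.2.2] /\
  (q'.1.2 - q'.1.1 = (q.1.2 - q.1.1) / 2 /\ q'.2.2 - q'.2.1 = (q.2.2 - q.2.1) /
    2).
pose ok (q : (R * R) * (R * R)) := [/\ bad q, q.1.1 <= q.1.2 & q.2.1 <= q.2.2].
have step q : exists q', ok q -> next q q'.
  case: (pselect (ok q)) => [|nok]; last by exists q.
  case: q => -[x1 x2] [y1 y2] okq; have [/= badq x12 y12] := okq.
  pose x := (x1 + x2) / 2; pose y := (y1 + y2) / 2.
  case: (pselect (bad ((x1, x), (y1, y)))) => [h1|h1].
    exists ((x1, x), (y1, y)) => _; do !split => //=; rewrite ?/x ?/y; lra.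
  case: (pselect (bad ((x, x2), (y1, y)))) => [h2|h2].
    exists ((x, x2), (y1, y)) => _; do !split => //=; rewrite ?/x ?/y; lra.
  case: (pselect (bad ((x1, x), (y, y2)))) => [h3|h3].
    exists ((x1, x), (y, y2)) => _; do !split => //=; rewrite ?/x ?/y; lra.
  case: (pselect (bad ((x, x2), (y, y2)))) => [h4|h4].
    exists ((x, x2), (y, y2)) => _; do !split => //=; rewrite ?/x ?/y; lra.
  exfalso; move/negP: h1; move/negP: h2; move/negP: h3; move/negP: h4.
  rewrite /bad /= -!leNgt.
  have -> : x2 - x + (y2 - y) = (x2 - x1 + (y2 - y1)) / 2 by rewrite /x /y; lra.
  have -> : x - x1 + (y2 - y) = (x2 - x1 + (y2 - y1)) / 2 by rewrite /x /y; lra.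
  have -> : x2 - x + (y - y1) = (x2 - x1 + (y2 - y1)) / 2 by rewrite /x /y; lra.
  have -> : x - x1 + (y - y1) = (x2 - x1 + (y2 - y1)) / 2 by rewrite /x /y; lra.
  move: badq; rewrite /bad /= (addx x1 x x2) !(addy _ _ y1 y y2).
  rewrite expr_div_n.
  move: (_ ^+ 2) => s.
  move: (Phi x1 x y1 y) (Phi x x2 y1 y) (Phi x1 x y y2) (Phi x x2 y y2).
  move=> p1 p2 p3 p4 H h4 h3 h2 h1.
  have N1 := ler_normD (p1 + p3) (p2 + p4).
  have N2 := ler_normD p1 p3; have N3 := ler_normD p2 p4.
  by lra.
have [f fP] := choice step.
pose Q n := iter n f ((a, b), (c, d)).
have okQ n : ok (Q n).
  elim: n => [|n IH].
    split => //=; rewrite /bad /=; rewrite -/S /e mulrAC ltr_pdivrMr//.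
    by rewrite ltr_pM2l ?normr_gt0//; lra.
  have [[badf h1 h2 h3 h4] [h5 h6]] := fP _ IH.
  have [_ h7 h8] := IH.
  by split => //; rewrite -/(Q n.+1) /= -/(Q n) -subr_ge0 ?h5 ?h6; lra.
have nextQ n : next (Q n) (Q n.+1) by exact: fP.
have hw n : (Q n).1.2 - (Q n).1.1 = (b - a) / 2 ^+ n.
  elim: n => [|n IH]; first by rewrite expr0 divr1.
  have [_ [-> _]] := nextQ n; rewrite IH exprSr; field.
  by rewrite expf_neq0.
have hh n : (Q n).2.2 - (Q n).2.1 = (d - c) / 2 ^+ n.
  elim: n => [|n IH]; first by rewrite expr0 divr1.
  have [_ [_ ->]] := nextQ n; rewrite IH exprSr; field.
  by rewrite expf_neq0.
have [x xP] : exists x, forall n, (Q n).1.1 <= x <= (Q n).1.2.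
  apply: nested_intervals => [||n]; last by have [] := okQ n.
  - apply: homo_leq => //; first exact: le_trans.
    by move=> n; have [[]] := nextQ n.
  - apply: homo_leq => //; first by move=> u v w uv vw; exact: le_trans vw uv.
    by move=> n; have [[]] := nextQ n.
have [y yP] : exists y, forall n, (Q n).2.1 <= y <= (Q n).2.2.
  apply: nested_intervals => [||n]; last by have [] := okQ n.
  - apply: homo_leq => //; first exact: le_trans.
    by move=> n; have [[]] := nextQ n.
  - apply: homo_leq => //; first by move=> u v w uv vw; exact: le_trans vw uv.
    by move=> n; have [[]] := nextQ n.
have inQ n : [/\ a <= (Q n).1.1, (Q n).1.2 <= b, c <= (Q n).2.1 & (Q n).2.2 <=
  d].
  elim: n => [|n [h1 h2 h3 h4]]; first by split=> /=.
  have [[_ g1 g2 g3 g4] _] := nextQ n.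
  by split; lra.
have [del del0 /(_ (Q _).1.1 (Q _).1.2 (Q _).2.1 (Q _).2.2) H] :=
  small x y (xP 0%N) (yP 0%N) e e0.
have [n Sn] := @ex_div_expn2_lt S del del0.
have [/andP[x1 x2] /andP[y1 y2]] := (xP n, yP n).
have [h1 h2 h3 h4] := inQ n.
have := H n n n n h1 x1 x2 h2 h3 y1 y2 h4.
have E : S / 2 ^+ n = (b - a) / 2 ^+ n + (d - c) / 2 ^+ n by rewrite /S mulrDl.
have p1 : 0 <= (b - a) / 2 ^+ n by rewrite divr_ge0 ?exprn_ge0 ?subr_ge0.
have p2 : 0 <= (d - c) / 2 ^+ n by rewrite divr_ge0 ?exprn_ge0 ?subr_ge0.
move=> /(_ _ _)/wrap[||]; rewrite ?hw ?hh; try lra.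
have [+ _ _] := okQ n; rewrite /bad hw hh.
by rewrite ltNge => /negP.
Qed.

End RealPotential.

(** * Expansions at a point and circulation around rectangles *)

Section ClosedForms.
Variable R : realType.
Implicit Types (x y a b c d e : R).

Lemma eps_continuous (phi : R -> R) :
  (forall t e, 0 < e -> exists2 del, 0 < del &
     forall t', `|t' - t| < del -> `|phi t' - phi t| <= e) -> continuous phi.
Proof.
move=> H t; apply/cvgrPdist_le => e e0; have [del del0 hdel] := H t e e0.
apply/nbhs_ballP; exists del => //= t' bt.
by rewrite distrC; apply: hdel; rewrite distrC.
Qed.

(** Composed with this projection, a function continuous on a segment becomes continuous on the
    whole line, as [continuous_has_primitive] asks. *)
Definition clamp a b t := Num.max a (Num.min b t).

Lemma clamp_bounds a b t : a <= b -> a <= clamp a b t <= b.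
Proof. by move=> ab; rewrite /clamp le_max lexx/= ge_max ab ge_min lexx. Qed.

Lemma clamp_id a b t : a <= t <= b -> clamp a b t = t.
Proof. by move=> /andP[at_ tb]; rewrite /clamp (min_idPr tb) (max_idPr at_).
  Qed.

Lemma clamp_lip a b t t' : a <= b -> `|clamp a b t' - clamp a b t| <= `|t' - t|.
Proof.
move=> ab; have n1 := ler_norm (t' - t); have n2 := ler_norm (t - t').
rewrite distrC in n2; rewrite /clamp ler_norml.
case: (leP b t) => ?; case: (leP b t') => ?; rewrite ?(max_idPr ab);
  case: (leP a t) => ?; case: (leP a t') => ?; apply/andP; split; lra.
Qed.

(** Differentiability at one point, relative to [S], with gradient [(p1, p2)]. *)
Definition has_expansion (S : R -> R -> Prop) (p : R -> R -> R) x y p1 p2 :=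
  forall e, 0 < e -> exists2 del, 0 < del & forall x' y', S x' y' ->
    `|x' - x| < del -> `|y' - y| < del ->
    `|p x' y' - p x y - (p1 * (x' - x) + p2 * (y' - y))|
      <= e * (`|x' - x| + `|y' - y|).

Lemma expansion_continuous S p x y p1 p2 : has_expansion S p x y p1 p2 ->
  forall e, 0 < e -> exists2 del, 0 < del & forall x' y', S x' y' ->
    `|x' - x| < del -> `|y' - y| < del -> `|p x' y' - p x y| <= e.
Proof.
move=> H e e0; have [del del0 hd] := H 1 ltr01.
pose K := `|p1| + `|p2| + 2.
have K0 : 0 < K by rewrite /K ltr_wpDl// addr_ge0.
exists (Num.min del (e / K)); first by rewrite lt_min del0 divr_gt0.
move=> x' y' Sxy; rewrite !lt_min => /andP[x1 x2] /andP[y1 y2].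
have {}hd := hd _ _ Sxy x1 y1.
have N : `|p1 * (x' - x) + p2 * (y' - y)| <= `|p1| * (e / K) + `|p2| * (e / K).
  apply: le_trans (ler_normD _ _) _; rewrite !normrM.
  by apply: lerD; apply: ler_wpM2l => //; apply: ltW.
have E : p x' y' - p x y = (p x' y' - p x y - (p1 * (x' - x) + p2 * (y' - y))) +
  (p1 * (x' - x) + p2 * (y' - y)) by ring.
rewrite E; apply: le_trans (ler_normD _ _) _.
have -> : e = `|p1| * (e / K) + `|p2| * (e / K) + 2 * (e / K).
  by rewrite -!mulrDl mulrC -mulrA mulVf ?mulr1// gt_eqF.
lra.
Qed.

(** The common coefficient [m] is the equality of cross derivatives, that is, closedness of p dx + q
    dy at each point. Bisection makes the circulation around rectangles vanish, so integrating along
    the bottom side and then vertically gives a potential. *)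
Lemma closed_form_potential (p q : R -> R -> R) a b c d : a <= b -> c <= d ->
  let S x y := a <= x <= b /\ c <= y <= d in
  (forall x y, S x y -> exists p1 m q2,
     has_expansion S p x y p1 m /\ has_expansion S q x y m q2) ->
  exists F : R -> R -> R, forall x y, S x y ->
    has_expansion S F x y (p x y) (q x y).
Proof.
move=> ab cd S H.
pose p' x y := p (clamp a b x) (clamp c d y).
pose q' x y := q (clamp a b x) (clamp c d y).
have clS x y : S (clamp a b x) (clamp c d y).
  by split; exact: clamp_bounds.
have p'E x y : S x y -> p' x y = p x y by move=> [? ?]; rewrite /p' !clamp_id.
have q'E x y : S x y -> q' x y = q x y by move=> [? ?]; rewrite /q' !clamp_id.
have cp y : continuous (p' ^~ y).
  apply: eps_continuous => t e e0.
  have [p1 [m [q2 [Hp _]]]] := H _ _ (clS t y).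
  have [del del0 hd] := expansion_continuous _ _ _ _ _ _ Hp e e0.
  exists del => // t' ht'; apply: hd => //; last by rewrite subrr normr0.
  exact: le_lt_trans (clamp_lip _ _ _ _ ab) ht'.
have cq x : continuous (q' x).
  apply: eps_continuous => t e e0.
  have [p1 [m [q2 [_ Hq]]]] := H _ _ (clS x t).
  have [del del0 hd] := expansion_continuous _ _ _ _ _ _ Hq e e0.
  exists del => // t' ht'; apply: hd => //; first by rewrite subrr normr0.
  exact: le_lt_trans (clamp_lip _ _ _ _ cd) ht'.
(* The integrals start at [a - 1] and [c - 1] because the primitive is differentiable only strictly
   to the right of its base point. *)
have [P PP] := choice (fun y => continuous_has_primitive _ (p' ^~ y) (a - 1) (cp
  y)).
have [Q QP] := choice (fun x => continuous_has_primitive _ (q' x) (c - 1) (cq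
  x)).
have dP y t : a <= t -> is_derive t 1 (P y) (p' t y) by move=> at_; apply: PP;
  lra.
have dQ x t : c <= t -> is_derive t 1 (Q x) (q' x t) by move=> at_; apply: QP;
  lra.
have mP y A B x1 x2 e : a <= x1 -> a <= x2 ->
   (forall t, Num.min x1 x2 <= t <= Num.max x1 x2 ->
     `|p' t y - (A + B * t)| <= e) ->
   `|P y x2 - P y x1 - (A * (x2 - x1) + B * (x2 ^+ 2 - x1 ^+ 2) / 2)| <= e *
     `|x2 - x1|.
  move=> h1 h2 h; apply: (@mean_value_bound R (P y) (p' ^~ y)) => // t /andP[ht
    _].
  by apply: dP; apply: le_trans ht; rewrite le_min h1.
have mQ x A B x1 x2 e : c <= x1 -> c <= x2 ->
   (forall t, Num.min x1 x2 <= t <= Num.max x1 x2 ->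
     `|q' x t - (A + B * t)| <= e) ->
   `|Q x x2 - Q x x1 - (A * (x2 - x1) + B * (x2 ^+ 2 - x1 ^+ 2) / 2)| <= e *
     `|x2 - x1|.
  move=> h1 h2 h; apply: (@mean_value_bound R (Q x) (q' x)) => // t /andP[ht _].
  by apply: dQ; apply: le_trans ht; rewrite le_min h1.
(* Counterclockwise circulation around the boundary. *)
pose Phi x1 x2 y1 y2 := (P y1 x2 - P y1 x1) - (P y2 x2 - P y2 x1)
  + (Q x2 y2 - Q x2 y1) - (Q x1 y2 - Q x1 y1).
have Phi0 x1 x2 y1 y2 : a <= x1 -> x1 <= x2 -> x2 <= b -> c <= y1 -> y1 <= y2 ->
    y2 <= d -> Phi x1 x2 y1 y2 = 0.
  move=> ax1 x12 x2b cy1 y12 y2d.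
  apply: rect_functional_eq0 => //; rewrite /Phi; try by move=> *; ring.
  move=> x y xI yI e e0.
  have Sxy : S x y by clear - xI yI ax1 x2b cy1 y2d; split; lra.
  have [p1 [m [q2 [Hp Hq]]]] := H _ _ Sxy.
  have e20 : 0 < e / 2 by lra.
  have [d1 d10 hd1] := Hp _ e20; have [d2 d20 hd2] := Hq _ e20.
  exists (Num.min d1 d2); first by rewrite lt_min d10.
  move=> {Phi} u1 u2 v1 v2 hu1 u1x xu2 hu2 hv1 v1y yv2 hv2.
  rewrite !lt_min => /andP[u12 u12'] /andP[v12 v12'].
  have u12l := le_trans u1x xu2; have v12l := le_trans v1y yv2.
  have eP v : v1 <= v <= v2 -> `|P v u2 - P v u1 - ((p x y - p1 * x + m * (v -
    y)) * (u2 - u1) + p1 * (u2 ^+ 2 - u1 ^+ 2) / 2)| <= e / 2 * (u2 - u1 + (v2 -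
    v1)) * `|u2 - u1|.
    move=> hv; apply: mP => [||t]; [exact: le_trans hu1|exact: le_trans
      (le_trans ax1 hu1) _|].
    rewrite min_l// max_r// => ht.
    have St : S t v.
      by clear - ax1 x2b cy1 y2d hu1 hu2 hv1 hv2 hv ht; split; lra.
    have tx : `|t - x| <= u2 - u1 by clear - ht u1x xu2; rewrite ler_norml; lra.
    have vy : `|v - y| <= v2 - v1 by clear - hv v1y yv2; rewrite ler_norml; lra.
    have := hd1 _ _ St (le_lt_trans tx u12) (le_lt_trans vy v12).
    rewrite p'E//.
    have -> : p t v - p x y - (p1 * (t - x) + m * (v - y)) = p t v - (p x y - p1
      * x + m * (v - y) + p1 * t) by ring.
    by move=> h; apply: le_trans h _; rewrite ler_pM2l// lerD.
  have eQ u : u1 <= u <= u2 -> `|Q u v2 - Q u v1 - ((q x y - q2 * y + m * (u -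
    x)) * (v2 - v1) + q2 * (v2 ^+ 2 - v1 ^+ 2) / 2)| <= e / 2 * (u2 - u1 + (v2 -
    v1)) * `|v2 - v1|.
    move=> hv; apply: mQ => [||t]; [exact: le_trans hv1|exact: le_trans
      (le_trans cy1 hv1) _|].
    rewrite min_l// max_r// => ht.
    have St : S u t.
      by clear - ax1 x2b cy1 y2d hu1 hu2 hv1 hv2 hv ht; split; lra.
    have tx : `|u - x| <= u2 - u1 by clear - hv u1x xu2; rewrite ler_norml; lra.
    have vy : `|t - y| <= v2 - v1 by clear - ht v1y yv2; rewrite ler_norml; lra.
    have := hd2 _ _ St (le_lt_trans tx u12') (le_lt_trans vy v12').
    rewrite q'E//.
    have -> : q u t - q x y - (m * (u - x) + q2 * (t - y)) = q u t - (q x y - q2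
      * y + m * (u - x) + q2 * t) by ring.
    by move=> h; apply: le_trans h _; rewrite ler_pM2l// lerD.
  have := eP v1; have := eP v2; have := eQ u1; have := eQ u2.
  rewrite !lexx u12l v12l => /(_ isT) + /(_ isT) + /(_ isT) + /(_ isT).
  rewrite (ger0_norm (_ : 0 <= u2 - u1)) ?subr_ge0//.
  rewrite (ger0_norm (_ : 0 <= v2 - v1)) ?subr_ge0//.
  set w := u2 - u1; set h := v2 - v1.
  set r4 := (Q u2 v2 - Q u2 v1 - _); set r3 := (Q u1 v2 - Q u1 v1 - _).
  set r2 := (P v2 u2 - P v2 u1 - _); set r1 := (P v1 u2 - P v1 u1 - _).
  move=> h4 h3 h2 h1.
  (* The affine parts of the four sides cancel because both expansions share [m]; only the
     remainders are left. *)
  have -> : P v1 u2 - P v1 u1 - (P v2 u2 - P v2 u1) + (Q u2 v2 - Q u2 v1) - (Q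
    u1 v2 - Q u1 v1) = r1 - r2 + r4 - r3.
    by rewrite /r1 /r2 /r3 /r4 /w /h; ring.
  have -> : e * (w + h) ^+ 2 = 2 * (e / 2 * (w + h) * w) + 2 * (e / 2 * (w + h)
    * h) by field.
  move: (e / 2 * (w + h) * w) (e / 2 * (w + h) * h) h1 h2 h3 h4 => s1 s2.
  by clearbody r1 r2 r3 r4; clear; rewrite !ler_norml; lra.
pose F x y := (P c x - P c a) + (Q x y - Q x c).
exists F => x y Sxy e e0.
have FE x' y' : S x' y' -> F x' y' - F x y = (P y x' - P y x) + (Q x' y' - Q x'
  y).
  move=> [Sx' Sy']; case: Sxy => Sx Sy.
  have [xx'|/ltW xx'] := leP x x'.
    have : Phi x x' c y = 0 by clear - Phi0 xx' Sx Sx' Sy; apply: Phi0; lra.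
    by rewrite /F /Phi => h; apply/eqP; rewrite -subr_eq0 -h; apply/eqP; ring.
  have : Phi x' x c y = 0 by clear - Phi0 xx' Sx Sx' Sy; apply: Phi0; lra.
  by rewrite /F /Phi => h; apply/eqP; rewrite -subr_eq0 -oppr_eq0 -h; apply/eqP;
    ring.
have [p1 [m [q2 [Hp Hq]]]] := H _ _ Sxy.
have [d1 d10 hd1] := expansion_continuous _ _ _ _ _ _ Hp e e0.
have [d2 d20 hd2] := expansion_continuous _ _ _ _ _ _ Hq e e0.
exists (Num.min d1 d2); first by rewrite lt_min d10.
move=> x' y' Sxy'; rewrite !lt_min => /andP[x1 x2] /andP[y1 y2].
rewrite FE//; case: (Sxy) => Sx Sy; case: (Sxy') => Sx' Sy'.
have between (u v t : R) : Num.min u v <= t <= Num.max u v ->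
  `|t - u| <= `|v - u|.
  clear; case: (lerP u v) => uv ht; first by rewrite !ger0_norm; lra.
  by rewrite !ler0_norm; lra.
have betweenI (u v t l r : R) : l <= u <= r -> l <= v <= r ->
  Num.min u v <= t <= Num.max u v -> l <= t <= r.
  by clear; case: (lerP u v) => uv; lra.
have e1 : `|P y x' - P y x - (p x y * (x' - x) + 0 * (x' ^+ 2 - x ^+ 2) / 2)| <=
  e * `|x' - x|.
  apply: mP => [||t ht]; [by case/andP: Sx|by case/andP: Sx'|].
  have St : S t y by split => //; apply: betweenI ht.
  rewrite p'E// mul0r addr0; apply: hd1 => //; last by rewrite subrr normr0.
  exact: le_lt_trans (between _ _ _ ht) x1.
have e2 : `|Q x' y' - Q x' y - (q x y * (y' - y) + 0 * (y' ^+ 2 - y ^+ 2) / 2)|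
  <= e * `|y' - y|.
  apply: mQ => [||t ht]; [by case/andP: Sy|by case/andP: Sy'|].
  have St : S x' t by split => //; apply: betweenI ht.
  rewrite q'E// mul0r addr0; apply: hd2 => //.
  exact: le_lt_trans (between _ _ _ ht) y2.
rewrite [leRHS]mulrDr; apply: (le_trans _ (lerD e1 e2));
  apply: (le_trans _ (ler_normD _ _)).
by rewrite !mul0r !addr0 le_eqVlt; apply/orP; left; apply/eqP; congr (`|_|);
  ring.
Qed.

End ClosedForms.

(** * Complex differentiability *)

Section Modulus.
Variable R : realType.
Implicit Types (z w : R[i]) (x y r : R).

(** The norm of [R[i]] takes its values in [R[i]]; a modulus with values in [R] gives access to the
    total order and to linear arithmetic. *)
Definition cabs (z : R[i]) : R := ComplexField.Normc.normc z.

Lemma normE z : `|z| = (cabs z)%:C.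
Proof. by case: z. Qed.

Lemma cabs_ge0 z : 0 <= cabs z.
Proof. by rewrite -lecR -normE normr_ge0. Qed.

Lemma cabs0 : cabs 0 = 0.
Proof. by apply: complexI; rewrite -normE normr0. Qed.

Lemma cabsM z w : cabs (z * w) = cabs z * cabs w.
Proof. by apply: complexI; rewrite rmorphM /= -!normE normrM. Qed.

Lemma cabsX z n : cabs (z ^+ n) = cabs z ^+ n.
Proof. by apply: complexI; rewrite rmorphXn /= -!normE normrX. Qed.

Lemma cabsV z : cabs z^-1 = (cabs z)^-1.
Proof. by apply: complexI; rewrite fmorphV /= -!normE normfV. Qed.

Lemma cabsN z : cabs (- z) = cabs z.
Proof. by apply: complexI; rewrite -!normE normrN. Qed.

Lemma cabsBC z w : cabs (z - w) = cabs (w - z).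
Proof. by rewrite -cabsN opprB. Qed.

Lemma cabsD z w : cabs (z + w) <= cabs z + cabs w.
Proof. by rewrite -lecR rmorphD /= -!normE ler_normD. Qed.

Lemma cabsB z w : cabs (z - w) <= cabs z + cabs w.
Proof. by rewrite -(cabsN w) cabsD. Qed.

Lemma cabs_triangle z w v : cabs (z - w) <= cabs (z - v) + cabs (v - w).
Proof. by apply: le_trans (cabsD _ _); rewrite addrA subrK. Qed.

Lemma cabs_lipschitz z w : `|cabs z - cabs w| <= cabs (z - w).
Proof.
rewrite ler_norml; apply/andP; split.
  by rewrite lerNl opprB lerBlDr cabsBC; apply: le_trans (cabsD _ _);
    rewrite subrK.
by rewrite lerBlDr; apply: le_trans (cabsD _ _); rewrite subrK.
Qed.

Lemma cabs_eq0 z : (cabs z == 0) = (z == 0).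
Proof. by rewrite -(inj_eq (@complexI R)) -normE normr_eq0. Qed.

Lemma cabs_gt0 z : (0 < cabs z) = (z != 0).
Proof. by rewrite lt_neqAle cabs_ge0 andbT eq_sym cabs_eq0. Qed.

Lemma cabsC x : cabs x%:C = `|x|.
Proof. by rewrite /cabs /= expr0n /= addr0 sqrtr_sqr. Qed.

Lemma cabsCi x : cabs (0 +i* x) = `|x|.
Proof. by rewrite /cabs /= expr0n /= add0r sqrtr_sqr. Qed.

Lemma cabs_sqr z : cabs z ^+ 2 = complex.Re z ^+ 2 + complex.Im z ^+ 2.
Proof. by case: z => a b; rewrite /cabs /= sqr_sqrtr// addr_ge0 ?sqr_ge0. Qed.

Lemma Re_le_cabs z : `|complex.Re z| <= cabs z.
Proof.
rewrite -(@ler_pXn2r _ 2)// ?nnegrE ?cabs_ge0// cabs_sqr real_normK ?num_real//.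
by rewrite lerDl sqr_ge0.
Qed.

Lemma Im_le_cabs z : `|complex.Im z| <= cabs z.
Proof.
rewrite -(@ler_pXn2r _ 2)// ?nnegrE ?cabs_ge0// cabs_sqr real_normK ?num_real//.
by rewrite lerDr sqr_ge0.
Qed.

Lemma cabs_le z : cabs z <= `|complex.Re z| + `|complex.Im z|.
Proof.
rewrite -(@ler_pXn2r _ 2)// ?nnegrE ?cabs_ge0 ?addr_ge0// cabs_sqr sqrrD.
rewrite !real_normK ?num_real// -addrA lerD2l lerDr mulrn_wge0// mulr_ge0//.
Qed.

Lemma cReD z w : complex.Re (z + w) = complex.Re z + complex.Re w.
Proof. by case: z; case: w. Qed.
Lemma cImD z w : complex.Im (z + w) = complex.Im z + complex.Im w.
Proof. by case: z; case: w. Qed.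
Lemma cReN z : complex.Re (- z) = - complex.Re z.
Proof. by case: z. Qed.
Lemma cImN z : complex.Im (- z) = - complex.Im z.
Proof. by case: z. Qed.
Lemma cReM z w : complex.Re (z * w) =
  complex.Re z * complex.Re w - complex.Im z * complex.Im w.
Proof. by case: z; case: w. Qed.
Lemma cImM z w : complex.Im (z * w) =
  complex.Re z * complex.Im w + complex.Im z * complex.Re w.
Proof. by case: z => a b; case: w => c d /=. Qed.
Definition ReImE := (cReD, cImD, cReN, cImN, cReM, cImM).

Lemma nbhs_cabs (z : R[i]^o) (A : set R[i]^o) :
  nbhs z A <-> exists2 e, 0 < e & forall w : R[i]^o, cabs (w - z) < e -> A w.
Proof.
split.
  move=> /nbhs_ballP[[a b] /= e0 H].
  have [a0 b0] : 0 < a /\ b = 0 by move: e0; rewrite ltcE /= => /andP[/eqP ? ?].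
  exists a => // w hw; apply: H.
  by rewrite /ball /= distrC normE b0 ltcR.
move=> [e e0 H]; apply/nbhs_ballP; exists e%:C; first by rewrite /= ltcR.
by move=> w; rewrite /ball /= distrC normE ltcR => /H.
Qed.

Lemma cabs_continuous_at (f : R[i]^o -> R[i]^o) (z : R[i]^o) :
  {for z, continuous f} <-> forall e, 0 < e -> exists2 del, 0 < del &
    forall w, cabs (w - z) < del -> cabs (f w - f z) < e.
Proof.
split.
  move=> cf e e0.
  suff : nbhs z (f @^-1` [set w : R[i]^o | cabs (w - f z) < e])
    by move/nbhs_cabs.
  by apply: cf; apply/nbhs_cabs; exists e.
move=> H A /nbhs_cabs[e e0 hA].
by have [del del0 hd] := H e e0; apply/nbhs_cabs; exists del => // w /hd /hA.
Qed.

Lemma real_continuous_at (f : R[i]^o -> R) (z : R[i]^o) :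
  {for z, continuous f} <-> forall e, 0 < e -> exists2 del, 0 < del &
    forall w, cabs (w - z) < del -> `|f w - f z| < e.
Proof.
split.
  move=> cf e e0.
  suff : nbhs z (f @^-1` [set w : R | `|w - f z| < e]) by move/nbhs_cabs.
  by apply: cf; apply/nbhs_ballP; exists e => //= w; rewrite /ball /= distrC.
move=> H A /nbhs_ballP[e /= e0 hA].
have [del del0 hd] := H e e0; apply/nbhs_cabs; exists del => // w /hd h;
  apply: hA.
by rewrite /ball /= distrC.
Qed.

Lemma open_cabs (A : set R[i]^o) :
  open A <-> forall z, A z -> exists2 e, 0 < e & forall w, cabs (w - z) < e ->
    A w.
Proof.
by rewrite openE; split=> H z /H /nbhs_cabs.
Qed.

Lemma closure_cabs (A : set R[i]^o) (z : R[i]^o) :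
  closure A z <-> forall e, 0 < e -> exists2 w, A w & cabs (w - z) < e.
Proof.
split.
  move=> H e e0; have [|w [Aw hw]] := H [set w : R[i]^o | cabs (w - z) < e].
    by apply/nbhs_cabs; exists e.
  by exists w.
move=> H B /nbhs_cabs[e e0 hB]; have [w Aw hw] := H e e0.
by exists w; split => //; exact: hB.
Qed.

Lemma cabs_within_continuous (A : set R) (g : R -> R[i]^o) :
  {within A, continuous g} <-> forall t, A t -> forall e, 0 < e ->
   exists2 del, 0 < del & forall t', A t' -> `|t' - t| < del ->
     cabs (g t' - g t) < e.
Proof.
split=> [/subspace_continuousP cg t At e e0|H].
  have : within A (nbhs t) (g @^-1` [set w : R[i]^o | cabs (w - g t) < e]).
    by apply: cg => //; apply/nbhs_cabs; exists e.
  move=> /nbhs_ballP[del /= del0 hd]; exists del => // t' At' ht.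
  by apply: hd => //; rewrite /ball /= distrC.
apply/subspace_continuousP => t At B /nbhs_cabs[e e0 hB].
have [del del0 hd] := H t At e e0.
apply/nbhs_ballP; exists del => //= t' ht At'; apply: hB; apply: hd => //.
by rewrite distrC.
Qed.

(** Written as an expansion without a quotient, so that [w = z] is allowed and the real and
    imaginary parts fall under [has_expansion]. *)
Definition cder (f : R[i] -> R[i]) (z l : R[i]) :=
  forall e, 0 < e -> exists2 del, 0 < del & forall w, cabs (w - z) < del ->
    cabs (f w - f z - l * (w - z)) <= e * cabs (w - z).

Definition hol (f : R[i] -> R[i]) (z : R[i]) := exists l, cder f z l.

Lemma derivable_hol (f : R[i]^o -> R[i]^o) (z : R[i]^o) :
  derivable f z (1 : R[i]) <-> hol f z.
Proof.
split.
  move=> /cvg_ex[/= l /cvgrPdist_lt H]; exists l => e e0.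
  have /H : 0 < e%:C by rewrite ltcR.
  rewrite near_withinE => /nbhs_cabs[del del0 hd]; exists del => // w hw.
  have [->|wz] := eqVneq w z; first by rewrite !subrr mulr0 subrr cabs0 mulr0.
  have wz0 : w - z != 0 by rewrite subr_eq0.
  have := hd (w - z); rewrite subr0 => /(_ hw wz0).
  rewrite /GRing.scale /= mulr1 subrK normE ltcR => h.
  have -> : f w - f z - l * (w - z) = (w - z) * ((w - z)^-1 * (f w - f z) - l)
    by field.
  by rewrite cabsM mulrC ler_wpM2r ?cabs_ge0// cabsBC ltW.
move=> [l H]; apply/cvg_ex; exists l => /=; apply/cvgrPdist_le => -[a b].
rewrite ltcE /= => /andP[/eqP -> a0]; have [del del0 hd] := H a a0.
rewrite near_withinE; apply/nbhs_cabs; exists del => // k.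
rewrite subr0 => hk k0; rewrite normE lecR.
have := hd (k + z); rewrite addrK => /(_ hk) h.
have -> : l - k^-1 *: (f (k *: 1 + z) - f z) =
    - ((f (k + z) - f z - l * k) / k).
  by rewrite /GRing.scale /= mulr1; field.
by rewrite cabsN cabsM cabsV ler_pdivrMr // cabs_gt0.
Qed.

Lemma cder_continuous f z l : cder f z l -> forall e, 0 < e ->
  exists2 del, 0 < del & forall w, cabs (w - z) < del -> cabs (f w - f z) < e.
Proof.
move=> H e e0; have [del del0 hd] := H 1 ltr01.
have K0 : 0 < 1 + cabs l by rewrite ltr_pwDl ?cabs_ge0.
exists (Num.min del (e / (1 + cabs l))); first by rewrite lt_min del0 divr_gt0.
move=> w; rewrite lt_min ltr_pdivlMr// => /andP[/hd h1 h2].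
apply: le_lt_trans h2; rewrite mulrDr mulr1.
have -> : f w - f z = (f w - f z - l * (w - z)) + l * (w - z) by ring.
by apply: le_trans (cabsD _ _) _; rewrite cabsM mulrC mul1r in h1 *;
  rewrite [_ * cabs l]mulrC lerD.
Qed.

Lemma hol_continuous (f : R[i]^o -> R[i]^o) z : hol f z ->
  {for z, continuous f}.
Proof. by move=> [l hl]; apply/cabs_continuous_at;
  exact: cder_continuous hl. Qed.

Lemma hol_cst c z : hol (fun=> c) z.
Proof. by apply/derivable_hol; exact: derivable_cst. Qed.

Lemma hol_id z : hol id z.
Proof. by apply/derivable_hol; exact: derivable_id. Qed.

Lemma holD f g z : hol f z -> hol g z -> hol (fun w => f w + g w) z.
Proof.
by move=> /derivable_hol hf /derivable_hol hg; apply/derivable_hol;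
  exact: derivableD.
Qed.

Lemma holB f g z : hol f z -> hol g z -> hol (fun w => f w - g w) z.
Proof.
by move=> /derivable_hol hf /derivable_hol hg; apply/derivable_hol;
  exact: derivableB.
Qed.

Lemma holM f g z : hol f z -> hol g z -> hol (fun w => f w * g w) z.
Proof.
move=> /derivable_hol hf /derivable_hol hg; apply/derivable_hol.
exact: (@derivableM R[i] R[i]^o f g z 1 hf hg).
Qed.

Lemma holX f n z : hol f z -> hol (fun w => f w ^+ n) z.
Proof.
move=> hf; elim: n => [|n IH]; first exact: hol_cst.
have -> : (fun w => f w ^+ n.+1) = (fun w => f w * f w ^+ n).
  by apply/funext => w; rewrite exprS.
exact: holM.
Qed.

Lemma holV f z : f z != 0 -> hol f z -> hol (fun w => (f w)^-1) z.
Proof.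
move=> f0 /derivable_hol hf; apply/derivable_hol.
exact: (@derivableV R[i] R[i]^o f z 1 f0 hf).
Qed.

Lemma hol_comp f g z : hol f z -> hol g (f z) -> hol (g \o f) z.
Proof.
move=> /derivable_hol/derivable1_diffP hf /derivable_hol/derivable1_diffP hg.
apply/derivable_hol/derivable1_diffP.
exact: (@differentiable_comp R[i] R[i]^o R[i]^o R[i]^o f g z hf hg).
Qed.

Lemma hol_near f g z e : 0 < e -> (forall w, cabs (w - z) < e -> f w = g w) ->
  hol f z -> hol g z.
Proof.
move=> e0 fg [l H]; exists l => r /H [del del0 hd].
exists (Num.min e del); first by rewrite lt_min e0.
move=> w; rewrite lt_min => /andP[we wd]; rewrite -!fg ?hd//.
by rewrite subrr cabs0.
Qed.

Definition in_square (z0 : R[i]) (s : R) (z : R[i]) :=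
  `|complex.Re (z - z0)| <= s /\ `|complex.Im (z - z0)| <= s.

Lemma cabs_lt_in_square z0 s z : cabs (z - z0) <= s -> in_square z0 s z.
Proof. by move=> h; split; apply: le_trans h;
  rewrite ?Re_le_cabs ?Im_le_cabs. Qed.

(** With f = u + iv, the form f dz has real part u dx - v dy and imaginary part v dx + u dy; complex
    differentiability makes both closed at every point, and their potentials are the two parts of
    the primitive. *)
Lemma hol_primitive f z0 s : 0 < s -> (forall z, in_square z0 s z -> hol f z) ->
  exists F, forall z, cabs (z - z0) < s -> cder F z (f z).
Proof.
move=> s0 hf; pose x0 := complex.Re z0; pose y0 := complex.Im z0.
have inS x y : x0 - s <= x <= x0 + s /\ y0 - s <= y <= y0 + s <->
    in_square z0 s (x +i* y).
  rewrite /in_square !ReImE /= -/x0 -/y0 !ler_norml.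
  by split=> [[/andP[? ?] /andP[? ?]]|[/andP[? ?] /andP[? ?]]]; split;
    apply/andP; split; lra.
have expand x y : x0 - s <= x <= x0 + s /\ y0 - s <= y <= y0 + s -> exists l,
   forall e, 0 < e -> exists2 del, 0 < del & forall x' y',
     `|x' - x| < del -> `|y' - y| < del ->
     cabs (f (x' +i* y') - f (x +i* y) - l * ((x' +i* y') - (x +i* y))) <= e *
       (`|x' - x| + `|y' - y|).
  move=> /inS /hf[l hl]; exists l => e e0; have [del del0 hd] := hl e e0.
  exists (del / 2); first by lra.
  move=> x' y' hx hy.
  have h : cabs (x' +i* y' - x +i* y) <= `|x' - x| + `|y' - y|
    by exact: cabs_le.
  apply: le_trans (hd _ _) _; first by apply: le_lt_trans h _; lra.
  by rewrite ler_pM2l.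
pose u x y := complex.Re (f (x +i* y)); pose v x y := complex.Im (f (x +i* y)).
have xs : x0 - s <= x0 + s by lra.
have ys : y0 - s <= y0 + s by lra.
have [|U HU] := @closed_form_potential R u (fun x y => - v x y) _ _ _ _ xs ys.
  move=> x y Sxy; have [l hl] := expand x y Sxy.
  exists (complex.Re l), (- complex.Im l), (- complex.Re l); split.
    move=> e /hl[del del0 hd]; exists del => // x' y' _ hx hy.
    apply: le_trans (hd x' y' hx hy); apply: le_trans (Re_le_cabs _).
    by rewrite !ReImE /= /u le_eqVlt; apply/orP; left; apply/eqP; congr (`|_|);
      ring.
  move=> e /hl[del del0 hd]; exists del => // x' y' _ hx hy.
  apply: le_trans (hd x' y' hx hy); apply: le_trans (Im_le_cabs _).
  by rewrite -[leRHS]normrN !ReImE /= /v le_eqVlt; apply/orP; left; apply/eqP;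
    congr (`|_|); ring.
have [|V HV] := @closed_form_potential R v u _ _ _ _ xs ys.
  move=> x y Sxy; have [l hl] := expand x y Sxy.
  exists (complex.Im l), (complex.Re l), (- complex.Im l); split.
    move=> e /hl[del del0 hd]; exists del => // x' y' _ hx hy.
    apply: le_trans (hd x' y' hx hy); apply: le_trans (Im_le_cabs _).
    by rewrite !ReImE /= /v le_eqVlt; apply/orP; left; apply/eqP; congr (`|_|);
      ring.
  move=> e /hl[del del0 hd]; exists del => // x' y' _ hx hy.
  apply: le_trans (hd x' y' hx hy); apply: le_trans (Re_le_cabs _).
  by rewrite !ReImE /= /u le_eqVlt; apply/orP; left; apply/eqP; congr (`|_|);
    ring.
exists (fun z => U (complex.Re z) (complex.Im z) +i* V (complex.Re z)
  (complex.Im z)).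
move=> [x y] zs e e0.
have Sxy : x0 - s <= x <= x0 + s /\ y0 - s <= y <= y0 + s.
  by apply/inS; apply: cabs_lt_in_square; exact: ltW.
have e40 : 0 < e / 4 by lra.
have [d1 d10 hd1] := HU x y Sxy _ e40; have [d2 d20 hd2] := HV x y Sxy _ e40.
exists (Num.min (s - cabs (x +i* y - z0)) (Num.min d1 d2)).
  by rewrite !lt_min d10 d20 subr_gt0 zs.
move=> [x' y']; rewrite !lt_min => /and3P[h0 h1 h2].
have Sxy' : x0 - s <= x' <= x0 + s /\ y0 - s <= y' <= y0 + s.
  apply/inS; apply: cabs_lt_in_square; apply: le_trans (cabs_triangle _ _ (x +i*
    y)) _; lra.
have rx := Re_le_cabs (x' +i* y' - x +i* y).
have ry := Im_le_cabs (x' +i* y' - x +i* y).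
have := hd1 x' y' Sxy' (le_lt_trans rx h1) (le_lt_trans ry h1).
have := hd2 x' y' Sxy' (le_lt_trans rx h2) (le_lt_trans ry h2).
move: (cabs_le ((U x' y' +i* V x' y') - (U x y +i* V x y) - f (x +i* y) * (x'
  +i* y' - x +i* y))).
rewrite !ReImE /=.
move: rx ry; rewrite !ReImE /= => rx ry h ev eu.
apply: le_trans h _.
have -> : U x' y' - U x y - (complex.Re (f (x +i* y)) * (x' - x) - complex.Im (f
  (x +i* y)) * (y' - y)) =
   U x' y' - U x y - (u x y * (x' - x) + - v x y * (y' - y)) by rewrite /u /v;
     ring.
have -> : V x' y' - V x y - (complex.Re (f (x +i* y)) * (y' - y) + complex.Im (f
  (x +i* y)) * (x' - x)) =
   V x' y' - V x y - (v x y * (x' - x) + u x y * (y' - y)) by rewrite /u /v;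
     ring.
apply: le_trans (lerD eu ev) _.
have -> : e / 4 * (`|x' - x| + `|y' - y|) + e / 4 * (`|x' - x| + `|y' - y|) = e
  / 2 * (`|x' - x| + `|y' - y|) by field.
have -> : e * cabs (x' +i* y' - x +i* y) = e / 2 * (cabs (x' +i* y' - x +i* y) +
  cabs (x' +i* y' - x +i* y)) by field.
rewrite ler_pM2l; last by lra.
exact: lerD.
Qed.

End Modulus.

(** * The maximum principle *)

Section SecondOrderExpansions.
Variable R : realType.
Implicit Types (z w : R[i]) (x y r : R).

Lemma eps_is_derive (phi : R -> R) (t l : R) :
  (forall e, 0 < e -> exists2 del, 0 < del & forall t', `|t' - t| < del ->
     `|phi t' - phi t - l * (t' - t)| <= e * `|t' - t|) ->
  is_derive t 1 phi l.
Proof.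
move=> H.
have cv : (fun h => h^-1 *: ((phi \o shift t) (h *: 1) - phi t)) @ (0 : R)^' -->
  l.
  apply/cvgrPdist_le => e e0; have [del del0 hd] := H e e0.
  rewrite near_withinE; apply/nbhs_ballP; exists del => //= k.
  rewrite /ball /= sub0r normrN => hk k0.
  have := hd (k + t); rewrite addrK => /(_ hk) h.
  have -> : l - k^-1 *: (phi (k *: 1 + t) - phi t) = - ((phi (k + t) - phi t - l
    * k) / k).
    by rewrite /GRing.scale /= mulr1; field.
  by rewrite normrN normrM normfV ler_pdivrMr // normr_gt0.
split; first by apply/cvg_ex; exists l.
exact: cvg_lim cv.
Qed.

(** The mean value theorem fails for complex values, so real and imaginary parts are treated
    separately; this costs the factor 2. *)
Lemma cder_segment_bound (F f : R[i] -> R[i]) z k (A B : R[i]) e :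
  (forall t : R, 0 <= t <= 1 -> cder R F (z + t%:C * k) (f (z + t%:C * k))) ->
  (forall t : R, 0 <= t <= 1 -> cabs R (f (z + t%:C * k) - (A + B * (t%:C * k)))
    <= e) ->
  cabs R (F (z + k) - F z - (A * k + B * k ^+ 2 / 2)) <= 2 * (e * cabs R k).
Proof.
move=> dF hf.
have key (p : R[i] -> R) : (forall u v, p (u + v) = p u + p v) ->
    (forall u, p (- u) = - p u) -> (forall (t : R) u, p (t%:C * u) = t * p u) ->
    (forall u, `|p u| <= cabs R u) ->
    `|p (F (z + k) - F z - (A * k + B * k ^+ 2 / 2))| <= e * cabs R k.
  move=> pD pN pZ pn.
  have := @mean_value_bound R (fun t => p (F (z + t%:C * k))) (fun t => p (f (z
    + t%:C * k) * k))
    (p (A * k)) (p (B * k ^+ 2)) 0 1 (e * cabs R k).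
  rewrite min_l// max_r// => /(_ _ _)/wrap[t ht|t ht|].
  - apply: eps_is_derive => d d0.
    have K0 : 0 < cabs R k + 1 by rewrite ltr_wpDl// cabs_ge0.
    have [del del0 hd] := dF t ht (d / (cabs R k + 1)) (divr_gt0 d0 K0).
    exists (del / (cabs R k + 1)); first by rewrite divr_gt0.
    move=> t' ht'.
    have E : z + t'%:C * k - (z + t%:C * k) = (t' - t)%:C * k
      by rewrite rmorphB /=; ring.
    have En : cabs R ((t' - t)%:C * k) = `|t' - t| * cabs R k
      by rewrite cabsM cabsC.
    have := hd (z + t'%:C * k); rewrite E En => /(_ _)/wrap[|h].
      move: ht'; rewrite ltr_pdivlMr//; apply: le_lt_trans.
      by rewrite ler_wpM2l// lerDl.
    have -> : p (F (z + t'%:C * k)) - p (F (z + t%:C * k)) - p (f (z + t%:C * k)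
      * k) * (t' - t) =
      p (F (z + t'%:C * k) - F (z + t%:C * k) - f (z + t%:C * k) * ((t' - t)%:C
        * k)).
      by rewrite !pD !pN mulrCA pZ; ring.
    apply: le_trans (pn _) _; apply: le_trans h _.
    rewrite mulrAC ler_pdivrMr// -mulrA ler_pM2l// ler_wpM2l// lerDl//.
  - have -> : p (f (z + t%:C * k) * k) - (p (A * k) + p (B * k ^+ 2) * t) =
       p ((f (z + t%:C * k) - (A + B * (t%:C * k))) * k).
      rewrite [p _ * t]mulrC -pZ -pD -pN -pD; congr p; ring.
    by apply: le_trans (pn _) _; rewrite cabsM ler_wpM2r ?cabs_ge0// hf.
  - rewrite mul1r mul0r addr0 !subr0 normr1 expr1n expr0n /= !mulr1 subr0 mulr1.
    apply: le_trans; rewrite le_eqVlt; apply/orP; left; apply/eqP; congr (`|_|).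
    have -> : B * k ^+ 2 / 2 = (2^-1)%:C * (B * k ^+ 2)
      by rewrite fmorphV /= rmorph_nat mulrC.
    by rewrite !pD !pN !pD pZ; field.
have h1 := key (@complex.Re R) (@cReD R) (@cReN R) _ (@Re_le_cabs R).
have h2 := key (@complex.Im R) (@cImD R) (@cImN R) _ (@Im_le_cabs R).
rewrite mulr2n mulrDl mul1r; apply: le_trans (cabs_le _ _) _; apply: lerD.
  by apply: h1 => t u; rewrite cReM /= mul0r subr0.
by apply: h2 => t u; rewrite cImM /= mul0r addr0.
Qed.

(** The first-order expansion of [f] at [z], in effect integrated along the segment from [z] to
    [z + k]. *)
Lemma cder_second_order (F f : R[i] -> R[i]) z l s : 0 < s ->
  (forall w, cabs R (w - z) < s -> cder R F w (f w)) -> cder R f z l ->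
  forall e, 0 < e -> exists2 del, 0 < del & forall k, cabs R k < del ->
    cabs R (F (z + k) - (F z + f z * k + l / 2 * k ^+ 2)) <= e * cabs R k ^+ 2.
Proof.
move=> s0 dF df e e0.
have e20 : 0 < e / 2 by lra.
have [del del0 hd] := df _ e20.
exists (Num.min s del); first by rewrite lt_min s0.
move=> k; rewrite lt_min => /andP[ks kd].
have hk t : 0 <= t <= 1 -> cabs R (z + t%:C * k - z) <= cabs R k.
  move=> /andP[t0 t1]; rewrite addrC addKr cabsM cabsC ger0_norm//.
  by rewrite ler_piMl ?cabs_ge0.
have -> : F (z + k) - (F z + f z * k + l / 2 * k ^+ 2) = F (z + k) - F z - (f z
  * k + l * k ^+ 2 / 2) by ring.
have -> : e * cabs R k ^+ 2 = 2 * ((e / 2 * cabs R k) * cabs R k) by field.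
apply: cder_segment_bound => t ht; first by apply: dF;
  exact: le_lt_trans (hk t ht) ks.
have := hd (z + t%:C * k) (le_lt_trans (hk t ht) kd).
have -> : f (z + t%:C * k) - f z - l * (z + t%:C * k - z) = f (z + t%:C * k) -
  (f z + l * (t%:C * k)) by ring.
by move=> h; apply: le_trans h _; rewrite ler_pM2l// hk.
Qed.

Lemma bounded_closed_cabs_compact (K : set R[i]^o) (M : R) :
  closed K -> (forall z, K z -> cabs R z <= M) -> compact K.
Proof.
move=> cK bK.
pose j (p : R * R) : R[i]^o := p.1 +i* p.2.
have cj : continuous j.
  move=> [x y] A /nbhs_cabs[e e0 hA]; apply/nbhs_ballP; exists (e / 2); first
    by rewrite /= divr_gt0.
  move=> [x' y'] [/=]; rewrite /ball /= => hx hy; apply: hA.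
  apply: le_lt_trans (cabs_le _ _) _; rewrite /= distrC [`|y' - y|]distrC.
  by rewrite [e]splitr ltrD.
apply: (@subclosed_compact _ _ (j @` (`[-M, M] `*` `[-M, M]))) => //.
  apply: continuous_compact; first exact: continuous_subspaceT.
  by apply: compact_setX; exact: segment_compact.
move=> [x y] Kz; exists (x, y) => //; have h := bK _ Kz.
have := le_trans (Re_le_cabs _ _) h; have := le_trans (Im_le_cabs _ _) h.
by rewrite /= !in_itv /= -!ler_norml => -> ->.
Qed.

Lemma compact_uniformly (K : set R[i]^o) (P : R -> R[i] -> Prop) : compact K ->
  (forall z, K z -> exists2 del, 0 < del &
     forall w e, cabs R (w - z) < del -> 0 < e < del -> P e w) ->
  exists2 del, 0 < del & forall z e, K z -> 0 < e < del -> P e z.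
Proof.
move=> /compact_near_coveringP cK H.
have : \forall e \near (0 : R)^'+, K `<=` P e.
  apply: cK => z /H[del del0 hd].
  exists ([set w : R[i]^o | cabs R (w - z) < del], [set e | 0 < e < del]) => /=;
    last first.
    by move=> [w e] [/= hw he]; exact: hd.
  split => /=; first by apply/nbhs_cabs; exists del.
  change (\forall e \near (0 : R)^'+, 0 < e < del).
  near=> e; apply/andP; split => //.
rewrite near_withinE => /nbhs_ballP[del /= del0 hd];
  exists del => // z e Kz /andP[e0 ed].
by apply: hd => //; rewrite /ball /= sub0r normrN gtr0_norm.
Unshelve. all: by end_near. Qed.

(** For a quadratic polynomial the sum of the squared moduli at the four points is computed exactly:
    the cross terms cancel, and what remains is at least four times the central value. The expansion
    transfers this to [G] up to an error small against [r ^+ 2], a substitute for the mean value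
    property. *)
Lemma four_point_sum (G : R[i] -> R[i]) z (b c : R[i]) :
  (forall e, 0 < e -> exists2 del, 0 < del & forall k, cabs R k < del ->
     cabs R (G (z + k) - (G z + b * k + c * k ^+ 2)) <= e * cabs R k ^+ 2) ->
  forall kap d0, 0 < kap -> 0 < d0 -> exists2 r, 0 < r < d0 &
    4 * cabs R (G z) ^+ 2 < cabs R (G (z + r%:C)) ^+ 2 + cabs R (G (z - r%:C))
      ^+ 2
     + cabs R (G (z + 0 +i* r)) ^+ 2 + cabs R (G (z - 0 +i* r)) ^+ 2 + kap * r
       ^+ 2.
Proof.
move=> H kap d0 kap0 d00.
pose M := cabs R (G z) + cabs R b + cabs R c.
have M0 : 0 <= M by rewrite !addr_ge0 ?cabs_ge0.
(* Each of the four points loses at most [2 * M * (e * r ^+ 2)], in total less than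
   [kap * r ^+ 2]. *)
pose e := kap / (8 * (M + 1)).
have e0 : 0 < e by rewrite divr_gt0// mulr_gt0// ltr_wpDl.
have [del del0 hd] := H e e0.
pose r := Num.min 1 (Num.min del d0) / 2.
have m0 : 0 < Num.min 1 (Num.min del d0) by rewrite !lt_min ltr01 del0.
have r0 : 0 < r by rewrite /r; lra.
have : r < Num.min 1 (Num.min del d0) by rewrite /r; lra.
rewrite !lt_min => /and3P[r1 rd rd0].
exists r; first by rewrite r0.
pose T k := G z + b * k + c * k ^+ 2.
have hT k : cabs R k = r -> cabs R (T k) ^+ 2 - 2 * M * (e * r ^+ 2) <= cabs R
  (G (z + k)) ^+ 2.
  move=> kr; have := hd k; rewrite kr => /(_ rd) h.
  have TM : cabs R (T k) <= M.
    rewrite /T /M; apply: le_trans (cabsD _ _ _) _; apply: lerD.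
      apply: le_trans (cabsD _ _ _) _; rewrite lerD2l cabsM kr ler_piMr
        ?cabs_ge0// ltW//.
    by rewrite cabsM cabsX kr ler_piMr ?cabs_ge0// exprn_ile1// ltW.
  have := cabs_lipschitz R (T k) (G (z + k)); rewrite cabsBC => h2.
  have h3 := le_trans (ler_norm _) (le_trans h2 h).
  have E0 : 0 <= e * r ^+ 2 by rewrite mulr_ge0 ?sqr_ge0// ltW.
  have g0 := cabs_ge0 R (G (z + k)); have t0 := cabs_ge0 R (T k).
  move: (cabs R (T k)) (cabs R (G (z + k))) (e * r ^+ 2) TM h3 E0 g0 t0 => t g
    E.
  clear -M0 => TM h3 E0 g0 t0.
  have [tE|tE] := leP E t; last first.
    have : t * t <= 2 * M * E by nra.
    have := sqr_ge0 g; rewrite expr2; nra.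
  have : (t - E) ^+ 2 <= g ^+ 2 by rewrite ler_sqr ?nnegrE//; lra.
  have : t * E <= M * E by rewrite ler_wpM2r.
  have := sqr_ge0 E; lra.
have n1 : cabs R r%:C = r by rewrite cabsC gtr0_norm.
have n2 : cabs R (0 +i* r) = r.
  by rewrite cabsCi gtr0_norm.
have := hT r%:C n1; have := hT (- r%:C); rewrite cabsN => /(_ n1).
have := hT (0 +i* r) n2; have := hT (- (0 +i* r)); rewrite cabsN => /(_ n2).
have S : cabs R (T r%:C) ^+ 2 + cabs R (T (- r%:C)) ^+ 2 + cabs R (T (0 +i* r))
  ^+ 2 + cabs R (T (- (0 +i* r))) ^+ 2 =
   4 * cabs R (G z) ^+ 2 + 4 * cabs R b ^+ 2 * r ^+ 2 + 4 * cabs R c ^+ 2 * r ^+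
     4.
  rewrite !cabs_sqr /T !expr2 !ReImE /=; ring.
have rr := ltW r0; have bb := cabs_ge0 R b; have cc := cabs_ge0 R c.
have P1 : 0 <= 4 * cabs R b ^+ 2 * r ^+ 2.
  exact: (mulr_ge0 (mulr_ge0 (ler0n R 4) (exprn_ge0 2 bb)) (exprn_ge0 2 rr)).
have P2 : 0 <= 4 * cabs R c ^+ 2 * r ^+ 4.
  exact: (mulr_ge0 (mulr_ge0 (ler0n R 4) (exprn_ge0 2 cc)) (exprn_ge0 4 rr)).
have L : 8 * M * (e * r ^+ 2) < kap * r ^+ 2.
  rewrite mulrA ltr_pM2r ?exprn_gt0//.
  rewrite /e mulrA ltr_pdivrMr ?mulr_gt0// ?ltr_wpDl//.
  by clear - kap0 M0; nra.
clearbody T; move: S P1 P2 L; clear.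
move: (cabs R (G z) ^+ 2) (4 * cabs R b ^+ 2 * r ^+ 2) (4 * cabs R c ^+ 2 * r ^+
  4) => x0 x1 x2.
move: (kap * r ^+ 2) => x3.
have -> : 8 * M * (e * r ^+ 2) = 4 * (2 * M * (e * r ^+ 2)) by ring.
move: (2 * M * (e * r ^+ 2)) => x4.
lra.
Qed.

End SecondOrderExpansions.

Section MaximumPrinciple.
Variable R : realType.
Implicit Types (z w : R[i]) (x y r : R).
Local Notation cabs := (cabs R).
Local Notation hol := (hol R).
Local Notation cder := (cder R).

Lemma closed_disc_compact (z0 : R[i]) r : compact [set w : R[i]^o | cabs (w -
  z0) <= r].
Proof.
apply: (@bounded_closed_cabs_compact _ _ (r + cabs z0)); last first.
  move=> z /= h; have -> : z = (z - z0) + z0 by ring.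
  by apply: le_trans (cabsD _ _ _) _; rewrite lerD2r.
move=> z /closure_cabs H /=; rewrite leNgt; apply/negP => h.
have [|w /= wr] := H (cabs (z - z0) - r); first by rewrite subr_gt0.
have := cabs_triangle _ z z0 w; rewrite (cabsBC _ z w) => h2 h3.
by clear - wr h2 h3; lra.
Qed.

(** Locally this is the segment bound with a constant comparison function, since the derivative [f]
    of [F] is continuous; compactness makes it uniform. *)
Lemma diff_quotient_uniform (F f : R[i] -> R[i]) z0 s r :
  r < s -> (forall w, cabs (w - z0) < s -> cder F w (f w)) ->
  (forall w, cabs (w - z0) < s -> hol f w) ->
  forall eta, 0 < eta -> exists2 h : R, 0 < h < s - r & forall w, cabs (w - z0)
    <= r ->
    cabs ((F (w + h%:C) - F w) / h%:C - f w) <= eta.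
Proof.
move=> rs dF hf eta eta0.
have [|del del0 hd] := @compact_uniformly R [set w : R[i]^o | cabs (w - z0) <=
  r]
    (fun h w => cabs (F (w + h%:C) - F w - (f w * h%:C + 0 * h%:C ^+ 2 / 2)) <=
      2 * (eta / 2 * cabs h%:C))
    (closed_disc_compact z0 r).
  move=> z /= zr; have [|l hl] := hf z; first exact: le_lt_trans zr rs.
  have [|d d0 hd] := cder_continuous _ _ _ _ hl (eta / 4); first by lra.
  exists (Num.min (d / 2) ((s - r) / 2)); first by rewrite lt_min; apply/andP;
    split; lra.
  move=> w e; rewrite !lt_min => /andP[w1 w2] /and3P[e0 e1 e2].
  have he t : 0 <= t <= 1 -> cabs (t%:C * e%:C) <= e.
    move=> /andP[t0 t1]; rewrite cabsM !cabsC !ger0_norm//; last exact: ltW.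
    by rewrite ler_piMl// ltW.
  have hz t : 0 <= t <= 1 -> cabs (w + t%:C * e%:C - z) < d.
    move=> /he ht; rewrite addrAC; apply: le_lt_trans (cabsD _ _ _) _.
    by clear - ht w1 e1; lra.
  apply: cder_segment_bound => t ht.
    apply: dF; apply: le_lt_trans (cabs_triangle _ _ _ z) _.
    rewrite addrAC; have := cabsD _ (w - z) (t%:C * e%:C); have := he t ht.
    by clear - w2 e2 zr; lra.
  rewrite mul0r addr0; apply: le_trans (cabs_triangle _ _ _ (f z)) _.
  rewrite (cabsBC _ (f z)).
  have h1 := hd _ (hz t ht); have h2 := hd w (lt_le_trans w1 _).
  have := h2 _; rewrite ler_pdivrMr// => /(_ _)/wrap[|h3]; first by clear - d0;
    lra.
  by clear - h1 h3; lra.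
exists (Num.min del (s - r) / 2).
  have : 0 < Num.min del (s - r) by rewrite lt_min del0 subr_gt0.
  have : Num.min del (s - r) <= s - r by rewrite ge_min lexx orbT.
  by clear; move: (Num.min _ _) => m; lra.
have : Num.min del (s - r) / 2 < del.
  have : 0 < Num.min del (s - r) by rewrite lt_min del0 subr_gt0.
  have : Num.min del (s - r) <= del by rewrite ge_min lexx.
  by clear; move: (Num.min _ _) => m; lra.
have : 0 < Num.min del (s - r) / 2 by rewrite divr_gt0// lt_min del0 subr_gt0.
move: (_ / 2) => h h0 hdel w wr.
have := hd w h wr; rewrite h0 hdel => /(_ isT).
have hC0 : h%:C != 0 :> R[i] by rewrite -cabs_eq0 cabsC normr_eq0 gt_eqF.
have E : 2 * (eta / 2 * h) = eta * h by field.
rewrite !mul0r addr0 cabsC gtr0_norm// E => H.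
have -> : (F (w + h%:C) - F w) / h%:C - f w = (F (w + h%:C) - F w - f w * h%:C)
  / h%:C by field.
by rewrite cabsM cabsV cabsC gtr0_norm// ler_pdivrMr.
Qed.

Lemma cabs_comp_continuous_at (u : R[i]^o ->
  R[i]^o) (z : R[i]^o) : {for z, continuous u} ->
  {for z, continuous (fun w : R[i]^o => cabs (u w))}.
Proof.
move=> /cabs_continuous_at H; apply/real_continuous_at => e /H[del del0 hd].
by exists del => // w /hd; apply: le_lt_trans; exact: cabs_lipschitz.
Qed.

Lemma cabs_sqr_continuous_at (G : R[i]^o -> R[i]^o) (z : R[i]^o) :
  {for z, continuous G} -> {for z, continuous (fun w : R[i]^o => cabs (G w) ^+
    2)}.
Proof.
move=> /cabs_comp_continuous_at c1.
rewrite (_ : (fun w => _) = (fun w => cabs (G w) * cabs (G w))).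
  exact: (cvgM c1 c1).
by apply/funext => w; rewrite expr2.
Qed.

Lemma quadratic_continuous_at (G : R[i]^o -> R[i]^o) (z z0 : R[i]^o) (a b : R) :
  {for z, continuous G} -> {for z, continuous (fun w : R[i]^o =>
    cabs (G w) ^+ 2 + (a * cabs w ^+ 2 - b * cabs (w - z0) ^+ 2))}.
Proof.
move=> /cabs_sqr_continuous_at c1.
have /cabs_sqr_continuous_at c2 := hol_continuous _ _ _ (hol_id R z).
have /cabs_sqr_continuous_at c3 :=
  hol_continuous _ _ _ (holB _ _ _ _ (hol_id R z) (hol_cst R z0 z)).
exact: (cvgD c1 (cvgB (cvgM (cvg_cst a) c2) (cvgM (cvg_cst b) c3))).
Qed.

Lemma in_square_cabs z0 s z : in_square R z0 s z -> cabs (z - z0) <= 2 * s.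
Proof.
move=> [h1 h2]; apply: le_trans (cabs_le _ _) _; rewrite mulr2n mulrDl mul1r.
exact: lerD.
Qed.

(* A difference quotient of a primitive of [f] is twice differentiable, so that
   [four_point_sum] forbids interior maxima of [psi] with [f] replaced by it;
   these quotients converge to [f] uniformly. *)
Lemma no_strict_local_max (f : R[i] -> R[i]) z0 s r eps eta : 0 < eps ->
  0 < eta ->
  0 < r -> r < s -> (forall z, in_square R z0 s z -> hol f z) ->
  let psi w := cabs (f w) ^+ 2 + (eps * cabs w ^+ 2 - eps / 2 * cabs (w - z0) ^+
    2) in
  ~ (forall w, cabs (w - z0) = r -> psi w + eta <= psi z0).
Proof.
move=> eps0 eta0 r0 rs hf psi Hpsi.
have s0 : 0 < s by exact: lt_trans rs.
have [F dF] := hol_primitive _ _ _ _ s0 hf.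
have hf' w : cabs (w - z0) < s -> hol f w by move=> h;
  apply/hf/cabs_lt_in_square/ltW.
pose D : set R[i]^o := [set w | cabs (w - z0) <= r].
have D0 : D !=set0 by exists z0; rewrite /D /= subrr cabs0 ltW.
have cD : compact D := closed_disc_compact z0 r.
have [M M0 hM] : exists2 M, 0 <= M & forall w, D w -> cabs (f w) <= M.
  have [|c _ hc] := @compact_EVT_max _ R (fun w : R[i]^o => cabs (f w) ^+ 2) _
    D0 cD.
    apply: continuous_in_subspaceT => w; rewrite inE => Dw.
    by apply: cabs_sqr_continuous_at; apply/hol_continuous/hf';
      exact: le_lt_trans rs.
  exists (cabs (f c)); first exact: cabs_ge0.
  move=> w Dw; have := hc w; rewrite inE => /(_ Dw).
  by rewrite ler_sqr // nnegrE cabs_ge0.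
(* On the disc the squared moduli of [f] and of a function within [et <= 1] of it differ by at most
   [et * (2 * M + 1)], hence by at most a third of [eta]. *)
pose K := 3 * (2 * M + 1).
have K0 : 0 < K by rewrite /K; lra.
pose et := Num.min 1 (eta / K).
have et0 : 0 < et by rewrite lt_min ltr01 divr_gt0.
have [h /andP[h0 hs] hG] := diff_quotient_uniform _ _ _ _ _ rs dF hf' et et0.
pose G w := (F (w + h%:C) - F w) / h%:C.
have Gf w : D w -> `|cabs (G w) ^+ 2 - cabs (f w) ^+ 2| <= eta / 3.
  move=> Dw; have := le_trans (cabs_lipschitz _ _ _) (hG w Dw);
    rewrite -/(G w) => h1.
  have fM := hM w Dw; have f0 := cabs_ge0 _ (f w); have g0 := cabs_ge0 _ (G w).
  have et1 : et <= 1 by rewrite ge_min lexx.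
  have etK : et * K <= eta by rewrite -ler_pdivlMr// ge_min lexx orbT.
  rewrite subr_sqr normrM (ger0_norm (addr_ge0 g0 f0)).
  have h2 : cabs (G w) + cabs (f w) <= 2 * M + 1.
    by move: (le_trans (ler_norm _) h1) fM et1; clear;
      move: (cabs (G w)) (cabs (f w)) et => a b c; lra.
  have : `|cabs (G w) - cabs (f w)| * (cabs (G w) + cabs (f w)) <= et * (2 * M +
    1).
    by apply: ler_pM => //; rewrite addr_ge0.
  rewrite (_ : et * K = 3 * (et * (2 * M + 1))) in etK; last by rewrite /K;
    ring.
  by move: etK; clear; move: (et * _) (`|_| * _) => u t; lra.
pose Q w := eps * cabs w ^+ 2 - eps / 2 * cabs (w - z0) ^+ 2.
pose psih (w : R[i]^o) := cabs (G w) ^+ 2 + Q w.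
have inS w : D w -> cabs (w + h%:C - z0) < s.
  move=> Dw; rewrite addrAC; apply: le_lt_trans (cabsD _ _ _) _.
  rewrite cabsC gtr0_norm//; move: Dw hs; rewrite /D /=; clear; lra.
have cG w : D w -> {for (w : R[i]^o), continuous (G : R[i]^o -> R[i]^o)}.
  move=> Dw; apply: hol_continuous.
  have hF u : cabs (u - z0) < s -> hol F u by exists (f u); exact: dF.
  apply: holM; last exact: hol_cst.
  apply: holB; last by apply: hF; exact: le_lt_trans rs.
  apply: (hol_comp _ (fun w => w + h%:C) F); last by apply: hF; exact: inS.
  by apply: holD; [exact: hol_id|exact: hol_cst].
have [|z2 Dz2 hz2] := @compact_EVT_max _ R psih D D0 cD.
  apply: continuous_in_subspaceT => w; rewrite inE => Dw.
  by apply: quadratic_continuous_at; exact: cG.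
rewrite inE in Dz2.
have {}hz2 w : D w -> psih w <= psih z2 by move=> Dw; apply: hz2; rewrite inE.
(* Passing from [f] to [G] costs [eta / 3] at each of two points, which the gap [eta] on the circle
   absorbs. *)
have z2r : cabs (z2 - z0) < r.
  rewrite lt_neqAle Dz2 andbT; apply/negP => /eqP /Hpsi h1.
  have Dz0 : D z0 by rewrite /D /= subrr cabs0 ltW.
  have := hz2 z0 Dz0; have := Gf z0 Dz0; have := Gf z2 Dz2; move: h1.
  rewrite /psi /psih -/(Q _) -/(Q _) !ler_norml; clear - eta0; lra.
have [l1 hl1] : hol f z2 by apply: hf'; exact: lt_trans rs.
have [l2 hl2] : hol f (z2 + h%:C) by apply: hf'; exact: inS.
have hC0 : h%:C != 0 :> R[i] by rewrite -cabs_eq0 cabsC normr_eq0 gt_eqF.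
have P1 : forall e, 0 < e -> exists2 del, 0 < del & forall k, cabs k < del ->
     cabs (G (z2 + k) - (G z2 + (f (z2 + h%:C) - f z2) / h%:C * k + ((l2 - l1) /
       2 / h%:C) * k ^+ 2)) <= e * cabs k ^+ 2.
  move=> e e0; have eh : 0 < e * h / 2 by rewrite divr_gt0 ?mulr_gt0.
  have s1 : 0 < s - cabs (z2 - z0) by rewrite subr_gt0; exact: lt_trans rs.
  have s2 : 0 < s - cabs (z2 + h%:C - z0) by rewrite subr_gt0; exact: inS.
  have [|d1 d10 hd1] := cder_second_order _ F f z2 l1 _ s1 _ hl1 _ eh.
    move=> w hw; apply: dF; apply: le_lt_trans (cabs_triangle _ _ _ z2) _.
    by clear - hw; lra.
  have [|d2 d20 hd2] := cder_second_order _ F f _ l2 _ s2 _ hl2 _ eh.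
    move=> w hw; apply: dF; apply: le_lt_trans (cabs_triangle _ _ _ (z2 + h%:C))
      _.
    by clear - hw; lra.
  exists (Num.min d1 d2); first by rewrite lt_min d10.
  move=> k; rewrite lt_min => /andP[/hd1 k1 /hd2 k2].
  rewrite /G.
  set E2 := _ - _ in k2; set E1 := _ - _ in k1.
  rewrite [X in cabs X](_ : _ = (E2 - E1) / h%:C); last first.
    by rewrite /E1 /E2 (addrAC z2 k); field.
  rewrite cabsM cabsV cabsC gtr0_norm// ler_pdivrMr//.
  apply: le_trans (cabsB _ _ _) _.
  by move: k1 k2; clear; move: (cabs k ^+ 2) => q; lra.
(* Over the four points [Q] gains [4 * eps - 2 * eps] times [rho ^+ 2], exactly the loss allowed to
   [G] by this choice. *)
have kap0 : 0 < 2 * eps by lra.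
have [|rho /andP[rho0 rhod] fps] := four_point_sum _ _ _ _ _ P1 _ (r - cabs (z2
  - z0)) kap0.
  by rewrite subr_gt0.
move: fps.
have inD k : cabs k = rho -> D (z2 + k).
  move=> kr; rewrite /D /= addrAC; apply: le_trans (cabsD _ _ _) _.
  by rewrite kr; clear - rhod; lra.
have n1 : cabs rho%:C = rho by rewrite cabsC gtr0_norm.
have n2 : cabs (0 +i* rho) = rho.
  by rewrite cabsCi gtr0_norm.
have := hz2 _ (inD _ n1); have := hz2 _ (inD _ n2).
have := hz2 _ (inD (- _) (etrans (cabsN _ _) n1)).
have := hz2 _ (inD (- _) (etrans (cabsN _ _) n2)).
have : Q (z2 + rho%:C) + Q (z2 - rho%:C) + Q (z2 + 0 +i* rho) + Q (z2 - 0 +i*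
  rho) = 4 * Q z2 + 2 * eps * rho ^+ 2.
  by rewrite /Q !cabs_sqr !ReImE /=; field.
rewrite /psih; clearbody Q G; clear.
move: (Q (z2 + _)) (Q (z2 - _)) (Q (z2 + _)) (Q (z2 - _)) (Q z2) => q1 q2 q3 q4
  q5.
by move: (2 * eps * rho ^+ 2) => q; lra.
Qed.

Lemma closure_bounded (W : set R[i]^o) (B : R) : (forall z, W z ->
  cabs z <= B) ->
  forall z, closure W z -> cabs z <= B.
Proof.
move=> bW z /closure_cabs H; apply/ler_addgt0Pl => e e0; have [w Ww hw] :=
  H e e0.
have -> : z = (z - w) + w by ring.
by apply: le_trans (cabsD _ _ _) _; rewrite cabsBC; apply: lerD;
  [exact: ltW|exact: bW].
Qed.

Lemma closure_compact_bounded (W : set R[i]^o) (B : R) : (forall z, W z ->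
  cabs z <= B) ->
  compact (closure W).
Proof.
move=> bW; apply: (@bounded_closed_cabs_compact _ _ B);
  first exact: closed_closure.
exact: closure_bounded.
Qed.

(** A maximum of the squared modulus need not be strict. Adding [eps * cabs z ^+ 2] leaves room to
    subtract a smaller multiple of the squared distance to the maximum point, which makes it
    strict. *)
Theorem maximum_principle (W : set R[i]^o) (f : R[i] -> R[i]) (m B : R) :
  open W -> (forall z, W z -> cabs z <= B) -> 0 <= m ->
  (forall z, W z -> hol f z) ->
  (forall z : R[i]^o, closure W z -> {for z, continuous (f : R[i]^o ->
    R[i]^o)}) ->
  (forall z, closure W z -> ~ W z -> cabs (f z) <= m) ->
  forall z, W z -> cabs (f z) <= m.
Proof.
move=> oW bW m0 hf cf bd z1 Wz1; rewrite leNgt; apply/negP => fz1.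
have bcW := closure_bounded W B bW.
have cW := closure_compact_bounded W B bW.
have sub := @subset_closure _ W.
have B0 : 0 <= B by apply: le_trans (bW _ Wz1); exact: cabs_ge0.
have g0 : 0 < cabs (f z1) ^+ 2 - m ^+ 2.
  by rewrite subr_gt0 ltr_sqr ?nnegrE ?cabs_ge0.
have K0 : 0 < B ^+ 2 + 1 by rewrite ltr_wpDl ?sqr_ge0.
(* On the closure of [W] the added term stays below the excess at [z1], so the maximum does not move
   to the boundary. *)
pose eps := (cabs (f z1) ^+ 2 - m ^+ 2) / (B ^+ 2 + 1).
have eps0 : 0 < eps by rewrite divr_gt0.
have epsB : eps * B ^+ 2 < cabs (f z1) ^+ 2 - m ^+ 2.
  by rewrite /eps mulrAC ltr_pdivrMr// ltr_pM2l// ltrDl.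
pose phi (z : R[i]^o) := cabs (f z) ^+ 2 + (eps * cabs z ^+ 2 - 0 * cabs (z - 0)
  ^+ 2).
have phiE z : phi z = cabs (f z) ^+ 2 + eps * cabs z ^+ 2
  by rewrite /phi mul0r subr0.
have [||z0 cz0 hz0] := @compact_EVT_max _ R phi _ _ cW.
- by exists z1; exact: sub.
- apply: continuous_in_subspaceT => w; rewrite inE => Dw.
  by apply: quadratic_continuous_at; exact: cf.
rewrite inE in cz0.
have Wz0 : W z0.
  apply: contrapT => nW; have h1 := bd _ cz0 nW.
  have := hz0 z1; rewrite inE => /(_ (sub _ Wz1)); rewrite !phiE.
  have : 0 <= eps * cabs z1 ^+ 2 by rewrite mulr_ge0 ?sqr_ge0// ltW.
  have : cabs (f z0) ^+ 2 <= m ^+ 2 by rewrite ler_sqr ?nnegrE ?cabs_ge0.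
  have : eps * cabs z0 ^+ 2 <= eps * B ^+ 2.
    by rewrite ler_pM2l// ler_sqr ?nnegrE ?cabs_ge0// bcW.
  by clear - epsB; lra.
have [e e0 he] := (open_cabs _ _).1 oW z0 Wz0.
(* The square of half-side [e / 4] stays within [e] of [z0]; on the circle of radius [e / 8] the
   subtracted term is [eps / 2 * (e / 8) ^+ 2], which is the gap. *)
apply: (@no_strict_local_max f z0 (e / 4) (e / 8) eps (eps / 2 * (e / 8) ^+ 2))
  => //.
- by rewrite mulr_gt0 ?exprn_gt0 ?divr_gt0.
- by rewrite divr_gt0.
- by clear - e0; lra.
- move=> z /in_square_cabs h; apply/hf/he; clear - h e0; lra.
move=> w hw; rewrite /= subrr cabs0 hw expr0n /= mulr0 subr0.
have := hz0 w; rewrite inE => /(_ _)/wrap[|h].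
  by apply/sub/he; rewrite hw; clear - e0; lra.
rewrite !phiE in h; move: h; clear.
move: (eps / 2 * _) (_ ^+ 2 + _) (cabs (f w) ^+ 2) (eps * _) => a b c d; lra.
Qed.

End MaximumPrinciple.

(** * Consequences of the maximum principle *)

Section FunctionTheory.
Variable R : realType.
Implicit Types (z w : R[i]) (x y r : R).
Local Notation cabs := (cabs R).
Local Notation hol := (hol R).
Local Notation cder := (cder R).

(** The maximum principle for the inverse of [u - w], which has no pole on the closure: on the
    boundary the lower bound [m] is positive. *)
Lemma minimum_principle (W : set R[i]^o) (u : R[i] -> R[i]) w (m B : R) :
  open W -> (forall z, W z -> cabs z <= B) -> 0 < m -> (forall z, hol u z) ->
  (forall z, W z -> u z != w) ->
  (forall z, closure W z -> ~ W z -> m <= cabs (u z - w)) ->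
  forall z, W z -> m <= cabs (u z - w).
Proof.
move=> oW bW m0 hu nw bd z Wz.
have nw' v : closure W v -> u v - w != 0.
  move=> cv; rewrite subr_eq0; have [/nw//|nWv] := pselect (W v).
  by rewrite -subr_eq0 -cabs_gt0; apply: lt_le_trans (bd _ cv nWv).
have hv v : closure W v -> hol (fun z => (u z - w)^-1) v.
  move=> /nw' h; apply: holV => //; apply: holB; [exact: hu|exact: hol_cst].
have sub := @subset_closure _ W.
have m10 : 0 <= m^-1 by rewrite invr_ge0 ltW.
have := @maximum_principle R W (fun z => (u z - w)^-1) m^-1 B oW bW m10 _ _ _ z
  Wz.
rewrite cabsV lef_pV2 ?posrE ?cabs_gt0 ?nw'//; last exact: sub.
apply=> [v Wv|v cv|v cv nWv].
- by apply: hv; exact: sub.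
- by apply: hol_continuous; exact: hv.
- by rewrite cabsV lef_pV2 ?posrE ?cabs_gt0 ?nw'//; exact: bd.
Qed.

Lemma bernoulli_ineq x n : 0 <= x -> 1 + n%:R * x <= (1 + x) ^+ n.
Proof.
move=> x0; elim: n => [|n IH]; first by rewrite mul0r addr0 expr0.
rewrite exprS; apply: (@le_trans _ _ ((1 + x) * (1 + n%:R * x))); last first.
  by rewrite ler_wpM2l// addr_ge0.
have : 0 <= n%:R * x * x by rewrite !mulr_ge0.
by rewrite -natr1; lra.
Qed.

Lemma le_of_bounded_powers (d C s t : R) : 0 < d -> 0 <= s -> 0 <= t ->
  (forall n, d * t ^+ n <= C * s ^+ n) -> t <= s.
Proof.
move=> d0 s0 t0 H; rewrite leNgt; apply/negP => st.
(* The midpoint is positive even when [s] is zero, so that one may divide by it. *)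
pose s' := (s + t) / 2; have s'0 : 0 < s' by rewrite /s'; lra.
have ss' : s <= s' by rewrite /s'; lra.
pose y := t / s' - 1.
have y0 : 0 < y by rewrite /y subr_gt0 ltr_pdivlMr// /s'; lra.
have C0 : 0 <= C.
  by have := H 0%N; rewrite !expr0 !mulr1; apply: le_trans; exact: ltW.
have key n : 1 + n%:R * y <= C / d.
  apply: le_trans (bernoulli_ineq _ n (ltW y0)) _.
  rewrite /y addrC subrK expr_div_n ler_pdivlMr// mulrC mulrA ler_pdivrMr
    ?exprn_gt0//.
  apply: le_trans (H n) _; rewrite ler_wpM2l//.
  by apply: lerXn2r => //; rewrite nnegrE// ltW.
have := key (Num.truncn (C / d / y)).+1.
have := truncnS_gt (C / d / y); rewrite ltr_pdivrMr//.
by move=> h1 h2; have := lt_le_trans h1 (le_trans (_ : _ <= 1 + _) h2);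
  rewrite lerDr ltxx => /(_ ler01).
Qed.

(** The quotient [q] is only known to be continuous at [a]. Multiplied by [w - a], its powers vanish
    there, so the centre becomes a harmless boundary point of the punctured disc; letting the
    exponent grow removes the influence of this factor. *)
Lemma schwarz_bound (f : R[i] -> R[i]) a r r' B :
  0 < r -> r < r' -> (forall z, cabs (z - a) < r' -> hol f z) ->
  (forall z, cabs (z - a) <= r -> cabs (f z) <= B) ->
  forall z, cabs (z - a) < r -> cabs (f z - f a) <= 2 * B / r * cabs (z - a).
Proof.
move=> r0 rr' hf fB z zr.
have [->|za] := eqVneq z a; first by rewrite !subrr cabs0 mulr0.
have [l hl] : hol f a by apply: hf; rewrite subrr cabs0 (lt_trans r0).
pose q w := if w == a then l else (f w - f a) / (w - a).
pose W : set R[i]^o := [set w | 0 < cabs (w - a) < r].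
have fa : cabs (f a) <= B by apply: fB; rewrite subrr cabs0 ltW.
have B0 : 0 <= B by apply: le_trans fa; exact: cabs_ge0.
have oW : open W.
  apply/open_cabs => w /andP[w0 wr].
  exists (Num.min (cabs (w - a)) (r - cabs (w - a))); first
    by rewrite lt_min w0 subr_gt0.
  move=> v; rewrite lt_min => /andP[v1 v2]; rewrite /W /=.
  have h1 := cabs_triangle _ v a w; have h2 := cabs_triangle _ w a v.
  by rewrite (cabsBC _ w v) in h2; clear - h1 h2 v1 v2; apply/andP; split; lra.
have cW w : closure W w -> cabs (w - a) <= r.
  move=> /closure_cabs H; apply/ler_addgt0Pl => e e0.
  have [v /andP[_ vr] hv] := H e e0; have h := cabs_triangle _ w a v.
  by rewrite (cabsBC _ w v) in h; clear - h hv vr; lra.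
have hq w : w != a -> cabs (w - a) < r' -> hol q w.
  move=> wa wr'; have wa0 : 0 < cabs (w - a) by rewrite cabs_gt0 subr_eq0.
  apply: (@hol_near R (fun w => (f w - f a) / (w - a)) _ _ (cabs (w - a))) =>
    //.
    move=> v hv; rewrite /q; case: eqVneq => // va.
    by move: hv; rewrite va cabsBC ltxx.
  apply: holM; first by apply: holB; [exact: hf|exact: hol_cst].
  by apply: holV; [rewrite subr_eq0|apply: holB;
    [exact: hol_id|exact: hol_cst]].
have cq : {for (a : R[i]^o), continuous (q : R[i]^o -> R[i]^o)}.
  apply/cabs_continuous_at => e e0; have e20 : 0 < e / 2 by rewrite divr_gt0.
  have [del del0 hd] := hl _ e20; exists del => // w /hd hw.
  rewrite /q eqxx; case: eqVneq => [_|wa]; first by rewrite subrr cabs0.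
  have wa0 : w - a != 0 by rewrite subr_eq0.
  have -> : (f w - f a) / (w - a) - l = (f w - f a - l * (w - a)) / (w - a)
    by field.
  rewrite cabsM cabsV ltr_pdivrMr ?cabs_gt0//; apply: le_lt_trans hw _.
  by rewrite ltr_pM2r ?cabs_gt0// gtr_pMr// invf_lt1// ltr1n.
have cqn n : {for (a : R[i]^o), continuous ((fun w => q w ^+ n) : R[i]^o ->
  R[i]^o)}.
  elim: n => [|n IH]; first by apply: hol_continuous; exact: hol_cst.
  rewrite (_ : (fun w => _) = (fun w => q w * q w ^+ n));
    first exact: (cvgM cq IH).
  by apply/funext => w; rewrite exprS.
have bW w : W w -> cabs w <= r + cabs a.
  move=> /andP[_ wr]; have -> : w = (w - a) + a by ring.
  by apply: le_trans (cabsD _ _ _) _; rewrite lerD2r ltW.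
have key n : cabs (z - a) * cabs (q z) ^+ n <= r * (2 * B / r) ^+ n.
  have s0 : 0 <= r * (2 * B / r) ^+ n.
    by rewrite mulr_ge0 ?exprn_ge0 ?divr_ge0 ?mulr_ge0// ltW.
  rewrite -cabsX -cabsM.
  apply: (@maximum_principle R W (fun w => (w - a) * q w ^+ n) _ _ oW bW s0).
  - move=> w /andP[wa wr]; rewrite cabs_gt0 subr_eq0 in wa.
    apply: holM; first by apply: holB; [exact: hol_id|exact: hol_cst].
    by apply/holX/hq => //; exact: lt_trans rr'.
  - move=> w /cW wr; have [->|wa] := eqVneq w a.
      exact: (cvgM (hol_continuous _ _ _ (holB _ _ _ _ (hol_id R a) (hol_cst R a
        a))) (cqn n)).
    apply: hol_continuous; apply: holM; first by apply: holB;
      [exact: hol_id|exact: hol_cst].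
    by apply/holX/hq => //; exact: le_lt_trans rr'.
  - move=> w /cW wr nW; have [->|wa] := eqVneq w a; first
    by rewrite subrr mul0r cabs0.
    have wr1 : cabs (w - a) = r.
      apply/eqP; rewrite eq_le wr /= leNgt; apply/negP => h; apply: nW.
      by rewrite /W /= h cabs_gt0 subr_eq0 wa.
    rewrite cabsM cabsX wr1 ler_pM2l// lerXn2r ?nnegrE ?cabs_ge0//.
      by rewrite divr_ge0 ?mulr_ge0// ltW.
    rewrite /q (negbTE wa) cabsM cabsV wr1 ler_pM2r ?invr_gt0//.
    apply: le_trans (cabsB _ _ _) _; rewrite mulr2n mulrDl mul1r;
      apply: lerD => //.
    by apply: fB; rewrite wr1.
  - by rewrite /W /= zr cabs_gt0 subr_eq0 za.
have := le_of_bounded_powers _ _ _ _ _ _ _ key.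
rewrite cabs_gt0 subr_eq0 za divr_ge0 ?mulr_ge0 ?cabs_ge0 ?(ltW r0)//.
move=> /(_ isT isT isT); rewrite {1}/q (negbTE za) cabsM cabsV ler_pdivrMr//.
by rewrite cabs_gt0 subr_eq0.
Qed.

Lemma liouville (f : R[i] -> R[i]) B : (forall z, hol f z) ->
  (forall z, cabs (f z) <= B) -> forall z, f z = f 0.
Proof.
move=> hf fB z; apply/eqP; rewrite -subr_eq0 -cabs_eq0 eq_le cabs_ge0 andbT.
have B0 : 0 <= B by apply: le_trans (fB 0); exact: cabs_ge0.
apply/ler_addgt0Pl => e e0; rewrite addr0.
(* The first term makes [2 * B * cabs z / r] at most [e]; the others put [z] inside the disc and
   keep [r] positive. *)
pose r := 2 * B * cabs z / e + cabs z + 1.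
have z0 := cabs_ge0 _ z.
have p0 : 0 <= 2 * B * cabs z / e by rewrite divr_ge0 ?mulr_ge0// ltW.
have r0 : 0 < r by rewrite /r; clear - p0 z0; lra.
have rr' : r < r + 1 by lra.
have zr : cabs (z - 0) < r by rewrite subr0 /r; clear - p0 z0; lra.
have := @schwarz_bound f 0 r (r + 1) B r0 rr' (fun z _ => hf z) (fun z _ => fB
  z) z zr.
rewrite subr0 => h; apply: le_trans h _.
rewrite mulrAC ler_pdivrMr// -ler_pdivrMl// mulrC /r; clear - z0; lra.
Qed.

Lemma real_cauchy_limit (u : nat -> R) :
  (forall e, 0 < e -> exists N, forall k l, (N <= k)%N -> (N <= l)%N ->
    `|u k - u l| <= e) ->
  exists L, forall e, 0 < e -> exists N, forall k, (N <= k)%N ->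
    `|u k - L| <= e.
Proof.
(* [sup S] is the lower limit of the sequence. *)
move=> H; pose S := [set x : R | exists N, forall k, (N <= k)%N -> x <= u k].
have key e : 0 < e -> exists N, [/\ S (u N - e), ubound S (u N + e) &
    forall k, (N <= k)%N -> `|u k - u N| <= e].
  move=> e0; have [N hN] := H e e0; exists N; split; last by move=> k Nk;
    exact: hN.
    exists N => k Nk; have := hN k N Nk (leqnn N); rewrite ler_norml; lra.
  move=> x [N' hN']; have := hN' _ (leq_maxr N N').
  have := hN (maxn N N') N (leq_maxl _ _) (leqnn N); rewrite ler_norml; lra.
exists (sup S) => e e0; have e20 : 0 < e / 2 by rewrite divr_gt0.
have [N [SN ubN hN]] := key _ e20; exists N => k /hN hk.
have h1 : u N - e / 2 <= sup S by apply: ub_le_sup => //; exists (u N + e / 2).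
have h2 : sup S <= u N + e / 2 by apply: ge_sup => //; exists (u N - e / 2).
by move: hk; rewrite !ler_norml; lra.
Qed.

Lemma complex_cauchy_limit (u : nat -> R[i]) :
  (forall e, 0 < e -> exists N, forall k l, (N <= k)%N -> (N <= l)%N ->
    cabs (u k - u l) <= e) ->
  exists L, forall e, 0 < e -> exists N, forall k, (N <= k)%N ->
    cabs (u k - L) <= e.
Proof.
move=> H.
have [|a ha] := @real_cauchy_limit (fun k => complex.Re (u k)).
  move=> e /H[N hN]; exists N => k l Nk Nl; apply: le_trans (hN k l Nk Nl).
  by rewrite -cReN -cReD Re_le_cabs.
have [|b hb] := @real_cauchy_limit (fun k => complex.Im (u k)).
  move=> e /H[N hN]; exists N => k l Nk Nl; apply: le_trans (hN k l Nk Nl).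
  by rewrite -cImN -cImD Im_le_cabs.
exists (a +i* b) => e e0; have e20 : 0 < e / 2 by rewrite divr_gt0.
have [N1 h1] := ha _ e20; have [N2 h2] := hb _ e20; exists (maxn N1 N2) => k.
rewrite geq_max => /andP[/h1 k1 /h2 k2]; apply: le_trans (cabs_le _ _) _.
by rewrite !ReImE /= [e]splitr lerD.
Qed.

Lemma cder_le (f : R[i] -> R[i]) a l C r : 0 < r -> cder f a l ->
  (forall z, cabs (z - a) < r -> cabs (f z - f a) <= C * cabs (z - a)) ->
    cabs l <= C.
Proof.
move=> r0 hl hC; apply/ler_addgt0Pl => e e0.
have [del del0 hd] := hl e e0.
pose t := Num.min r del / 2.
have m0 : 0 < Num.min r del by rewrite lt_min r0.
have t0 : 0 < t by rewrite divr_gt0.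
have : t < Num.min r del by rewrite /t; clear - m0; lra.
rewrite lt_min => /andP[tr td].
have E : a + t%:C - a = t%:C by ring.
have tC : cabs t%:C = t by rewrite cabsC gtr0_norm.
have := hC (a + t%:C); have := hd (a + t%:C);
  rewrite E tC => /(_ td) h1 /(_ tr) h2.
rewrite -(ler_pM2r t0) -{1}tC -cabsM.
have -> : l * t%:C = (f (a + t%:C) - f a) - (f (a + t%:C) - f a - l * t%:C)
  by ring.
by apply: le_trans (cabsB _ _ _) _; rewrite mulrDl addrC lerD.
Qed.

(** By [schwarz_bound] applied to differences, the difference quotients of the [u k] at [a] are
    uniformly Cauchy; so the derivatives at [a] converge, and their limit is the derivative of
    [h]. *)
Lemma uniform_limit_hol (W : set R[i]^o) (u : nat -> R[i] -> R[i]) (h : R[i] ->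
  R[i]) :
  open W -> (forall k z, W z -> hol (u k) z) ->
  (forall e, 0 < e -> exists N, forall k z, (N <= k)%N -> W z ->
    cabs (u k z - h z) <= e) ->
  forall z, W z -> hol h z.
Proof.
move=> oW hu uh a Wa; have [s s0 hs] := (open_cabs _ _).1 oW a Wa.
have Wd z : cabs (z - a) <= s / 2 -> W z by move=> hz; apply: hs; clear - hz s0;
  lra.
have r0 : 0 < s / 2 by rewrite divr_gt0.
have rs : s / 2 < s by lra.
have [l hl] := choice (fun k => hu k a Wa).
pose r := s / 2.
have key e : 0 < e -> exists N, forall k k', (N <= k)%N -> (N <= k')%N ->
  forall z, cabs (z - a) < r ->
   cabs ((u k z - u k' z) - (u k a - u k' a)) <= e * cabs (z - a).
  move=> e0; have er : 0 < e * r / 4 by rewrite divr_gt0 ?mulr_gt0.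
  have [N hN] := uh _ er; exists N => k k' Nk Nk' z zr.
  have -> : e = 2 * (e * r / 4 + e * r / 4) / r.
    by field; rewrite /r gt_eqF.
  apply: (@schwarz_bound (fun z => u k z - u k' z) a r s) => // w hw.
    by apply: holB; apply: hu; exact: hs.
  have -> : u k w - u k' w = (u k w - h w) - (u k' w - h w) by ring.
  by apply: le_trans (cabsB _ _ _) _; apply: lerD; apply: hN => //; exact: Wd.
have [|L hL] := complex_cauchy_limit l.
  move=> e /key[N hN]; exists N => k k' Nk Nk'.
  apply: (@cder_le (fun z => u k z - u k' z) a _ _ r) => //; last exact: hN.
  move=> e' e0'; have e20' : 0 < e' / 2 by rewrite divr_gt0.
  have [d1 d10 hd1] := hl k _ e20'; have [d2 d20 hd2] := hl k' _ e20'.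
  exists (Num.min d1 d2); first by rewrite lt_min d10.
  move=> w; rewrite lt_min => /andP[/hd1 w1 /hd2 w2].
  have -> : u k w - u k' w - (u k a - u k' a) - (l k - l k') * (w - a) =
    (u k w - u k a - l k * (w - a)) - (u k' w - u k' a - l k' * (w - a))
      by ring.
  apply: le_trans (cabsB _ _ _) _; move: w1 w2; clear;
    move: (cabs (w - a)) => t; lra.
exists L => e e0; have e40 : 0 < e / 4 by rewrite divr_gt0.
have [N1 hN1] := key _ e40; have [N2 hN2] := hL _ e40.
pose k := maxn N1 N2.
have [del del0 hd] := hl k _ e40.
exists (Num.min r del); first by rewrite lt_min r0.
move=> z; rewrite lt_min => /andP[zr /hd hz].
have Wz : W z by apply: Wd; exact: ltW.
(* Let [k'] tend to infinity in [key]. *)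
have h1 : cabs ((u k z - h z) - (u k a - h a)) <= e / 4 * cabs (z - a).
  apply/ler_addgt0Pl => d d0; have d20 : 0 < d / 2 by rewrite divr_gt0.
  have [N3 hN3] := uh _ d20; pose k' := maxn N1 N3.
  have -> : (u k z - h z) - (u k a - h a) =
     ((u k z - u k' z) - (u k a - u k' a)) + ((u k' z - h z) - (u k' a - h a))
       by ring.
  rewrite addrC; apply: le_trans (cabsD _ _ _) _; apply: lerD.
    rewrite [d]splitr; apply: le_trans (cabsB _ _ _) _.
    by apply: lerD; apply: hN3 => //; exact: leq_maxr.
  by apply: hN1 => //; exact: leq_maxl.
have h2 := hN2 k (leq_maxr _ _).
have -> : h z - h a - L * (z - a) = (u k z - u k a - l k * (z - a)) -
   ((u k z - h z) - (u k a - h a)) + (l k - L) * (z - a) by ring.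
apply: le_trans (cabsD _ _ _) _.
apply: le_trans (lerD (cabsB _ _ _) (lexx _)) _; rewrite cabsM.
have h3 : cabs (l k - L) * cabs (z - a) <= e / 4 * cabs (z - a).
  by rewrite ler_wpM2r ?cabs_ge0.
have : 0 <= e / 4 * cabs (z - a) by rewrite mulr_ge0 ?cabs_ge0// ltW.
have -> : e * cabs (z - a) = 4 * (e / 4 * cabs (z - a)) by field.
by move: hz h1 h3; clear; move: (e / 4 * _) => q; lra.
Qed.

End FunctionTheory.

(** * Normal families *)

Section NormalFamilies.
Variable R : realType.
Implicit Types (z w : R[i]) (x y r : R).
Local Notation cabs := (cabs R).
Local Notation hol := (hol R).
Local Notation C := (R[i]^o).

Lemma uniform_cvg_cabs (V : set C) (u : nat -> C -> C) (h : C -> C) :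
  {uniform V, u @ \oo --> h} <-> forall e : R, 0 < e ->
    exists N, forall k w, (N <= k)%N -> V w -> cabs (u k w - h w) < e.
Proof.
split=> [H e e0|H P /uniform_nbhs[E [entE EP]]].
  have : nbhs (h : {uniform` V -> C}) [set f | forall w, V w ->
    cabs (f w - h w) < e].
    apply/uniform_nbhs; exists [set p : C * C | ball p.1 (e%:C : R[i]) p.2];
      split.
      by rewrite -entourage_ballE; exists e%:C => //=; rewrite ltcR.
    by move=> f /= fV w /fV; rewrite /ball /= distrC normE ltcR.
  by move=> /H [N _ HN]; exists N => k w Nk Vw; exact: HN.
move: entE; rewrite -entourage_ballE => -[[a b] /= +] sub.
rewrite ltcE /= => /andP[/eqP b0 a0].
have [N hN] := H a a0; exists N => // k /= Nk; apply: EP => w Vw; apply: sub.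
by rewrite /ball /= distrC normE b0 ltcR; exact: hN.
Qed.

Lemma eventually_ex (P : nat -> Prop) :
  (\forall k \near \oo, P k) <-> exists N, forall k, (N <= k)%N -> P k.
Proof. by split=> [[N _ HN]|[N HN]]; exists N. Qed.

(** A Cauchy condition in place of convergence, so that no limit function is carried along. The
    bound makes this case incompatible with [inf_at]. *)
Definition fin_at (v : nat -> C -> C) (z : C) := exists2 del : R, 0 < del &
  (forall e, 0 < e -> exists N, forall k l w, (N <= k)%N -> (N <= l)%N ->
     cabs (w - z) < del -> cabs (v k w - v l w) <= e) /\
  (exists (M : R) N, forall k w, (N <= k)%N -> cabs (w - z) < del ->
    cabs (v k w) <= M).

Definition inf_at (v : nat -> C -> C) (z : C) := exists2 del : R, 0 < del &
  forall M, exists N, forall k w, (N <= k)%N -> cabs (w - z) < del ->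
    M < cabs (v k w).

Definition increasing_nat (phi : nat -> nat) := {homo phi : i j / (i < j)%N}.

Lemma increasing_nat_ge phi k : increasing_nat phi -> (k <= phi k)%N.
Proof.
by move=> hphi; elim: k => // k IH; apply: leq_ltn_trans IH (hphi _ _ (ltnSn
  k)).
Qed.

Lemma increasing_nat_comp phi psi : increasing_nat phi -> increasing_nat psi ->
  increasing_nat (phi \o psi).
Proof. by move=> h1 h2 i j /h2 /h1. Qed.

Lemma fin_at_sub v z phi : increasing_nat phi -> fin_at v z ->
  fin_at (v \o phi) z.
Proof.
move=> hphi [del del0 [H1 [M [N HM]]]]; exists del => //; split.
  move=> e /H1[N' hN']; exists N' => k l w Nk Nl.
  by apply: hN'; [apply: leq_trans Nk _|apply: leq_trans Nl _];
    exact: increasing_nat_ge.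
exists M, N => k w Nk; apply: HM; apply: leq_trans Nk _;
  exact: increasing_nat_ge.
Qed.

Lemma inf_at_sub v z phi : increasing_nat phi -> inf_at v z ->
  inf_at (v \o phi) z.
Proof.
move=> hphi [del del0 H]; exists del => // M; have [N hN] := H M;
  exists N => k w Nk.
apply: hN; apply: leq_trans Nk _; exact: increasing_nat_ge.
Qed.

Lemma fin_inf_at v z : fin_at v z -> inf_at v z -> False.
Proof.
move=> [d1 d10 [_ [M [N HM]]]] [d2 d20 H]; have [N' HN'] := H M.
have := HM (maxn N N') z (leq_maxl _ _); have :=
  HN' (maxn N N') z (leq_maxr _ _).
rewrite subrr cabs0 => /(_ d20) h1 /(_ d10); by rewrite leNgt h1.
Qed.

Lemma normal_dichotomy (W : set C) (G : set (C -> C)) (u : nat -> C -> C) :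
  open W -> normal_on W G -> (forall k, G (u k)) ->
  exists2 phi, increasing_nat phi &
    (forall z, W z -> fin_at (u \o phi) z) \/ (forall z, W z ->
      inf_at (u \o phi) z).
Proof.
move=> oW nW Gu; have [phi [hphi [[h hh H]|H]]] := nW u Gu; exists phi => //.
  left=> z Wz; have [V /nbhs_cabs[del del0 hV] /uniform_cvg_cabs HV] := H z Wz.
  have [l hl] : hol h z by apply/derivable_hol; exact: hh.
  have [d d0 hd] := cder_continuous _ _ _ _ hl 1 ltr01.
  exists (Num.min del d); first by rewrite lt_min del0.
  split.
    move=> e e0; have e20 : 0 < e / 2 by rewrite divr_gt0.
    have [N hN] := HV _ e20; exists N => k l' w Nk Nl;
      rewrite lt_min => /andP[/hV w1 _].
    have -> : (u \o phi) k w - (u \o phi) l' w = ((u \o phi) k w - h w) - ((u \o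
      phi) l' w - h w) by ring.
    rewrite [e]splitr; apply: le_trans (cabsB _ _ _) _.
    by apply: lerD; apply/ltW/hN.
  have [N hN] := HV _ ltr01; exists (cabs (h z) + 2), N => k w Nk.
  rewrite lt_min => /andP[/hV w1 /hd w2]; have h1 := hN k w Nk w1.
  have -> : (u \o phi) k w = ((u \o phi) k w - h w) + (h w - h z) + h z by ring.
  apply: le_trans (cabsD _ _ _) _; apply: le_trans (lerD (cabsD _ _ _) (lexx _))
    _.
  by move: h1 w2; clear; lra.
right=> z Wz; have [V /nbhs_cabs[del del0 hV] HV] := H z Wz; exists del => // M.
have [N hN] := (eventually_ex _).1 (HV M); exists N => k w Nk /hV Vw.
by have := hN k Nk w Vw; rewrite normE ltcR.
Qed.

Lemma compact_uniformly_nat (K : set C) (P : nat -> C -> Prop) : compact K ->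
  (forall z, K z -> exists2 del, 0 < del & exists N,
     forall w n, cabs (w - z) < del -> (N <= n)%N -> P n w) ->
  exists N, forall z n, K z -> (N <= n)%N -> P n z.
Proof.
move=> /compact_near_coveringP cK H.
have : \forall n \near \oo, K `<=` P n.
  apply: cK => z /H[del del0 [N hd]].
  exists ([set w : C | cabs (w - z) < del], [set n | (N <= n)%N]) => /=;
    last first.
    by move=> [w n] [/= hw hn]; exact: hd.
  by split => /=; [apply/nbhs_cabs; exists del|exists N].
by move=> /eventually_ex[N hN]; exists N => z n Kz /hN; apply.
Qed.

(** After successive extractions, each of finitely many sets of normality covering [K] has its own
    alternative. The points of either kind form disjoint open sets covering [K], and connectedness
    leaves only one kind. *)
Lemma normal_on_compact (K : set C) (G : set (C -> C)) (u : nat -> C -> C) :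
  compact K -> connected K -> K `<=` fatou_set G -> (forall k, G (u k)) ->
  exists2 phi, increasing_nat phi &
   ((forall e, 0 < e -> exists N, forall k l z, (N <= k)%N -> (N <= l)%N ->
     K z ->
        cabs (u (phi k) z - u (phi l) z) <= e) /\
    (exists (M : R) N, forall k z, (N <= k)%N -> K z ->
      cabs (u (phi k) z) <= M))
   \/ (forall M, exists N, forall k z, (N <= k)%N -> K z ->
     M < cabs (u (phi k) z)).
Proof.
move=> cK conK KF Gu.
have [phi hphi dich] : exists2 phi, increasing_nat phi &
    forall z, K z -> fin_at (u \o phi) z \/ inf_at (u \o phi) z.
  have := cK; rewrite compact_cover => /(_ _ [set W | open W /\ normal_on W G]
    id).
  move=> /(_ _ _)/wrap[W [] //||[D subD KD]].
    by move=> z /KF[W hW Wz]; exists W.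
  have [phi hphi H] : exists2 phi, increasing_nat phi & forall W, W \in
    (finmap.enum_fset D) ->
      (forall z, W z -> fin_at (u \o phi) z) \/ (forall z, W z ->
        inf_at (u \o phi) z).
    have : forall W, W \in (finmap.enum_fset D) -> open W /\ normal_on W G.
      by move=> W /subD; rewrite inE.
    elim: (finmap.enum_fset D) => [_|W s IH hs]; first by exists id.
    have [|phi hphi H] := IH; first by move=> V Vs; apply: hs;
      rewrite in_cons Vs orbT.
    have [|oW nW] := hs W; first by rewrite in_cons eqxx.
    have [|psi hpsi HW] := @normal_dichotomy W G (u \o phi) oW nW; first
      by move=> k /=.
    exists (phi \o psi); first exact: increasing_nat_comp.
    move=> V; rewrite in_cons => /orP[/eqP -> //|/H[h|h]]; [left|right] => z Vz.
      by apply: (fin_at_sub (u \o phi)) => //; exact: h.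
    by apply: (inf_at_sub (u \o phi)) => //; exact: h.
  exists phi => // z /KD[W /= WD Wz]; have [h|h] := H W WD; [left|right];
    exact: h.
exists phi => //; pose v := u \o phi.
have openfin : open [set z | fin_at v z].
  apply/open_cabs => z [del del0 [H1 [M [N HM]]]]; exists (del / 2); first
    by rewrite divr_gt0.
  move=> w wz; exists (del / 2); first by rewrite divr_gt0.
  have tri (y : C) : cabs (y - w) < del / 2 -> cabs (y - z) < del.
    by move=> yw; have := cabs_triangle _ y z w; clear - yw wz; lra.
  split; last by exists M, N => k y Nk /tri; exact: HM.
  by move=> e /H1[N' hN']; exists N' => k l y Nk Nl /tri; exact: hN'.
have openinf : open [set z | inf_at v z].
  apply/open_cabs => z [del del0 H]; exists (del / 2); first
    by rewrite divr_gt0.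
  move=> w wz; exists (del / 2); first by rewrite divr_gt0.
  have tri (y : C) : cabs (y - w) < del / 2 -> cabs (y - z) < del.
    by move=> yw; have := cabs_triangle _ y z w; clear - yw wz; lra.
  by move=> M; have [N hN] := H M; exists N => k y Nk /tri; exact: hN.
have allsame : (forall z, K z -> fin_at v z) \/ (forall z, K z -> inf_at v z).
  have [[z0 [Kz0 fz0]]|nofin] := pselect (exists z, K z /\ fin_at v z).
    left; suff KE : K `&` [set z | fin_at v z] = K by move=> z;
      rewrite -{1}KE => -[].
    apply: conK; first by exists z0.
      by exists [set z | fin_at v z].
    exists (~` [set z | inf_at v z]); first exact: open_closedC.
    apply/seteqP; split=> z [Kz hz]; split=> //.
      by move=> /=; exact: fin_inf_at hz.
    by have [] := dich z Kz.
  right=> z Kz; have [fz|//] := dich z Kz; exfalso; apply: nofin; by exists z.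
case: allsame => H; [left|right].
  split.
    move=> e e0; pose P N (w : C) := forall k l, (N <= k)%N -> (N <= l)%N ->
      cabs (v k w - v l w) <= e.
    have [|N hN] := @compact_uniformly_nat K P cK.
      move=> z /H[del del0 [H1 _]]; exists del => //; have [N hN] := H1 e e0;
        exists N.
      by move=> w n wz Nn k l nk nl; apply: hN => //; exact: leq_trans Nn _.
    by exists N => k l z Nk Nl Kz; apply: (hN z N Kz).
  pose P N (w : C) := forall k, (N <= k)%N -> cabs (v k w) <= N%:R.
  have [|N hN] := @compact_uniformly_nat K P cK.
    move=> z /H[del del0 [_ [M [N HM]]]]; exists del => //.
    exists (maxn N (Num.truncn M).+1) => w n wz;
      rewrite geq_max => /andP[Nn Mn] k nk.
    apply: le_trans (HM _ _ _ wz) _; first exact: leq_trans nk.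
    by apply: le_trans (ltW (truncnS_gt M)) _; rewrite ler_nat.
  by exists N%:R, N => k z Nk Kz; apply: (hN z N Kz).
move=> M; pose P N (w : C) := forall k, (N <= k)%N -> M < cabs (v k w).
have [|N hN] := @compact_uniformly_nat K P cK.
  move=> z /H[del del0 H1]; exists del => //; have [N hN] := H1 M; exists N.
  by move=> w n wz Nn k nk; apply: hN => //; exact: leq_trans nk.
by exists N => k z Nk Kz; apply: (hN z N Kz).
Qed.

End NormalFamilies.

(** * Bounded open sets with boundary in a compact connected subset of the Fatou set *)

Section FillingHoles.
Variable R : realType.
Implicit Types (z w : R[i]) (x y r : R).
Local Notation cabs := (cabs R).
Local Notation hol := (hol R).
Local Notation C := (R[i]^o).

(** If [w] were omitted on [W], the minimum principle would keep [u a] at distance at least [m / 2]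
    from it, because on the boundary the distance from [u] to [w] is at least [m - m / 2]. *)
Lemma disc_in_image (W : set C) (u : C -> C) (m B : R) a w :
  open W -> (forall z, W z -> cabs z <= B) -> (forall z, hol u z) ->
  (forall z, closure W z -> ~ W z -> m <= cabs (u z - u a)) ->
  W a -> cabs (w - u a) < m / 2 -> exists2 z, W z & u z = w.
Proof.
move=> oW bW hu bd Wa hw; apply: contrapT => nex.
have m20 : 0 < m / 2 by apply: le_lt_trans hw; exact: cabs_ge0.
have := @minimum_principle R W u w (m / 2) B oW bW m20 hu _ _ a Wa.
rewrite cabsBC leNgt hw /= => H; suff : false by []; apply: H.
  by move=> z Wz; apply/eqP => uz; apply: nex; exists z.
move=> z cz nWz; have := bd z cz nWz; have := cabs_triangle _ (u z) (u a) w.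
clear - hw; lra.
Qed.

(** If [S] missed the image of the boundary of [W], its part in the image of [W] would be open in
    [S] by [disc_in_image], and closed as its part in the compact image of the closure. It would be
    all of [S], which is unbounded. *)
Lemma connected_crosses_image_boundary (W : set C) (u : C ->
  C) (B : R) (S : set C) a :
  open W -> (forall z, W z -> cabs z <= B) -> (forall z, hol u z) ->
  connected S -> W a -> S (u a) -> (forall M : R, exists2 s, S s & M < cabs s)
    ->
  exists2 p, closure W p /\ ~ W p & S (u p).
Proof.
move=> oW bW hu conS Wa Sa unS; apply: contrapT => nocross.
have cW := closure_compact_bounded R W B bW.
have cu : continuous u by move=> z; apply: hol_continuous.
have sub := @subset_closure _ W.
have SE : S `&` (u @` W) = S.
  apply: conS; first by exists (u a); split => //; exists a.
  - exists (u @` W)°; first exact: open_interior.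
    apply/seteqP; split=> w [Sw hw]; split => //; last exact: interior_subset.
    case: hw => b Wb ub; rewrite -ub in Sw *.
    have cbd : compact (closure W `\` W : set C).
      apply: (subclosed_compact _ cW); last by move=> z [].
      by apply: closedI; [exact: closed_closure|exact: open_closedC].
    have [m m0 hm] : exists2 m : R, 0 < m & forall z, closure W z -> ~ W z ->
      m <= cabs (u z - u b).
      (* With empty boundary any positive [m] will do; otherwise the minimum over it is positive,
         because [S] contains [u b] and misses the image of the boundary. *)
      have [[p bdp]|nbd] := pselect (exists p, (closure W `\` W) p); last first.
        by exists 1 => // z cz nWz; exfalso; apply: nbd; exists z.
      have [||c cbdc hc] := @compact_EVT_min _ R (fun z : C => cabs (u z - u b))
        _ _ cbd.
      - by exists p.
      - apply: continuous_in_subspaceT => z _;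
        apply: (cabs_comp_continuous_at R (fun z => u z - u b)).
        by apply: hol_continuous; apply: holB; [exact: hu|exact: hol_cst].
      rewrite inE in cbdc; case: cbdc => cc nc.
      exists (cabs (u c - u b)).
        rewrite cabs_gt0 subr_eq0; apply/eqP => ucb; apply: nocross;
          exists c => //.
        by rewrite ucb.
      by move=> z cz nz; apply: hc; rewrite inE.
    apply/nbhs_cabs; exists (m / 2); first by rewrite divr_gt0.
    by move=> w' /(disc_in_image W u m B b w' oW bW hu hm Wb)[z Wz <-];
      exists z.
  - exists (u @` closure W).
      apply: compact_closed; first exact: norm_hausdorff.
      by apply: continuous_compact => //; exact: continuous_subspaceT.
    apply/seteqP; split=> w [Sw [z hz uz]]; split => //; first
      by exists z => //; exact: sub.
    have [Wz|nWz] := pselect (W z); first by exists z.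
    by exfalso; apply: nocross; exists z => //; rewrite uz.
have [||c _ hc] := @compact_EVT_max _ R (fun z : C => cabs (u z)) (closure W) _
  cW.
- by exists a; exact: sub.
- by apply: continuous_in_subspaceT => z _;
  apply: (cabs_comp_continuous_at R u); exact: cu.
have [s Ss] := unS (cabs (u c)); move: Ss; rewrite -{1}SE => -[_ [z Wz <-]].
by rewrite ltNge hc// inE; exact: sub.
Qed.

Theorem holes_in_fatou_set (K W : set C) (G : set (C -> C)) (g : C ->
  C) (gamma : R -> C) (B Bd : R) :
  compact K -> connected K -> K `<=` fatou_set G ->
  open W -> (forall z, W z -> cabs z <= B) ->
  (forall z, closure W z -> ~ W z -> K z) ->
  (forall f, G f -> forall z, hol f z) -> (forall f, G f -> G (g \o f)) ->
  (forall z, hol g z) -> ~ (forall z, g z = g 0) ->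
  {within `[0, +oo[, continuous gamma} ->
  (forall M : R, \forall t \near +oo, M < cabs (gamma t)) ->
  (forall t, 0 <= t -> cabs (g (gamma t)) <= Bd) ->
  W `<=` fatou_set G.
Proof.
move=> cK conK KF oW bW bdK hG Gg hg gnc cgam gaminf gBd.
suff nW : normal_on W G by move=> z Wz; exists W.
move=> u Gu; have [phi hphi dich] := normal_on_compact _ K G u cK conK KF Gu.
pose v := u \o phi.
have hv k z : hol (v k) z by apply: hG; exact: Gu.
have maxW (f : C -> C) m : (forall z, hol f z) -> 0 <= m -> (forall z, K z ->
  cabs (f z) <= m) ->
    forall z, W z -> cabs (f z) <= m.
  move=> hf m0 fK; apply: (maximum_principle R W f m B oW bW m0 (fun z _ => hf
    z)).
    by move=> z _; exact: (hol_continuous _ _ _ (hf z)).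
  by move=> z cz nz; exact: (fK _ (bdK _ cz nz)).
case: dich => [[cau _]|inf].
  exists phi; split => //; left.
  have cauW e : 0 < e -> exists N, forall k l, (N <= k)%N -> (N <= l)%N ->
      forall z, W z -> cabs (v k z - v l z) <= e.
    move=> e0; have [N hN] := cau e e0; exists N => k l Nk Nl.
    apply: (maxW (fun z => v k z - v l z)); [by move=> z;
      exact: holB|exact: ltW|].
    by move=> z; exact: hN.
  have lim z : exists L, W z -> forall e, 0 < e ->
    exists N, forall k, (N <= k)%N -> cabs (v k z - L) <= e.
    have [Wz|nWz] := pselect (W z); last by exists 0.
    have [|L hL] := @complex_cauchy_limit R (fun k => v k z); last by exists L.
    by move=> e /cauW[N hN]; exists N => k l Nk Nl; exact: hN.
  have [h hh] := choice lim.
  have uni e : 0 < e -> exists N, forall k z, (N <= k)%N -> W z ->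
    cabs (v k z - h z) <= e.
    move=> e0; have [N hN] := cauW e e0; exists N => k z Nk Wz.
    apply/ler_addgt0Pl => d d0; have [N' hN'] := hh z Wz d d0.
    apply: le_trans (cabs_triangle _ _ _ (v (maxn N N') z)) _; rewrite addrC;
      apply: lerD.
      by apply: hN'; exact: leq_maxr.
    by apply: hN => //; exact: leq_maxl.
  exists h.
    move=> z Wz; apply/derivable_hol; apply: (@uniform_limit_hol R W v h oW _
      uni z Wz).
    by move=> k y _.
  move=> z Wz; exists W; first exact: open_nbhs_nbhs.
  apply/uniform_cvg_cabs => e e0; have e20 : 0 < e / 2 by rewrite divr_gt0.
  have [N hN] := uni _ e20; exists N => k w Nk Ww;
    apply: le_lt_trans (hN k w Nk Ww) _.
  by rewrite ltr_pdivrMr// ltr_pMr// ltr1n.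
have [freq|] := pselect (forall N, exists2 k, (N <= k)%N & forall z, W z ->
  v k z != 0).
  have /choice[s hs] : forall N, exists k, (N <= k)%N /\ forall z, W z ->
    v k z != 0.
    by move=> N; have [k Nk hk] := freq N; exists k.
  pose sig n := iter n (fun k => s k.+1) (s 0%N).
  have hsig : increasing_nat sig.
    apply: homo_ltn => [a b c|k]; first exact: ltn_trans.
    by rewrite /sig iterS; have [] := hs (sig k).+1.
  have zsig k z : W z -> v (sig k) z != 0.
    by case: k => [|k]; rewrite /sig ?iterS; apply: (hs _).2.
  exists (phi \o sig); split; first exact: increasing_nat_comp.
  right=> z Wz; exists W; first exact: open_nbhs_nbhs.
  move=> M; pose M1 := Num.max M 0 + 1.
  have M10 : 0 < M1 by rewrite ltr_wpDl// le_max lexx orbT.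
  have MM1 : M < M1.
    by apply: le_lt_trans (_ : Num.max M 0 < _);
      [rewrite le_max lexx|rewrite ltrDl].
  have [N hN] := inf M1; exists N => // k /= Nk w Ww; rewrite normE ltcR.
  apply: lt_le_trans MM1 _.
  have := @minimum_principle R W (v (sig k)) 0 M1 B oW bW M10 (hv _) (zsig k) _
    w Ww.
  rewrite subr0; apply => y cy nWy; rewrite subr0.
  apply: ltW; apply: hN; last exact: bdK.
  by apply: leq_trans Nk _; exact: increasing_nat_ge.
move=> /existsNP[N0 hN0].
have zer k : (N0 <= k)%N -> exists2 a, W a & v k a = 0.
  move=> Nk; apply: contrapT => nz; apply: hN0; exists k => // z Wz.
  by apply/eqP => vz; apply: nz; exists z.
have surj k m : (N0 <= k)%N -> (forall z, K z -> m <= cabs (v k z)) ->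
    forall w, cabs w < m / 2 -> exists2 z, W z & v k z = w.
  move=> /zer[a Wa va] hm w hw.
  apply: (@disc_in_image W (v k) m B a w) => //; rewrite va ?subr0//.
  by move=> z cz nz; rewrite subr0; apply/hm/bdK.
(* The shift by [N0] gives every [v] used here a zero in [W], so that [surj] applies to it. *)
have [psi hpsi dich] := normal_on_compact _ K G (fun k => g \o v (k + N0)%N) cK
  conK KF
   (fun k => Gg _ (Gu _)).
have large M : exists N, forall k, (N <= k)%N -> forall z, K z ->
  M < cabs (v (psi k + N0)%N z).
  have [N hN] := inf M; exists N => k Nk z; apply: hN; apply: leq_trans Nk _.
  by apply: leq_trans (leq_addr _ _); exact: increasing_nat_ge.
case: dich => [[_ [M1 [N1 hN1]]]|inf2].
  exfalso; apply: gnc; pose M2 := Num.max M1 0.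
  have M20 : 0 <= M2 by rewrite le_max lexx orbT.
  apply: (@liouville R g M2 hg) => w.
  (* As [surj] halves the radius, this bound on [K] puts [w] in the image of [W]; the bound for the
     composition on [K], carried over to [W], then bounds [g w]. *)
  have [N hN] := large (2 * (cabs w + 1)).
  pose k := maxn N N1.
  have [||z Wz <-] := surj (psi k + N0)%N (2 * (cabs w + 1)) (leq_addl _ _) _ w.
  - by move=> z Kz; apply/ltW/hN => //; exact: leq_maxl.
  - by rewrite mulrC mulKf// ltrDl.
  apply: (maxW (g \o v (psi k + N0)%N)) => //.
    by move=> y; apply: hol_comp; [exact: hv|exact: hg].
  move=> y Ky; rewrite le_max; apply/orP; left; apply: hN1 => //;
    exact: leq_maxr.
exfalso.
(* The start of the curve becomes a value taken in [W]. On its way to infinity the curve meets the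
   image of the boundary, where [g] would have to exceed its bound [Bd] on the curve. *)
have [N1 hN1] := large (2 * (cabs (gamma 0) + 1)); have [N2 hN2] := inf2 Bd.
pose k := maxn N1 N2.
have [||a Wa va] := surj (psi k + N0)%N (2 * (cabs (gamma 0) + 1)) (leq_addl _
  _) _ (gamma 0).
- by move=> z Kz; apply/ltW/hN1 => //; exact: leq_maxl.
- by rewrite mulrC mulKf// ltrDl.
pose S := gamma @` `[0, +oo[.
have conS : connected S.
  apply: connected_continuous_connected => //.
  by apply/connected_intervalP; exact: interval_is_interval.
have [|M|p [cp np] [t /=]] := @connected_crosses_image_boundary W (v (psi k +
  N0)%N) B S a oW bW (hv _) conS Wa.
- by rewrite va; exists 0 => //=; rewrite in_itv /= lexx.
- have [t [Mt t0]] : exists t, M < cabs (gamma t) /\ 0 <= t.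
    have : \forall t \near +oo, M < cabs (gamma t) /\ 0 <= t.
      by apply: filterI; [exact: gaminf|exact: nbhs_pinfty_ge].
    by move=> /filter_ex.
  by exists (gamma t) => //; exists t => //=; rewrite in_itv /= t0.
rewrite in_itv /= andbT => t0 vp.
have := hN2 k p (leq_maxr _ _) (bdK _ cp np).
by rewrite /= -vp ltNge gBd.
Qed.

End FillingHoles.

(** * Homotopies of closed curves *)

Section GridHomotopy.
Variable R : realType.
Implicit Types (x y t r : R).
Local Notation cabs := (cabs R).
Local Notation C := (R[i]^o).

Definition hat x : R := Num.max 0 (1 - `|x|).

Lemma hat_ge0 x : 0 <= hat x.
Proof. by rewrite /hat le_max lexx. Qed.

Lemma hat_gt0 x : 0 < hat x -> `|x| < 1.
Proof. by rewrite /hat lt_max ltxx /= subr_gt0. Qed.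

Lemma hat_eq0 x : 1 <= `|x| -> hat x = 0.
Proof. by move=> h; rewrite /hat max_l// subr_le0. Qed.

Lemma hat_small x : `|x| <= 1 -> hat x = 1 - `|x|.
Proof. by move=> h; rewrite /hat max_r// subr_ge0. Qed.

Lemma hat0 : hat 0 = 1.
Proof. by rewrite hat_small normr0 ?subr0. Qed.

Lemma hat_nat (n k : nat) : hat (n%:R - k%:R) = (n == k)%:R.
Proof.
have [->|nk] := eqVneq n k; first by rewrite subrr hat0.
rewrite hat_eq0//; case: (ltngtP n k) nk => // nk _.
  have h : (n%:R : R) + 1 <= k%:R by rewrite natr1 ler_nat.
  by rewrite ler0_norm; lra.
have h : (k%:R : R) + 1 <= n%:R by rewrite natr1 ler_nat.
by rewrite ger0_norm; lra.
Qed.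

Lemma hat_lip x y : `|hat x - hat y| <= `|x - y|.
Proof.
have h1 := ler_dist_dist x y; have h2 := ler_norm (`|x| - `|y|).
have h3 := ler_norm (`|y| - `|x|); rewrite distrC in h3.
have h4 := le_trans h2 h1; have h5 := le_trans h3 h1.
rewrite /hat ler_norml.
by case: (leP 0 (1 - `|x|)) => ?; case: (leP 0 (1 - `|y|)) => ?; clear h1 h2 h3;
  lra.
Qed.

Lemma sum_hat (n : nat) x : 0 <= x <= n%:R ->
  \sum_(k < n.+1) hat (x - k%:R) = 1.
Proof.
elim: n => [|n IH] /andP[x0 xn].
  have -> : x = 0 by apply/eqP; rewrite eq_le x0 xn.
  by rewrite big_ord1 subrr hat0.
have [xn'|nx] := leP x n%:R.
  rewrite big_ord_recr /= IH ?x0// hat_eq0 ?addr0// distrC -natr1.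
  by rewrite ger0_norm; lra.
rewrite big_ord_recr big_ord_recr /= big1 ?add0r => [|k _].
  rewrite -natr1 in xn *; rewrite !hat_small.
  - by rewrite (ger0_norm (_ : 0 <= x - n%:R)) ?(ler0_norm (_ : x - (n%:R + 1)
    <= 0)); lra.
  - by rewrite ler0_norm; lra.
  - by rewrite ger0_norm; lra.
have kn : (k%:R : R) + 1 <= n%:R by rewrite natr1 ler_nat.
by rewrite hat_eq0// ger0_norm; lra.
Qed.

Lemma cabs_sum (I : Type) (s : seq I) (f : I -> R[i]) :
  cabs (\sum_(i <- s) f i) <= \sum_(i <- s) cabs (f i).
Proof.
elim: s => [|i s IH]; first by rewrite !big_nil cabs0.
by rewrite !big_cons; apply: le_trans (cabsD _ _ _) _; rewrite lerD2l.
Qed.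

Lemma convex_close n (w : 'I_n -> R) (Z : 'I_n -> R[i]) (c : R[i]) r :
  (forall k, 0 <= w k) -> \sum_k w k = 1 ->
  (forall k, 0 < w k -> cabs (Z k - c) <= r) ->
  cabs (\sum_k (w k)%:C * Z k - c) <= r.
Proof.
move=> w0 w1 wZ.
have -> : c = \sum_k (w k)%:C * c by rewrite -mulr_suml -rmorph_sum w1 mul1r.
rewrite -sumrB; apply: le_trans (cabs_sum _ _ _) _.
rewrite -[leRHS]mul1r -w1 mulr_suml; apply: ler_sum => k _.
rewrite -mulrBr cabsM cabsC ger0_norm//.
have := w0 k; rewrite le_eqVlt => /orP[/eqP <-|wk]; first by rewrite !mul0r.
by rewrite ler_wpM2l// wZ.
Qed.

Lemma sum_hat_nat (n m : nat) (Z : nat -> R[i]) : (m <= n)%N ->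
  \sum_(k < n.+1) (hat (m%:R - k%:R))%:C * Z k = Z m.
Proof.
move=> mn; rewrite (bigD1 (Ordinal (mn : (m < n.+1)%N))) //= subrr hat0 mul1r.
rewrite big1 ?addr0// => k km; rewrite hat_nat; case: eqP => [mk|]; last
  by rewrite mul0r.
by move: km; rewrite -val_eqE /= mk eqxx.
Qed.

Lemma hatC_continuous : continuous ((fun x => (hat x)%:C) : R -> C).
Proof.
move=> x A /nbhs_cabs[e e0 hA]; apply/nbhs_ballP; exists e => //= y xy;
  apply: hA.
have -> : (hat y)%:C - (hat x)%:C = (hat y - hat x)%:C :> R[i]
  by rewrite rmorphB.
rewrite cabsC; apply: le_lt_trans (hat_lip _ _) _.
by rewrite distrC.
Qed.

Lemma continuous_sum (T : topologicalType) (I : Type) (s : seq I) (f : I -> T ->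
  C) :
  (forall i, continuous (f i)) -> continuous (fun z => \sum_(i <- s) f i z).
Proof.
move=> cf; elim: s => [|i s IH] z.
  rewrite (_ : (fun z => _) = (fun=> 0)); first exact: cvg_cst.
  by apply/funext => u; rewrite big_nil.
rewrite (_ : (fun z => _) = (fun z => f i z + \sum_(i <- s) f i z)).
  exact: (cvgD (cf i z) (IH z)).
by apply/funext => u; rewrite big_cons.
Qed.

Lemma hat_affine_continuous (T : topologicalType) (f : T -> R) (a b : R) :
  continuous f -> continuous ((fun z => (hat (a * f z - b))%:C) : T -> C).
Proof.
move=> cf z.
have c1 : {for z, continuous (fun z => a * f z - b)}.
  exact: (cvgB (cvgM (cvg_cst a) (cf z)) (cvg_cst b)).
exact: (continuous_comp c1 (hatC_continuous _)).
Qed.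

Lemma clamp_curve_continuous (gamma : R ->
  C) : {within `[0, 1], continuous gamma} ->
  continuous (gamma \o clamp R 0 1).
Proof.
move=> /cabs_within_continuous H t A /nbhs_cabs[e e0 hA].
have [del del0 hd] := H (clamp R 0 1 t) (clamp_bounds R 0 1 t ler01) e e0.
apply/nbhs_ballP; exists del => //= t' tt'; apply/hA/hd;
  first exact: clamp_bounds.
by apply: le_lt_trans (clamp_lip _ _ _ _ _ _) _ => //; rewrite distrC.
Qed.

(** Row 0 of the interpolation is the curve, row [i.+1] the closed polygon through the points
    [P i j]; hence [M.+2] rows. At each point only neighbouring indices have positive weight, so
    every value is a convex combination of points within [r] of a single [P i j]. *)
Lemma grid_null_homotopy (F : set C) (gamma : R -> C) (M N : nat) (P : nat ->
  nat -> C) (c : C) r :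
  {within `[0, 1], continuous gamma} -> gamma 0 = gamma 1 ->
  (forall i j w, (i <= M)%N -> (j <= N)%N -> cabs (w - P i j) <= r -> F w) ->
  (forall i i' j j', (i <= M)%N -> (i' <= M)%N -> (j <= N)%N -> (j' <= N)%N ->
     (i <= i'.+1)%N -> (i' <= i.+1)%N -> (j <= j'.+1)%N -> (j' <= j.+1)%N ->
     cabs (P i j - P i' j') <= r) ->
  (forall j t, (j <= N)%N -> 0 <= t <= 1 -> `|N%:R * t - j%:R| < 1 ->
     cabs (gamma t - P 0%N j) <= r) ->
  (forall i, (i <= M)%N -> P i 0%N = P i N) -> (forall j, (j <= N)%N ->
    P M j = c) ->
  null_homotopic_in F gamma.
Proof.
move=> cgam gam01 FP PP gP P0N PMc.
pose PL i t : C := \sum_(j < N.+1) (hat (N%:R * t - j%:R))%:C * P i j.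
pose Z k t : C := if k is i.+1 then PL i t else gamma (clamp R 0 1 t).
pose H (st : R * R) : C := \sum_(k < M.+2) (hat (M.+1%:R * st.1 - k%:R))%:C * Z
  k st.2.
have close (a : R) (k k' : nat) : 0 < hat (a - k%:R) -> 0 < hat (a - k'%:R) ->
  (k <= k'.+1)%N.
  move=> /hat_gt0 + /hat_gt0; rewrite !ltr_norml => h h'.
  rewrite -ltnS -(ltr_nat R) -!natr1; lra.
have pos n (a : R) : 0 <= a <= n%:R -> exists2 k : 'I_n.+1, true & 0 < hat (a -
  k%:R).
  move=> /sum_hat s1; apply: contrapT => np.
  have : (1 : R) = 0.
    rewrite -s1 big1// => k _; apply/eqP; rewrite eq_le hat_ge0 andbT leNgt.
    by apply/negP => hk; apply: np; exists k.
  by move/eqP; rewrite oner_eq0.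
exists H, c; split.
- apply: continuous_subspaceT => st.
  have cZ k : continuous (Z k).
    case: k => [|i]; first exact: clamp_curve_continuous.
    apply: continuous_sum => j t.
    exact: (cvgM (hat_affine_continuous _ id _ _ (fun x => cvg_id) t) (cvg_cst
      _)).
  apply: (continuous_sum (R * R)%type) => k {}st.
  apply: (@cvgM _ _ _ _ (fun st : R * R => (hat (M.+1%:R * st.1 - k%:R))%:C : C)
    (fun st : R * R => Z k st.2)).
    by apply: (hat_affine_continuous _ fst) => x; exact: cvg_fst.
  have c2 : {for st, continuous (@snd R R)} by exact: cvg_snd.
  exact: (continuous_comp c2 (cZ k _)).
- move=> _ [[s t] /= [s01 t01] <-]; move: s01 t01;
  rewrite !in_itv /= => s01 t01.
  have a1 : 0 <= M.+1%:R * s <= M.+1%:R.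
    by move: s01 => /andP[s0 s1]; rewrite mulr_ge0//= ler_piMr.
  have x1 : 0 <= N%:R * t <= N%:R.
    by move: t01 => /andP[t0 t1]; rewrite mulr_ge0//= ler_piMr.
  have [k0 _ hk0] := pos _ _ a1; have [j0 _ hj0] := pos _ _ x1.
  have k0M : (k0.-1 <= M)%N by have := ltn_ord k0; case: (nat_of_ord k0).
  have j0N : (j0 <= N)%N by rewrite -ltnS.
  (* Row [k] carries the index [k - 1] of [P]; truncation at 0 is right because the curve, in row 0,
     is compared with [P 0] just like row 1. *)
  apply: (FP k0.-1 j0) => //; apply: convex_close => [k||k hk].
  + exact: hat_ge0.
  + exact: sum_hat.
  have kk0 := close _ _ _ hk hk0; have k0k := close _ _ _ hk0 hk.
  have := ltn_ord k; case: (nat_of_ord k) kk0 k0k => [|i] kk0 k0k kM.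
    have -> : k0.-1 = 0%N by case: (nat_of_ord k0) k0k => [|[]].
    rewrite /Z clamp_id//; apply: gP => //; exact: hat_gt0.
  apply: convex_close => [j||j hj].
  + exact: hat_ge0.
  + exact: sum_hat.
  have jj0 := close _ _ _ hj hj0; have j0j := close _ _ _ hj0 hj.
  apply: PP => //.
  + by rewrite -ltnS.
  + by clear - kk0; lia.
  + by clear - k0k; lia.
- move=> t t01; rewrite /H /= mulr0.
  by have := sum_hat_nat M.+1 0 (Z ^~ t) (leq0n _) => /= ->; rewrite clamp_id.
- move=> t t01; rewrite /H /= mulr1.
  have := sum_hat_nat M.+1 M.+1 (Z ^~ t) (leqnn _) => /= ->.
  have x1 : 0 <= N%:R * t <= N%:R.
    by move: t01 => /andP[t0 t1]; rewrite mulr_ge0//= ler_piMr.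
  rewrite /PL (eq_bigr (fun j : 'I_N.+1 => (hat (N%:R * t - j%:R))%:C * c));
    last first.
    by move=> j _; rewrite PMc// -ltnS.
  by rewrite -mulr_suml -rmorph_sum sum_hat// mul1r.
- move=> s s01; rewrite /H /=; apply: eq_bigr => k _; congr (_ * _).
  have := ltn_ord k; case: (nat_of_ord k) => [|i] iM /=.
    by rewrite !clamp_id ?lexx ?ler01.
  rewrite /PL mulr0 mulr1.
  have := sum_hat_nat N 0 (P i) (leq0n _) => /= ->.
  have := sum_hat_nat N N (P i) (leqnn _) => /= ->.
  by apply: P0N; rewrite -ltnS.
Qed.

End GridHomotopy.

(** * Tubes around a curve and their lattice approximation *)

Section Curves.
Variable R : realType.
Implicit Types (t r e : R).
Local Notation cabs := (cabs R).
Local Notation C := (R[i]^o).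

Lemma curve_uniformly_continuous (gamma : R ->
  C) : {within `[0, 1], continuous gamma} ->
  forall e, 0 < e -> exists2 d, 0 < d & forall t t', 0 <= t <= 1 ->
    0 <= t' <= 1 ->
    `|t - t'| < d -> cabs (gamma t - gamma t') < e.
Proof.
move=> /clamp_curve_continuous cg e e0; have e20 : 0 < e / 2
  by rewrite divr_gt0.
set g := gamma \o clamp R 0 1 in cg.
have gE t : 0 <= t <= 1 -> g t = gamma t by move=> ht; rewrite /g /= clamp_id.
have := @segment_compact R 0 1 => /compact_near_coveringP cK.
have : \forall d \near (0 : R)^'+, `[0, 1] `<=` [set t | forall t', `|t - t'| <
  d -> cabs (g t - g t') < e].
  apply: cK => t _.
  have : nbhs t (g @^-1` [set w : C | cabs (w - g t) < e / 2]).
    by apply: cg; apply/nbhs_cabs; exists (e / 2).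
  move=> /nbhs_ballP[d /= d0 hd].
  exists (ball t (d / 2), [set d' | 0 < d' < d / 2]) => /=; last first.
    move=> [u d'] [/= tu /andP[d'0 d'd] u' uu'].
    have h1 : cabs (g u - g t) < e / 2 by apply: hd; apply: le_ball tu; lra.
    have h2 : cabs (g u' - g t) < e / 2.
      apply: hd; rewrite /ball /= in tu *;
        apply: le_lt_trans (ler_distD u _ _) _.
      by clear - tu uu' d'd; lra.
    apply: le_lt_trans (cabs_triangle _ _ _ (g t)) _; rewrite (cabsBC _ (g t)).
    by clear - h1 h2; lra.
  split => /=; first by apply: nbhsx_ballx; rewrite divr_gt0.
  change (\forall d' \near (0 : R)^'+, 0 < d' < d / 2).
  by near=> d'; apply/andP; split => //; near: d'; apply: nbhs_right_lt;
    rewrite divr_gt0.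
rewrite near_withinE => /nbhs_ballP[d /= d0 hd]; exists (d / 2); first
  by rewrite divr_gt0.
move=> t t' ht ht' tt'; rewrite -gE// -(gE t')//.
apply: (hd (d / 2)) tt'; last by rewrite /= in_itv.
  by rewrite /ball /= sub0r normrN gtr0_norm ?divr_gt0//; lra.
by rewrite divr_gt0.
Unshelve. all: by end_near. Qed.

Lemma curve_image_compact (gamma : R -> C) : {within `[0, 1], continuous gamma}
  ->
  compact (gamma @` `[0, 1]).
Proof. by move=> cg; apply: continuous_compact => //;
  exact: segment_compact. Qed.

Lemma curve_margin (F : set C) (gamma : R -> C) : open F ->
  {within `[0, 1], continuous gamma} -> gamma @` `[0, 1] `<=` F ->
  exists2 r, 0 < r & forall t (w : C), 0 <= t <= 1 -> cabs (w - gamma t) < r ->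
    F w.
Proof.
move=> /open_cabs oF cg gF.
have [|d d0 hd] := @compact_uniformly R _ (fun e w => forall v, cabs (v - w) < e
  -> F v)
    (curve_image_compact gamma cg).
  move=> z /gF /oF[e e0 he]; exists (e / 2); first by rewrite divr_gt0.
  move=> w d hw /andP[d0 hd] v hv; apply: he.
  by have := cabs_triangle _ v z w; clear - hw hv hd; lra.
exists (d / 2); first by rewrite divr_gt0.
move=> t w ht hw; apply: (hd (gamma t) (d / 2)) hw; first by exists t;
  rewrite //= in_itv.
by clear - d0; lra.
Qed.

Definition tube (gamma : R -> C) (r : R) : set C :=
  [set w | exists2 t, 0 <= t <= 1 & cabs (w - gamma t) <= r].

Lemma tube_compact (gamma : R -> C) r : {within `[0, 1], continuous gamma} ->
  compact (tube gamma r).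
Proof.
move=> cg; have cK := curve_image_compact gamma cg.
have K0 : (gamma @` `[0, 1]) !=set0.
  by exists (gamma 0), 0; rewrite //= in_itv /= lexx ler01.
have inK t : 0 <= t <= 1 -> (gamma @` `[0, 1]) (gamma t).
  by move=> ht; exists t; rewrite //= in_itv.
have cont (a : C) : continuous (fun w : C => cabs (a - w)).
  move=> z; apply/real_continuous_at => e e0; exists e => // w hw.
  apply: le_lt_trans (cabs_lipschitz _ _ _) _.
  have E : a - w - (a - z) = z - w by ring.
  by rewrite E cabsBC.
have [c _ hc] := @compact_EVT_max _ R (fun w : C => cabs (0 - w)) _ K0 cK
  (continuous_subspaceT (cont 0)).
apply: (@bounded_closed_cabs_compact _ _ (cabs (0 - c) + r)).
  move=> w /closure_cabs H.
  have [c' c'K hc'] := @compact_EVT_min _ R (fun v : C => cabs (w - v)) _ K0 cK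
    (continuous_subspaceT (cont w)).
  move: c'K; rewrite inE => -[t /=]; rewrite in_itv /= => ht gt.
  exists t => //; rewrite gt leNgt; apply/negP => h.
  have [|w' [t' ht' hw'] ww'] := H (cabs (w - c') - r); first
    by rewrite subr_gt0.
  have := hc' (gamma t'); rewrite inE => /(_ (inK _ ht')).
  have := cabs_triangle _ w (gamma t') w'; rewrite (cabsBC _ w w').
  by clear - ww' hw'; lra.
move=> w [t ht hw]; have := hc (gamma t); rewrite inE => /(_ (inK _ ht)).
have -> : w = gamma t + (w - gamma t) by ring.
rewrite !sub0r !cabsN => h; apply: le_trans (cabsD _ _ _) _; exact: lerD.
Qed.

(** The tube is a union of copies of the curve, each with one straight segment attached, all
    containing [gamma 0]. *)
Lemma tube_connected (gamma : R -> C) r : 0 <= r ->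
  {within `[0, 1], continuous gamma} ->
  connected (tube gamma r).
Proof.
move=> r0 cg; pose I := (R * C)%type.
pose seg (i : I) : set C := (fun s : R => gamma i.1 + s%:C * (i.2 - gamma i.1))
  @` `[0, 1].
have -> : tube gamma r = \bigcup_(i in [set i : I | 0 <= i.1 <= 1 /\ cabs (i.2 -
  gamma i.1) <= r])
    ((gamma @` `[0, 1]) `|` seg i).
  apply/seteqP; split=> [w [t ht hw]|w [[t v] /= [ht hv] [[t' /=]|[s /=]]]].
  - exists (t, w) => //; right; exists 1; first
    by rewrite /= in_itv /= ler01 lexx.
    by rewrite /= mul1r; ring.
  - rewrite in_itv /= => ht' <-; exists t' => //; by rewrite subrr cabs0.
  - rewrite in_itv /= => /andP[s0 s1] <-; exists t => //.
    rewrite addrC addKr cabsM cabsC ger0_norm//; apply: le_trans hv.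
    by rewrite ler_piMl// cabs_ge0.
have cI : connected (`[0, 1]%classic : set R) by apply/connected_intervalP;
  exact: interval_is_interval.
apply: bigcup_connected.
  by exists (gamma 0) => i _; left; exists 0; rewrite //= in_itv /= lexx ler01.
move=> [t v] /= [ht hv]; apply: connectedU.
- exists (gamma t); split; first by exists t; rewrite //= in_itv.
  by exists 0; rewrite /= ?in_itv /= ?lexx ?ler01// mul0r addr0.
- exact: (connected_continuous_connected cI cg).
- apply: (connected_continuous_connected cI).
  apply/cabs_within_continuous => s _ e e0.
  have K0 : 0 < cabs (v - gamma t) + 1 by rewrite ltr_wpDl ?cabs_ge0.
  exists (e / (cabs (v - gamma t) + 1)); first by rewrite divr_gt0.
  move=> s' _; rewrite ltr_pdivlMr// => h.
  have -> : gamma t + s'%:C * (v - gamma t) - (gamma t + s%:C * (v - gamma t)) =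
    (s' - s)%:C * (v - gamma t).
    by rewrite rmorphB /=; ring.
  rewrite cabsM cabsC; apply: le_lt_trans h; by rewrite ler_wpM2l// lerDl.
Qed.

Definition lat (del : R) (p : pt) : C := (p.1%:~R * del) +i* (p.2%:~R * del).

Definition rnd (del x : R) : int := Num.floor (x / del + 2^-1).

Definition rndC (del : R) (z : C) : pt := (rnd del (complex.Re z), rnd del
  (complex.Im z)).

Lemma rnd_close (del x : R) : 0 < del -> `|x - (rnd del x)%:~R * del| <= del /
  2.
Proof.
move=> d0; have := floor_le (x / del + 2^-1); have :=
  floorD1_gt (x / del + 2^-1).
rewrite intrD -/(rnd del x); set n := (rnd del x)%:~R => h1 h2.
have h3 : n * del <= x + del / 2.
  by rewrite -ler_pdivlMr// mulrDl mulrAC divff ?gt_eqF// mul1r.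
have h4 : x + del / 2 < (n + 1) * del.
  by rewrite -ltr_pdivrMr// mulrDl mulrAC divff ?gt_eqF// mul1r.
by move: h3 h4; clear; move: (n * del) (mulrDl n 1 del) => u ->;
  rewrite ler_norml mul1r => h3 h4; lra.
Qed.

Lemma lat_rndC (del : R) (z : C) : 0 < del ->
  cabs (lat del (rndC del z) - z) <= del.
Proof.
move=> d0; rewrite cabsBC; apply: le_trans (cabs_le _ _) _.
rewrite !ReImE /= [leRHS]splitr; apply: lerD; exact: rnd_close.
Qed.

Lemma int_close (del : R) (m n : int) : 0 < del ->
  `|m%:~R * del - n%:~R * del| < 2 * del -> -1 <= m - n <= 1.
Proof.
move=> d0; rewrite -mulrBl normrM (gtr0_norm d0) ltr_pM2r// -intrB -intr_norm.
rewrite (_ : (2 : R) = (2 : int)%:~R)// ltr_int; lia.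
Qed.

Lemma lat_dist (del : R) (p q : pt) (k : int) : 0 < del ->
  -k <= p.1 - q.1 <= k ->
  -k <= p.2 - q.2 <= k -> cabs (lat del p - lat del q) <= 2 * k%:~R * del.
Proof.
move=> d0 h1 h2; apply: le_trans (cabs_le _ _) _; rewrite !ReImE /=.
have key (a b : int) : -k <= a - b <= k ->
  `|a%:~R * del - b%:~R * del| <= k%:~R * del.
  move=> h; rewrite -mulrBl normrM (gtr0_norm d0) ler_pM2r// -intrB -intr_norm.
  by rewrite ler_int; lia.
have -> : 2 * k%:~R * del = k%:~R * del + k%:~R * del by ring.
by apply: lerD; exact: key.
Qed.

(** Isolates what function theory contributes, so that contracting curves becomes a matter of plane
    topology. *)
Definition no_holes (F : set C) := forall (K W : set C) (B : R),
  compact K -> connected K -> K `<=` F -> open W -> (forall z, W z ->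
    cabs z <= B) ->
  (forall z, closure W z -> ~ W z -> K z) -> W `<=` F.

Definition is_hole (V0 : seq pt) q := ~ mems V0 q /\ ~ escapes (mems V0) q.

(** The open squares of half-side [del] around all holes form a bounded open set. A boundary point
    has a nearest lattice point that is 8-adjacent to a hole without being one, hence lies in [V0]
    and close to the curve: the boundary is contained in the tube of radius [6 * del]. *)
Lemma hole_square_sub (F : set C) (gamma : R ->
  C) (del : R) (V0 : seq pt) : no_holes F ->
  {within `[0, 1], continuous gamma} -> 0 < del ->
  (forall t (w : C), 0 <= t <= 1 -> cabs (w - gamma t) <= 50 * del -> F w) ->
  (forall q, mems V0 q -> exists2 t, 0 <= t <= 1 & cabs (lat del q - gamma t) <=
    3 * del) ->
  (exists N : int, forall q, is_hole V0 q ->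
    -N <= q.1 <= N /\ -N <= q.2 <= N) ->
  forall q (w : C), is_hole V0 q -> `|complex.Re (w - lat del q)| < del ->
    `|complex.Im (w - lat del q)| < del -> F w.
Proof.
move=> nh cg d0 gF V0g [N hN] q w hq hw1 hw2.
pose W : set C := [set w | exists q, [/\ is_hole V0 q, `|complex.Re (w - lat del
  q)| < del &
   `|complex.Im (w - lat del q)| < del]].
have nhole (r r' : pt) : is_hole V0 r -> a8 r r' -> ~ mems V0 r' ->
  is_hole V0 r'.
  move=> [nr er] rr' nr'; split=> // er'; apply: er; exact: escapes_step er'.
suff : W `<=` F by apply; exists q.
have r0 : 0 <= 6 * del by rewrite mulr_ge0// ltW.
apply: (nh (tube gamma (6 * del)) W (2 * N%:~R * del + 2 * del)) => //.
- exact: tube_compact.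
- exact: tube_connected.
- move=> v [t ht hv]; apply: (gF t) => //; apply: le_trans hv _;
  rewrite ler_pM2r//; lra.
- apply/open_cabs => v [r [hr h1 h2]].
  exists (Num.min (del - `|complex.Re (v - lat del r)|) (del - `|complex.Im (v -
    lat del r)|)).
    by rewrite lt_min !subr_gt0 h1.
  move=> v'; rewrite lt_min => /andP[v1 v2]; exists r.
  have E : v' - lat del r = (v' - v) + (v - lat del r) by ring.
  split=> //; rewrite E.
    rewrite cReD; apply: le_lt_trans (ler_normD _ _) _.
    by have := Re_le_cabs _ (v' - v); clear - v1; lra.
  rewrite cImD; apply: le_lt_trans (ler_normD _ _) _.
  by have := Im_le_cabs _ (v' - v); clear - v2; lra.
- move=> v [r [hr h1 h2]].
  have -> : v = (lat del r - lat del (0, 0)) + (v - lat del r).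
    have -> : lat del (0, 0) = 0 by rewrite /lat /= !mul0r.
    by ring.
  apply: le_trans (cabsD _ _ _) _; apply: lerD.
    by apply: lat_dist => //=; rewrite subr0; have := hN _ hr; lia.
  apply: le_trans (cabs_le _ _) _; rewrite mulr2n mulrDl mul1r; apply: lerD;
    exact: ltW.
move=> z /closure_cabs cz nWz.
have [|v [r [hr h1 h2]] hv] := cz (del / 4); first by rewrite divr_gt0.
pose q' := rndC del z.
have k1 := rnd_close del (complex.Re z) d0; have k2 :=
  rnd_close del (complex.Im z) d0.
(* The distances add up to less than two mesh widths, so the integers differ by at most one. *)
have E (a b c n m : R) : `|a - n| < del -> `|a - b| < del / 4 ->
  `|b - m| <= del / 2 -> `|n - m| < 2 * del.
  rewrite !ltr_norml !ler_norml; clear; lra.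
have rq : a8 r q'.
  split; apply: (int_close del) => //.
    apply: (E (complex.Re v) (complex.Re z)) k1 => //; first by move: h1;
      rewrite !ReImE.
    by have := Re_le_cabs _ (v - z); rewrite !ReImE => h;
      exact: le_lt_trans h hv.
  apply: (E (complex.Im v) (complex.Im z)) k2 => //; first by move: h2;
    rewrite !ReImE.
  by have := Im_le_cabs _ (v - z); rewrite !ReImE => h; exact: le_lt_trans h hv.
have [V0q'|nV0q'] := pselect (mems V0 q').
  have [t ht hq'] := V0g _ V0q'; exists t => //.
  apply: le_trans (cabs_triangle _ _ _ (lat del q')) _.
  have := lat_rndC del z d0; rewrite cabsBC -/q'; clear - d0 hq'; lra.
exfalso; apply: nWz; exists q'; split; first exact: nhole hr rq nV0q'.
  rewrite !ReImE /=; apply: le_lt_trans k1 _; clear - d0; lra.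
rewrite !ReImE /=; apply: le_lt_trans k2 _; clear - d0; lra.
Qed.

(** Either [V0] comes within 12 steps of [q], and then [w] is within 10 + 24 + 3 mesh widths of the
    curve; or the whole lattice block around [q] consists of holes and contains the lattice point
    nearest to [w]. *)
Lemma filled_ball_sub (F : set C) (gamma : R ->
  C) (del : R) (V0 : seq pt) : no_holes F ->
  {within `[0, 1], continuous gamma} -> 0 < del ->
  (forall t (w : C), 0 <= t <= 1 -> cabs (w - gamma t) <= 50 * del -> F w) ->
  (forall q, mems V0 q -> exists2 t, 0 <= t <= 1 & cabs (lat del q - gamma t) <=
    3 * del) ->
  (exists N : int, forall q, is_hole V0 q ->
    -N <= q.1 <= N /\ -N <= q.2 <= N) ->
  forall q (w : C), mems V0 q \/ is_hole V0 q ->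
    cabs (w - lat del q) <= 10 * del -> F w.
Proof.
move=> nh cg d0 gF V0g Nb q w Vq hw.
have sq := hole_square_sub F gamma del V0 nh cg d0 gF V0g Nb.
have [[v [V0v v1 v2]]|far] := pselect (exists v, [/\ mems V0 v, -12 <= v.1 - q.1
  <= 12 & -12 <= v.2 - q.2 <= 12]).
  have [t ht hv] := V0g v V0v; apply: (gF t) => //.
  have h1 := lat_dist del v q 12 d0 v1 v2.
  have h2 := cabs_triangle _ w (gamma t) (lat del q).
  have h3 := cabs_triangle _ (lat del q) (gamma t) (lat del v).
  rewrite (cabsBC _ (lat del q) (lat del v)) in h3.
  have E : 2 * 12%:~R * del = 24 * del by rewrite (_ : (12%:~R : R) = 12)//;
    ring.
  by move: h1; rewrite E; clear - d0 hv hw h2 h3; lra.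
have hq : is_hole V0 q.
  by case: Vq => // V0q; exfalso; apply: far; exists q; split => //; lia.
have holes (n : nat) (r : pt) : (n <= 12)%N -> -(n%:Z) <= r.1 - q.1 <= n%:Z ->
  -(n%:Z) <= r.2 - q.2 <= n%:Z ->
    is_hole V0 r.
  elim: n r => [|n IH] r n12 h1 h2.
    by have -> : r = q by apply: pt_eq; lia.
  have nr : ~ mems V0 r by move=> V0r; apply: far; exists r; split => //; lia.
  (* [r'] is one step closer to [q] in each coordinate where they differ, so the holes spread
     outwards from [q]. *)
  split=> // er; pose r' : pt := (r.1 - Num.sg (r.1 - q.1), r.2 - Num.sg (r.2 -
    q.2)).
  have sg (x : int) : [\/ x < 0 /\ Num.sg x = -1, x = 0 /\ Num.sg x = 0 | 0 < x
    /\ Num.sg x = 1].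
    case: (ltrgtP x 0) => h; first by apply: Or31; rewrite ltr0_sg.
      by apply: Or33; rewrite gtr0_sg.
    by apply: Or32; rewrite h sgr0.
  have g1 := sg (r.1 - q.1); have g2 := sg (r.2 - q.2).
  have [|||nr' ner'] := IH r'; [lia|by rewrite /r' /=; case: g1 => -[? ->];
    lia|by rewrite /r' /=; case: g2 => -[? ->]; lia|].
  apply: ner'; apply: (escapes_step _ _ r) => //.
  by rewrite /a8 /r' /=; case: g1 => -[? ->]; case: g2 => -[? ->]; lia.
pose q' := rndC del w.
have k1 := rnd_close del (complex.Re w) d0; have k2 :=
  rnd_close del (complex.Im w) d0.
(* A distance of [10 * del] plus a rounding error of [del / 2] stays below 12 mesh widths. *)
have near (x : R) (m n : int) : `|x - m%:~R * del| <= 10 * del ->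
  `|x - n%:~R * del| <= del / 2 -> -12%:Z <= n - m <= 12%:Z.
  move=> x1 x2; have h : `|n%:~R * del - m%:~R * del| < 12 * del.
    by move: x1 x2; rewrite ltr_norml !ler_norml; clear - d0; lra.
  move: h; rewrite -mulrBl normrM (gtr0_norm d0) ltr_pM2r// -intrB -intr_norm.
  rewrite (_ : (12 : R) = (12 : int)%:~R)// ltr_int; lia.
have hole' : is_hole V0 q'.
  apply: (holes 12%N) => //; apply: near.
  - by have := le_trans (Re_le_cabs _ _) hw; rewrite !ReImE /=; exact.
  - exact: k1.
  - by have := le_trans (Im_le_cabs _ _) hw; rewrite !ReImE /=; exact.
  - exact: k2.
apply: (sq q') => //; rewrite !ReImE /=.
  by apply: le_lt_trans k1 _; clear - d0; lra.
by apply: le_lt_trans k2 _; clear - d0; lra.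
Qed.

End Curves.

(** * Components of the Fatou set *)

Section Main.
Variable R : realType.
Implicit Types (t r e : R).
Local Notation cabs := (cabs R).
Local Notation hol := (hol R).
Local Notation C := (R[i]^o).

Lemma no_holes_null_homotopic (F : set C) (gamma : R -> C) :
  open F -> no_holes R F -> closed_curve_in F gamma ->
    null_homotopic_in F gamma.
Proof.
move=> oF nh [cg gF gam01].
have [rho rho0 hrho] := curve_margin R F gamma oF cg gF.
(* The factor 100 leaves [50 * del] strictly inside the margin [rho]. *)
pose del := rho / 100; have d0 : 0 < del by rewrite divr_gt0.
have gF' t (w : C) : 0 <= t <= 1 -> cabs (w - gamma t) <= 50 * del -> F w.
  move=> ht hw; apply: (hrho t) => //; apply: le_lt_trans hw _.
  by rewrite /del; clear - rho0; lra.
have [d dpos hd] := curve_uniformly_continuous R gamma cg del d0.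
pose N := (Num.truncn d^-1).+1.
have N0 : 0 < N%:R :> R by rewrite ltr0n.
have Nd : N%:R^-1 < d by rewrite -[ltRHS]invrK ltf_pV2 ?posrE ?invr_gt0//
  truncnS_gt.
pose tj (j : nat) : R := j%:R / N%:R.
have tj01 j : (j <= N)%N -> 0 <= tj j <= 1.
  by move=> jN; rewrite divr_ge0//= ler_pdivrMr// mul1r ler_nat.
pose p j := rndC R del (gamma (tj j)).
(* Consecutive roundings may be diagonal neighbours; the corner [m j] between them turns the path
   into a 4-path. *)
pose m j : pt := ((p j.+1).1, (p j).2).
have step (x y : R) : `|x - y| < del -> -1 <= rnd R del x - rnd R del y <= 1.
  move=> xy; apply: (int_close R del) => //.
  have := rnd_close R del x d0; have := rnd_close R del y d0.
  by move: xy; rewrite !ltr_norml !ler_norml; clear; lra.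
have pstep j : (j < N)%N -> -1 <= (p j).1 - (p j.+1).1 <= 1 /\ -1 <= (p j).2 -
  (p j.+1).2 <= 1.
  move=> jN; have h : cabs (gamma (tj j) - gamma (tj j.+1)) < del.
    apply: hd; [apply: tj01; exact: ltnW|exact: tj01|].
    rewrite /tj -mulrBl -natr1 opprD addrA subrr add0r normrM normrN1 mul1r.
    by rewrite normfV normr_nat.
  split; apply: step.
    by apply: le_lt_trans h; have := Re_le_cabs R (gamma (tj j) - gamma (tj
      j.+1)); rewrite !ReImE.
  by apply: le_lt_trans h; have := Im_le_cabs R (gamma (tj j) - gamma (tj
    j.+1)); rewrite !ReImE.
have pm j : (j < N)%N -> a4 (p j) (m j) by move=> /pstep; rewrite /a4 /m /=;
  lia.
have mp j : (j < N)%N -> a4 (m j) (p j.+1) by move=> /pstep; rewrite /a4 /m /=;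
  lia.
pose V0 := [seq p j | j <- iota 0 N.+1] ++ [seq m j | j <- iota 0 N].
have V0p j : (j <= N)%N -> mems V0 (p j).
  by move=> jN; rewrite /mems mem_cat map_f// mem_iota add0n ltnS.
have V0m j : (j < N)%N -> mems V0 (m j).
  by move=> jN; rewrite /mems mem_cat (map_f m) ?orbT// mem_iota.
have V0E q : mems V0 q -> (exists2 j, (j <= N)%N & q = p j) \/ (exists2 j, (j <
  N)%N & q = m j).
  rewrite /mems mem_cat => /orP[/mapP[j]|/mapP[j]];
    rewrite mem_iota add0n => jN ->.
    by left; exists j.
  by right; exists j.
have pg j : cabs (lat R del (p j) - gamma (tj j)) <= del by exact: lat_rndC.
have V0g q : mems V0 q -> exists2 t, 0 <= t <= 1 & cabs (lat R del q - gamma t)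
  <= 3 * del.
  move=> /V0E[[j jN ->]|[j jN ->]]; exists (tj j); try by apply: tj01 => //;
    exact: ltnW.
    by apply: le_trans (pg j) _; clear - d0; lra.
  have h := lat_dist R del (m j) (p j) 1 d0; rewrite mulr1 in h.
  apply: le_trans (cabs_triangle _ _ _ (lat R del (p j))) _.
  have h2 : cabs (lat R del (m j) - lat R del (p j)) <= 2 * del.
    by apply: h; have := pstep _ jN; rewrite /m /=; lia.
  by have := pg j; clear - h2; lra.
have c0p j : (j <= N)%N -> conn a4 (mems V0) (p 0%N) (p j).
  elim: j => [_|j IH jN]; first by apply: conn_refl; exact: V0p.
  apply: conn_trans (IH (ltnW jN)) _.
  apply: (conn_step _ _ _ (m j)); [exact: V0p (ltnW jN)|exact: pm|].
  apply: (conn_step _ _ _ (p j.+1)); [exact: V0m|exact: mp|].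
  by apply: conn_refl; exact: V0p.
have c0 q : mems V0 q -> conn a4 (mems V0) (p 0%N) q.
  move=> /V0E[[j jN ->]|[j jN ->]]; first exact: c0p.
  apply: conn_trans (c0p j (ltnW jN)) _.
  apply: (conn_step _ _ _ (m j)); [exact: V0p (ltnW jN)|exact: pm|].
  by apply: conn_refl; exact: V0m.
have conV0 : connected_pts V0.
  by move=> x y /c0 cx /c0 cy; apply: conn_trans cy; apply: conn_sym cx;
    exact: a4_sym.
have [|V [conV hV VE]] := fill_holes V0 conV0; first by exists (p 0%N);
  exact: V0p.
have V0V q : mems V0 q -> mems V q by move=> h; apply/VE; left.
have [Nb hNb] := mems_bounded V.
have ballF (q : pt) (w : C) : mems V q -> cabs (w - lat R del q) <= 10 * del ->
  F w.
  move=> /VE Vq; apply: (filled_ball_sub R F gamma del V0) => //.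
  by exists Nb => r hr; apply: hNb; apply/VE; right.
have Vp j : (j <= N)%N -> mems V (p j) by move=> /V0p /V0V.
have [//|//|M [h [h0 hM Vh ah hh]]] := deform_seq (mems V) (p 0%N) id
  (hole_free_deform V (p 0%N) conV hV (Vp 0%N (leq0n _))).
pose P i j := lat R del (h i (p j)).
(* Stages preserve 4-adjacency along [p j], [m j], [p j.+1], so the images are at most two steps
   apart in each coordinate. One more step between stages makes 3, that is, a distance of at most
   [6 * del]. *)
have near2 i (j : nat) : (j < N)%N -> -2 <= (h i (p j)).1 - (h i (p j.+1)).1 <=
  2 /\
   -2 <= (h i (p j)).2 - (h i (p j.+1)).2 <= 2.
  move=> jN; have Vm := V0V _ (V0m j jN).
  have := ah i _ _ (Vp j (ltnW jN)) Vm (pm j jN).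
  have := ah i _ _ Vm (Vp j.+1 jN) (mp j jN).
  by rewrite /a4; lia.
have nearj i (j j' : nat) : (j <= N)%N -> (j' <= N)%N -> (j <= j'.+1)%N ->
  (j' <= j.+1)%N ->
   -2 <= (h i (p j)).1 - (h i (p j')).1 <= 2 /\ -2 <= (h i (p j)).2 - (h i (p
     j')).2 <= 2.
  move=> jN j'N jj' j'j.
  have [e|[e|e]] : j = j' \/ j' = j.+1 \/ j = j'.+1 by lia.
  - by rewrite e; lia.
  - by rewrite e; apply: near2; rewrite -e.
  - by have := near2 i j'; rewrite -e => /(_ jN); lia.
have neari i i' x : mems V x -> (i <= i'.+1)%N -> (i' <= i.+1)%N ->
  a8 (h i x) (h i' x).
  move=> Vx ii' i'i; have [->|[->|->]] : i = i' \/ i' = i.+1 \/ i = i'.+1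
    by lia.
  - exact: a8_refl.
  - exact: hh.
  - by apply: a8_sym; exact: hh.
apply: (grid_null_homotopy R F gamma M N P (lat R del (p 0%N)) (10 * del)) =>
  //.
- by move=> i j w _ jN; apply: ballF; apply: Vh; exact: Vp.
- move=> i i' j j' _ _ jN j'N ii' i'i jj' j'j.
  have [a1 a2] := nearj i j j' jN j'N jj' j'j; have [b1 b2] :=
    neari i i' _ (Vp j' j'N) ii' i'i.
  apply: le_trans (lat_dist R del _ _ 3 d0 _ _) _; [lia|lia|].
  by rewrite ler_pM2r// (_ : (3%:~R : R) = 3)//; clear; lra.
- move=> j t jN ht hj; rewrite /P h0 /=.
  apply: le_trans (cabs_triangle _ _ _ (gamma (tj j))) _.
  have h1 : cabs (gamma t - gamma (tj j)) < del.
    apply: hd => //; first exact: tj01.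
    apply: le_lt_trans Nd; rewrite -[leRHS]mul1r ler_pdivlMr// -(gtr0_norm N0)
      -normrM.
    by rewrite mulrBl /tj divfK ?gt_eqF// mulrC ltW.
  apply: le_trans (lerD (ltW h1) (_ : _ <= del)) _; last by clear - d0; lra.
  by rewrite cabsBC; exact: pg.
- by move=> i _; rewrite /P /p /tj mul0r divff ?gt_eqF// gam01.
- by move=> j jN; rewrite /P hM//; exact: Vp.
Qed.

Lemma fatou_set_open (G : set (C -> C)) : open (fatou_set G).
Proof. by apply: bigcup_open => W []. Qed.

(** The image of the homotopy is connected and meets the component at [gamma 0], so it stays
    inside. *)
Lemma null_homotopic_in_component (F : set C) (z : C) (gamma : R -> C) :
  closed_curve_in (connected_component F z) gamma ->
    null_homotopic_in F gamma ->
  null_homotopic_in (connected_component F z) gamma.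
Proof.
move=> [_ gU _] [H [c [cH HF H0 H1 Hs]]]; exists H, c; split => //.
set Q := `[0, 1] `*` `[0, 1] in cH HF *.
have i01 (t : R) : 0 <= t <= 1 -> `[0, 1]%classic t by move=> h;
  rewrite /= in_itv.
have conQ : connected (H @` Q).
  apply: (connected_continuous_connected _ cH).
  have cI : connected (`[0, 1]%classic : set R) by apply/connected_intervalP;
    exact: interval_is_interval.
  have cpair1 (s : R) : continuous (fun t : R => (s, t)).
    move=> t A [[A1 A2] /= [n1 n2] sA]; apply: filterS n2 => u Au.
    by apply: (sA (s, u)); split => //; exact: nbhs_singleton n1.
  have cpair2 (s : R) : continuous (fun t : R => (t, s)).
    move=> t A [[A1 A2] /= [n1 n2] sA]; apply: filterS n1 => u Au.
    by apply: (sA (u, s)); split => //; exact: nbhs_singleton n2.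
  (* The square as a union of connected pieces: each is a segment with first coordinate [s], joined
     to the common side where the second coordinate is 0. *)
  have -> : Q = \bigcup_(s in `[0, 1]%classic) (((fun t : R => (s, t)) @` `[0,
    1]) `|` ((fun t : R => (t, 0)) @` `[0, 1])).
    apply/seteqP; split=> [[s t] [hs ht]|[s t] [s' hs' [[t' ht' [<- <-]]|[t' ht'
      [<- <-]]]]].
    - by exists s => //; left; exists t.
    - by split.
    - by split=> //; apply: i01; rewrite lexx ler01.
  apply: bigcup_connected.
    exists (0, 0) => s _; right; exists 0 => //; apply: i01;
      by rewrite lexx ler01.
  move=> s hs; apply: connectedU.
  - exists (s, 0); split; last by exists s.
    by exists 0 => //; apply: i01; rewrite lexx ler01.
  - exact: (connected_continuous_connected cI (continuous_subspaceT (cpair1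
    s))).
  - exact: (connected_continuous_connected cI (continuous_subspaceT (cpair2
    0))).
have U0 : connected_component F z (gamma 0).
  by apply: gU; exists 0 => //; apply: i01; rewrite lexx ler01.
have [A [Az AF cA] Ag0] := U0.
have HQ0 : (H @` Q) (gamma 0).
  exists (0, 0); first by split; apply: i01; rewrite lexx ler01.
  by apply: H0; rewrite lexx ler01.
apply: (@subset_trans _ (A `|` H @` Q)); first exact: subsetUr.
apply: connected_component_max; first by left.
  by rewrite subUset.
by apply: connectedU => //; exists (gamma 0).
Qed.

Lemma generated_semigroup_hol (n : nat) (g : 'I_n -> C -> C) f :
  (forall i z, hol (g i) z) -> generated_semigroup g f -> forall z, hol f z.
Proof.
move=> hg; elim=> {f} [i z|f h _ hf _ hh z]; first exact: hg.
exact: (hol_comp R h f z (hh z) (hf _)).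
Qed.

End Main.

Theorem theorem3p10 (R : realType) (n : nat) (n_gt0 : (0 < n)%N)
    (g : 'I_n -> R[i]^o -> R[i]^o)
    (g_trans : forall i : 'I_n, transcendental_entire (g i))
    (Gamma : 'I_n -> set R[i]^o)
    (Gamma_infty : forall i : 'I_n, curve_to_infty (Gamma i))
    (g_bounded : forall i : 'I_n, [bounded g i z | z in Gamma i]) :
  forall z : R[i]^o, fatou_set (generated_semigroup g) z ->
    simply_connected
      (connected_component (fatou_set (generated_semigroup g)) z).
Proof.
move=> z Fz; split; first exact: component_connected.
move=> gamma hgamma; apply: null_homotopic_in_component => //.
have [cg gU gam01] := hgamma.
apply: no_holes_null_homotopic; first exact: fatou_set_open.
  move=> K W B cK conK KF oW bW bdK.
  have hg i w : hol R (g i) w by have [ent _] := g_trans i; apply/derivable_hol;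
    exact: ent.
  pose i0 := Ordinal n_gt0.
  have [gam [cgam gaminf GammaE]] := Gamma_infty i0.
  have [Bd hBd] : exists Bd : R, forall w, Gamma i0 w -> cabs R (g i0 w) <= Bd.
    have [M [Mreal hM]] := g_bounded i0.
    have [M' ME] : exists M', M = M'%:C by move/complex_realP: Mreal.
    (* Boundedness gives the estimate for every number strictly above [M], hence the 1. *)
    exists (M' + 1) => w Gw; rewrite -lecR -normE; apply: hM Gw.
    by rewrite ME ltcR ltrDl.
  apply: (holes_in_fatou_set R K W (generated_semigroup g) (g i0) gam B Bd) =>
    //.
  - by move=> f Gf w; exact: generated_semigroup_hol Gf w.
  - by move=> f Gf; apply: generated_semigroup_comp => //;
    exact: generated_semigroup_gen.
  - move=> cst; have [_ [] ] := g_trans i0; exists ((g i0 0)%:P) => w.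
    by rewrite cst hornerC.
  - move=> M; have := gaminf M; apply: filterS => t; by rewrite normE ltcR.
  - move=> t t0; apply: hBd; rewrite GammaE; exists t => //;
    by rewrite /= in_itv /= t0.
split => //; apply: subset_trans gU _; exact: connected_component_sub.
Qed.
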